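(* Let $\gamma=(t,r,\pi/2,\phi)$ be a non-circular, non-radial equatorial null geodesic in the Reissner--Nordström--(anti) de Sitter metric with parameters $\lambda,M,Q$, with energy $E$ and angular momentum $L$. The map $\ell\mapsto\phi(\ell)$ (with $\ell$ the affine parameter) is a diffeomorphism onto its image, so that $\gamma$ may be re-parametrized using $\phi$; denote again by $r$ the re-parametrized coordinate $\phi\mapsto r(\phi)$, and let the dot denote $\mathrm d/\mathrm d\phi$. If $\lambda\ge -E^2/L^2$, then one may choose a root $\overline r\in\mathbb R$ of the quartic $(\lambda+E^2/L^2)x^4-x^2+2Mx-Q^2$, and if $$\delta=\lambda+\frac{E^2}{L^2},\quad c=4\overline r\delta,\quad \beta=6\overline r^2\delta-1,\quad \alpha=4\overline r^3\delta-2\overline r+2M,$$ $$g_2:=\frac14\left(\frac{\beta^2}{3}-\alpha c\right),\quad g_3:=\frac18\left(\frac{\alpha\beta c}{6}-\frac{\alpha^2\delta}{2}-\frac{\beta^3}{27}\right),\quad P:=\frac{\alpha}{4(r-\overline r)}+\frac{\beta}{12},$$ then the function $P$ satisfies the Weierstrass equation $$\dot P^2=4P^3-g_2P-g_3.$$ In other words, if the discriminant $g_2^3-27g_3^2\neq0$, then the polar radial motion is given by $$r(\phi)=\overline r+\frac{\alpha}{4\wp(\phi)-\beta/3},$$ where $\wp=\wp_{g_2,g_3}$ is the Weierstrass function associated to $(g_2,g_3)\in\mathbb R^2$.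
   Context: The Reissner--Nordström--(anti) de Sitter (RNdS) metric with parameters $\lambda\in\mathbb R$, $M,Q\ge0$ is, in spherical coordinates $(t,r,\theta,\phi)$, $$\mathrm ds^2=-\underline\Delta\,\mathrm dt^2+\frac{\mathrm dr^2}{\underline\Delta}+r^2(\mathrm d\theta^2+\sin^2\theta\,\mathrm d\phi^2),\qquad \underline\Delta=1-\lambda r^2-\frac{2M}{r}+\frac{Q^2}{r^2}.$$ For an equatorial ($\theta\equiv\pi/2$) null geodesic (photon path) with affine parameter $\ell$, the energy $E=\underline\Delta\,\frac{\mathrm dt}{\mathrm d\ell}$ and the angular momentum $L=r^2\frac{\mathrm d\phi}{\mathrm d\ell}$ are constant. Radial means $\mathrm d\phi/\mathrm d\ell\equiv0$ (equivalently $L=0$); circular means $r$ is constant. The function $\wp_{g_2,g_3}$ is the Weierstrass elliptic function with invariants $g_2,g_3$, satisfying $(\wp')^2=4\wp^3-g_2\wp-g_3$.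
   Formalization: The closed formula is proved with ℘(φ+z₀) for some complex constant z₀ (and r = r̄ at the poles) in place of ℘(φ): translating φ preserves all hypotheses, so the formula without a phase fails for general non-circular geodesics. *)

(* Defs.v *)
From Stdlib Require Import Reals ZArith.
From Coquelicot Require Import Coquelicot.
Open Scope R_scope.

Inductive coord : Set := ct | cr | ctheta | cphi.

Definition coord_eqb (i j : coord) : bool :=
  match i, j with
  | ct, ct | cr, cr | ctheta, ctheta | cphi, cphi => true
  | _, _ => false
  end.

Definition point : Type := coord -> R.

Definition upd (x : point) (i : coord) (s : R) : point :=
  fun j => if coord_eqb i j then s else x j.

Definition csum (f : coord -> R) : R := f ct + f cr + f ctheta + f cphi.

Definition partial (i : coord) (F : point -> R) (x : point) : R :=
  Derive (fun s => F (upd x i s)) (x i).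

Definition tensor2 : Type := point -> coord -> coord -> R.

(** [christoffel g ginv x k i j] is the symbol of the second kind with upper
    index [k]; [ginv] is meant to be the inverse matrix of [g]. *)
Definition christoffel (g ginv : tensor2) (x : point) (k i j : coord) : R :=
  / 2 * csum (fun l => ginv x k l *
    (partial i (fun y => g y j l) x + partial j (fun y => g y i l) x
     - partial l (fun y => g y i j) x)).

Definition curve : Type := R -> point.

Definition vel (gamma : curve) (l : R) (i : coord) : R :=
  Derive (fun s => gamma s i) l.

Definition acc (gamma : curve) (l : R) (i : coord) : R :=
  Derive_n (fun s => gamma s i) 2 l.

Definition open_interval (I : R -> Prop) : Prop :=
  open I /\ forall x y z, I x -> I z -> x <= y <= z -> I y.

Definition smooth_on (I : R -> Prop) (f : R -> R) : Prop :=
  forall (n : nat) (x : R), I x -> ex_derive_n f n x.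

(** [U] is the domain of the chart; the curve only matters on [I]. *)
Record is_geodesic (g ginv : tensor2) (U : point -> Prop)
    (I : R -> Prop) (gamma : curve) : Prop := {
  geodesic_interval : open_interval I;
  geodesic_chart : forall l, I l -> U (gamma l);
  geodesic_smooth : forall i, smooth_on I (fun l => gamma l i);
  geodesic_eq : forall l k, I l ->
    acc gamma l k
    + csum (fun i => csum (fun j =>
        christoffel g ginv (gamma l) k i j * vel gamma l i * vel gamma l j))
    = 0
}.

Definition is_null (g : tensor2) (I : R -> Prop) (gamma : curve) : Prop :=
  forall l, I l ->
    csum (fun i => csum (fun j =>
      g (gamma l) i j * vel gamma l i * vel gamma l j)) = 0.

Definition RNdS_Delta (lambda M Q r : R) : R :=
  1 - lambda * r ^ 2 - 2 * M / r + Q ^ 2 / r ^ 2.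

Definition RNdS_diag (lambda M Q : R) (x : point) (i : coord) : R :=
  match i with
  | ct => - RNdS_Delta lambda M Q (x cr)
  | cr => / RNdS_Delta lambda M Q (x cr)
  | ctheta => x cr ^ 2
  | cphi => x cr ^ 2 * sin (x ctheta) ^ 2
  end.

Definition RNdS (lambda M Q : R) : tensor2 := fun x i j =>
  if coord_eqb i j then RNdS_diag lambda M Q x i else 0.

Definition RNdS_inv (lambda M Q : R) : tensor2 := fun x i j =>
  if coord_eqb i j then / RNdS_diag lambda M Q x i else 0.

(** Both signs of Delta are allowed.  The coordinate [phi] is not reduced
    modulo [2 * PI]: along a curve it is a continuous determination of the
    angle. *)
Definition RNdS_chart (lambda M Q : R) (x : point) : Prop :=
  0 < x cr /\ RNdS_Delta lambda M Q (x cr) <> 0 /\ 0 < x ctheta < PI.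

Definition is_null_geodesic (lambda M Q : R) (I : R -> Prop) (gamma : curve)
    : Prop :=
  is_geodesic (RNdS lambda M Q) (RNdS_inv lambda M Q)
    (RNdS_chart lambda M Q) I gamma
  /\ is_null (RNdS lambda M Q) I gamma.

Definition equatorial (I : R -> Prop) (gamma : curve) : Prop :=
  forall l, I l -> gamma l ctheta = PI / 2.

Definition circular (I : R -> Prop) (gamma : curve) : Prop :=
  exists r0, forall l, I l -> gamma l cr = r0.

Definition radial (I : R -> Prop) (gamma : curve) : Prop :=
  forall l, I l -> vel gamma l cphi = 0.

Definition has_energy (lambda M Q : R) (I : R -> Prop) (gamma : curve) (E : R)
    : Prop :=
  forall l, I l -> RNdS_Delta lambda M Q (gamma l cr) * vel gamma l ct = E.

Definition has_angular_momentum (I : R -> Prop) (gamma : curve) (L : R)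
    : Prop :=
  forall l, I l -> gamma l cr ^ 2 * vel gamma l cphi = L.

Definition image (I : R -> Prop) (f : R -> R) (y : R) : Prop :=
  exists x, I x /\ f x = y.

Definition diffeo_onto_image (I : R -> Prop) (f : R -> R) : Prop :=
  smooth_on I f /\ open (image I f) /\
  exists h : R -> R,
    (forall x, I x -> h (f x) = x) /\ smooth_on (image I f) h.

Definition lattice_basis (w1 w2 : C) : Prop := Im (w1 * Cconj w2)%C <> 0.

Definition lattice_point (w1 w2 : C) (m n : Z) : C :=
  (RtoC (IZR m) * w1 + RtoC (IZR n) * w2)%C.

Definition in_lattice (w1 w2 z : C) : Prop :=
  exists m n : Z, z = lattice_point w1 w2 m n.

(** Sum of [f w] over the [w = m w1 + n w2] with [(m,n) <> (0,0)] and
    [|m|, |n| <= N]. *)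
Definition lattice_partial_sum (w1 w2 : C) (f : C -> C) (N : nat) : C :=
  sum_n (fun i => sum_n (fun j =>
    let m := (Z.of_nat i - Z.of_nat N)%Z in
    let n := (Z.of_nat j - Z.of_nat N)%Z in
    if (Z.eqb m 0 && Z.eqb n 0)%bool then RtoC 0
    else f (lattice_point w1 w2 m n)) (2 * N)) (2 * N).

(** All the lattice sums below converge absolutely, so that summing over
    growing squares is no restriction. *)
Definition lattice_sum (w1 w2 : C) (f : C -> C) : C :=
  (real (Lim_seq (fun N => Re (lattice_partial_sum w1 w2 f N))),
   real (Lim_seq (fun N => Im (lattice_partial_sum w1 w2 f N)))).

Definition lattice_g2 (w1 w2 : C) : C :=
  (60 * lattice_sum w1 w2 (fun w => / w ^ 4))%C.

Definition lattice_g3 (w1 w2 : C) : C :=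
  (140 * lattice_sum w1 w2 (fun w => / w ^ 6))%C.

(** Only meaningful off the lattice, whose points are the poles. *)
Definition wp (w1 w2 z : C) : C :=
  (/ z ^ 2 + lattice_sum w1 w2 (fun w => / (z - w) ^ 2 - / w ^ 2))%C.

(** For such [w1 w2], the function [wp w1 w2] is the Weierstrass function with
    real invariants [g2], [g3]. *)
Definition has_invariants (w1 w2 : C) (g2 g3 : R) : Prop :=
  lattice_basis w1 w2 /\
  lattice_g2 w1 w2 = RtoC g2 /\ lattice_g3 w1 w2 = RtoC g3.

(** [r = rbar + alpha / (4 wp(phi + z0) - beta / 3)] for all [phi] in [J], where
    at a pole of [wp] the right-hand side takes its limit value [rbar].  As
    [wp' ^ 2 = 4 wp ^ 3 - g2 wp - g3] is autonomous, its solutions are the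
    translates of [wp]; the constant [z0] depends on the choice of the origin of
    [phi] and may be non-real: for instance, with three real half-period values
    [e3 < e2 < e1], the real solutions with values in [[e3, e2]] are translates
    of [wp] by a non-real half-period. *)
Definition weierstrass_motion (w1 w2 : C) (rbar alpha beta : R)
    (J : R -> Prop) (r : R -> R) (z0 : C) : Prop :=
  forall phi : R, J phi ->
    let z := (RtoC phi + z0)%C in
    let d := (4 * wp w1 w2 z - RtoC (beta / 3))%C in
    (in_lattice w1 w2 z -> r phi = rbar) /\
    (~ in_lattice w1 w2 z ->
       d <> RtoC 0 /\ RtoC (r phi) = (RtoC rbar + RtoC alpha / d)%C).

(* Main.v *)
Require Import Defs.
From Stdlib Require Import Reals Ranalysis5 ZArith Lra Lia Psatz Classical ClassicalEpsilon.
From Coquelicot Require Import Coquelicot.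
Open Scope R_scope.

(** Dividing the radial null condition by [phi' = L / r ^ 2] gives
    [rdot ^ 2 = delta r ^ 4 - r ^ 2 + 2 M r - Q ^ 2], and the radial geodesic
    equation gives [rddot] as half the derivative of this quartic; the quartic is
    [- Q ^ 2 <= 0] at [0] and nonnegative along the motion, hence has a root.
    Expanding it at a root [rbar] turns the first equation into the Weierstrass
    equation for [P].

    For the explicit solution, the differential equations of [wp] and its
    surjectivity onto [C] come from one Liouville principle: an elliptic function
    that is holomorphic off the lattice and tends to [0] at the lattice points
    vanishes, because by the mean value property its real part is constant on the
    largest disc, free of lattice points, around a maximum point, and the boundary
    of that disc contains a lattice point.  Surjectivity provides [z0] such that
    [wp (phi + z0)] and [P] agree to first order at one [phi], and evenness of [wp]
    fixes the sign of the derivative.  They agree everywhere because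
    [v = (r - rbar) / alpha] and [1 / (4 wp - beta / 3)] solve the same second-order
    equation, which is regular also at the poles of [wp], where both vanish. *)

(** * Complex differentiability *)

(** Put [r = rbar + alpha * v]. Expanding the quartic at its root gives [vdot ^ 2 = v + beta v ^ 2 +
    alpha c v ^ 3 + alpha ^ 2 delta v ^ 4], and in terms of [1 / v] the right-hand side over [v ^ 4]
    is a cubic, whose quadratic term is removed by the shift [1 / v = 4 P - beta / 3]. This explains
    the constants in [P], [g2] and [g3]. The first-order equation does not determine its solutions:
    the sign of [vdot] is lost, and at a turning point a constant solution competes with the moving
    one. Its differentiated form [vddot = 1/2 + beta v + 3/2 alpha c v ^ 2 + 2 alpha ^ 2 delta v ^
    3] is polynomial, hence locally Lipschitz, and the radial geodesic equation supplies it at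
    turning points too. Matching is done for [v] and not for [P], since [P] blows up where
    [r = rbar]. The opposite danger, a zero of [4 wp - beta / 3], is excluded along the motion
    because [v] stays finite. Dividing by [alpha] is legitimate because a multiple root [rbar] would
    make the discriminant vanish. *)

(** The quadratic remainder is stronger than differentiability, holds for all
    the functions below, and makes the closure properties purely algebraic. *)
Definition cderiv (f : C -> C) (z l : C) : Prop :=
  exists eps K, 0 < eps /\
    forall h, Cmod h < eps -> Cmod (f (z + h) - f z - l * h)%C <= K * Cmod h ^ 2.

Definition ccont (f : C -> C) (z : C) : Prop :=
  forall eps, 0 < eps -> exists d, 0 < d /\
    forall h, Cmod h < d -> Cmod (f (z + h) - f z)%C < eps.

Lemma Cmod_minus_le (a b : C) : Cmod (a - b)%C <= Cmod a + Cmod b.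
Proof.
  replace (a - b)%C with (a + - b)%C by ring.
  rewrite <- (Cmod_opp b); apply Cmod_triangle.
Qed.

Lemma Cmod_minus_sym (a b : C) : Cmod (a - b)%C = Cmod (b - a)%C.
Proof. rewrite <- Cmod_opp; f_equal; ring. Qed.

Lemma Cmod_Im_le (z : C) : Rabs (Im z) <= Cmod z.
Proof. eapply Rle_trans; [apply Rmax_r|apply Rmax_Cmod]. Qed.

Lemma Cmod_le_Re_Im (z : C) : Cmod z <= Rabs (Re z) + Rabs (Im z).
Proof.
  replace z with (RtoC (Re z) + Ci * RtoC (Im z))%C at 1
    by (destruct z; apply injective_projections; simpl; ring).
  eapply Rle_trans; [apply Cmod_triangle|].
  rewrite Cmod_mult, Cmod_Ci, !Cmod_R. lra.
Qed.

Lemma Cmod_triangle_sub (a b : C) : Cmod a - Cmod b <= Cmod (a - b)%C.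
Proof.
  pose proof (Cmod_triangle (a - b)%C b) as H.
  replace (a - b + b)%C with a in H by ring. lra.
Qed.

Lemma cderiv_intro (f : C -> C) (z l : C) (eps K : R) : 0 < eps ->
  (forall h, Cmod h < eps -> Cmod (f (z + h) - f z - l * h)%C <= K * Cmod h ^ 2) ->
  cderiv f z l.
Proof. intros He H; exists eps, K; split; assumption. Qed.

(** Below radius 1 one has [|h| ^ 2 <= |h|], so a single constant serves for the quadratic remainder
    and for a Lipschitz bound; products, inverses and compositions are estimated from this pair. *)
Lemma cderiv_lip (f : C -> C) (z l : C) : cderiv f z l ->
  exists eps K, 0 < eps /\ 0 <= K /\ forall h, Cmod h < eps ->
    Cmod (f (z + h) - f z - l * h)%C <= K * Cmod h ^ 2 /\
    Cmod (f (z + h) - f z)%C <= K * Cmod h.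
Proof.
  intros (e & K & He & H).
  exists (Rmin e 1), (Rabs K + Cmod l).
  assert (HK := Rabs_pos K). assert (Hl := Cmod_ge_0 l).
  split; [apply Rmin_pos; lra|]. split; [lra|].
  intros h Hh.
  assert (Hh1 : Cmod h < e) by (eapply Rlt_le_trans; [exact Hh|apply Rmin_l]).
  assert (Hh2 : Cmod h < 1) by (eapply Rlt_le_trans; [exact Hh|apply Rmin_r]).
  specialize (H h Hh1). assert (H0 := Cmod_ge_0 h). assert (HK' := Rle_abs K).
  assert (H2 := pow2_ge_0 (Cmod h)).
  assert (Hq : Cmod (f (z + h) - f z - l * h)%C <= Rabs K * Cmod h ^ 2)
    by (eapply Rle_trans; [exact H|apply Rmult_le_compat_r; assumption]).
  split; [nra|].
  replace (f (z + h) - f z)%C with ((f (z + h) - f z - l * h) + l * h)%C by ring.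
  eapply Rle_trans; [apply Cmod_triangle|]. rewrite Cmod_mult.
  assert (Cmod h ^ 2 <= Cmod h) by nra.
  assert (Rabs K * Cmod h ^ 2 <= Rabs K * Cmod h) by (apply Rmult_le_compat_l; assumption).
  lra.
Qed.

Lemma cderiv_ccont (f : C -> C) (z l : C) : cderiv f z l -> ccont f z.
Proof.
  intros H; destruct (cderiv_lip f z l H) as (e & K & He & HK & Hf).
  intros eps Heps. exists (Rmin e (eps / (K + 1))).
  assert (0 < eps / (K + 1)) by (apply Rdiv_lt_0_compat; lra).
  split; [apply Rmin_pos; lra|]. intros h Hh.
  assert (Hh1 : Cmod h < e) by (eapply Rlt_le_trans; [exact Hh|apply Rmin_l]).
  assert (Hh2 : Cmod h < eps / (K + 1)) by (eapply Rlt_le_trans; [exact Hh|apply Rmin_r]).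
  destruct (Hf h Hh1) as [_ Hc]. eapply Rle_lt_trans; [exact Hc|].
  assert (Cmod h * (K + 1) < eps).
  { replace eps with (eps / (K + 1) * (K + 1)) at 1 by (field; lra).
    apply Rmult_lt_compat_r; lra. }
  assert (Hp0 := Cmod_ge_0 h). nra.
Qed.

Lemma ccont_ext (f g : C -> C) (z : C) :
  (exists eps, 0 < eps /\ forall h, Cmod h < eps -> f (z + h)%C = g (z + h)%C) ->
  ccont f z -> ccont g z.
Proof.
  intros (e & He & H) Hf eps Heps. destruct (Hf eps Heps) as (d & Hd & Hd').
  exists (Rmin e d). split; [apply Rmin_pos; lra|]. intros h Hh.
  assert (E0 : f z = g z).
  { specialize (H 0%C). rewrite Cmod_0 in H. rewrite !Cplus_0_r in H. auto. }
  rewrite <- E0, <- H by (eapply Rlt_le_trans; [exact Hh|apply Rmin_l]).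
  apply Hd'; eapply Rlt_le_trans; [exact Hh|apply Rmin_r].
Qed.

Lemma cderiv_ext (f g : C -> C) (z l : C) :
  (exists eps, 0 < eps /\ forall h, Cmod h < eps -> f (z + h)%C = g (z + h)%C) ->
  cderiv f z l -> cderiv g z l.
Proof.
  intros (e & He & H) (e' & K & He' & Hf).
  apply (cderiv_intro _ _ _ (Rmin e e') K); [apply Rmin_pos; lra|]. intros h Hh.
  assert (E0 : f z = g z).
  { specialize (H 0%C). rewrite Cmod_0 in H. rewrite !Cplus_0_r in H. auto. }
  rewrite <- E0, <- H by (eapply Rlt_le_trans; [exact Hh|apply Rmin_l]).
  apply Hf; eapply Rlt_le_trans; [exact Hh|apply Rmin_r].
Qed.

Lemma cderiv_const (c z : C) : cderiv (fun _ => c) z 0%C.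
Proof.
  apply (cderiv_intro _ _ _ 1 0); [lra|]. intros h _.
  replace (c - c - 0 * h)%C with (RtoC 0) by ring. rewrite Cmod_0. lra.
Qed.

Lemma cderiv_id (z : C) : cderiv (fun x => x) z 1%C.
Proof.
  apply (cderiv_intro _ _ _ 1 0); [lra|]. intros h _.
  replace (z + h - z - 1 * h)%C with (RtoC 0) by ring. rewrite Cmod_0. lra.
Qed.

Lemma cderiv_plus (f g : C -> C) (z l m : C) : cderiv f z l -> cderiv g z m ->
  cderiv (fun x => f x + g x)%C z (l + m)%C.
Proof.
  intros (e & K & He & H) (e' & K' & He' & H').
  apply (cderiv_intro _ _ _ (Rmin e e') (K + K')); [apply Rmin_pos; lra|].
  intros h Hh.
  replace (f (z + h) + g (z + h) - (f z + g z) - (l + m) * h)%C with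
    ((f (z + h) - f z - l * h) + (g (z + h) - g z - m * h))%C by ring.
  eapply Rle_trans; [apply Cmod_triangle|]. rewrite Rmult_plus_distr_r.
  apply Rplus_le_compat; [apply H|apply H'];
    (eapply Rlt_le_trans; [exact Hh|]); [apply Rmin_l|apply Rmin_r].
Qed.

Lemma cderiv_mult (f g : C -> C) (z l m : C) : cderiv f z l -> cderiv g z m ->
  cderiv (fun x => f x * g x)%C z (l * g z + f z * m)%C.
Proof.
  intros H H'.
  destruct (cderiv_lip _ _ _ H) as (e & K & He & HK & Hf).
  destruct (cderiv_lip _ _ _ H') as (e' & K' & He' & HK' & Hg).
  apply (cderiv_intro _ _ _ (Rmin e e') (K * Cmod (g z) + Cmod (f z) * K' + K * K'));
    [apply Rmin_pos; lra|].
  intros h Hh.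
  assert (Hh1 : Cmod h < e) by (eapply Rlt_le_trans; [exact Hh|apply Rmin_l]).
  assert (Hh2 : Cmod h < e') by (eapply Rlt_le_trans; [exact Hh|apply Rmin_r]).
  destruct (Hf h Hh1) as [F1 F2]. destruct (Hg h Hh2) as [G1 G2].
  replace (f (z + h) * g (z + h) - f z * g z - (l * g z + f z * m) * h)%C with
    ((f (z + h) - f z - l * h) * g z + f z * (g (z + h) - g z - m * h)
     + (f (z + h) - f z) * (g (z + h) - g z))%C by ring.
  eapply Rle_trans; [apply Cmod_triangle|].
  rewrite !Rmult_plus_distr_r. apply Rplus_le_compat.
  - eapply Rle_trans; [apply Cmod_triangle|]. rewrite !Cmod_mult.
    assert (A := Cmod_ge_0 (g z)). assert (B := Cmod_ge_0 (f z)).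
    apply Rplus_le_compat; nra.
  - rewrite Cmod_mult.
    replace (K * K' * Cmod h ^ 2) with ((K * Cmod h) * (K' * Cmod h)) by ring.
    apply Rmult_le_compat; try apply Cmod_ge_0; assumption.
Qed.

Lemma cderiv_inv (f : C -> C) (z l : C) : cderiv f z l -> f z <> 0%C ->
  cderiv (fun x => / f x)%C z (- l / (f z) ^ 2)%C.
Proof.
  intros H H0.
  destruct (cderiv_lip _ _ _ H) as (e & K & He & HK & Hf).
  set (a := Cmod (f z)). assert (Ha : 0 < a) by (apply Cmod_gt_0; exact H0).
  (* Within [e1] the Lipschitz bound keeps [f (z + h)] within [a / 2] of [f z], hence of modulus at
     least [a / 2]; the factor [2 / a ^ 3] below is the inverse of [a ^ 2 * (a / 2)]. *)
  set (e1 := a / (2 * (K + 1))).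
  assert (He1 : 0 < e1) by (apply Rdiv_lt_0_compat; lra).
  apply (cderiv_intro _ _ _ (Rmin e e1) ((K * a + Cmod l * K) * (2 / a ^ 3)));
    [apply Rmin_pos; lra|].
  intros h Hh.
  assert (Hh1 : Cmod h < e) by (eapply Rlt_le_trans; [exact Hh|apply Rmin_l]).
  assert (Hh2 : Cmod h < e1) by (eapply Rlt_le_trans; [exact Hh|apply Rmin_r]).
  destruct (Hf h Hh1) as [F1 F2].
  assert (Hp := Cmod_ge_0 h).
  assert (Hb : a / 2 <= Cmod (f (z + h)%C)).
  { assert (HT := Cmod_triangle_sub (f z) (f z - f (z + h))%C).
    replace (f z - (f z - f (z + h)))%C with (f (z + h)%C) in HT by ring.
    rewrite (Cmod_minus_sym (f z)) in HT. fold a in HT.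
    assert (e1 * (2 * (K + 1)) = a) by (unfold e1; field; lra). nra. }
  assert (Hn : f (z + h)%C <> 0%C) by (apply Cmod_gt_0; lra).
  replace (/ f (z + h) - / f z - - l / f z ^ 2 * h)%C with
    ((- (f (z + h) - f z - l * h) * f z + l * h * (f (z + h) - f z))
      * (/ (f z ^ 2 * f (z + h))))%C by (field; split; assumption).
  rewrite Cmod_mult, Cmod_inv by (apply Cmult_neq_0; [apply Cpow_nz|]; assumption).
  rewrite Cmod_mult, Cmod_pow. fold a.
  replace ((K * a + Cmod l * K) * (2 / a ^ 3) * Cmod h ^ 2) with
    (((K * a + Cmod l * K) * Cmod h ^ 2) * / (a ^ 2 * (a / 2))) by (field; lra).
  apply Rmult_le_compat; [apply Cmod_ge_0| | |].
  - left; apply Rinv_0_lt_compat. apply Rmult_lt_0_compat; [nra|lra].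
  - eapply Rle_trans; [apply Cmod_triangle|]. rewrite !Cmod_mult, Cmod_opp. fold a.
    assert (Q := Cmod_ge_0 l).
    replace ((K * a + Cmod l * K) * Cmod h ^ 2)
      with (K * Cmod h ^ 2 * a + Cmod l * Cmod h * (K * Cmod h)) by ring.
    apply Rplus_le_compat; [apply Rmult_le_compat_r; [lra|exact F1]|].
    apply Rmult_le_compat_l; [nra|exact F2].
  - apply Rinv_le_contravar; [apply Rmult_lt_0_compat; nra|].
    apply Rmult_le_compat_l; [nra|assumption].
Qed.

Lemma cderiv_unique (f : C -> C) (z l m : C) : cderiv f z l -> cderiv f z m -> l = m.
Proof.
  intros (e & K & He & H) (e' & K' & He' & H').
  destruct (Ceq_dec l m) as [E|E]; [exact E|exfalso].
  assert (Hd : 0 < Cmod (l - m)%C).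
  { apply Cmod_gt_0. intros Q. apply E.
    replace l with (l - m + m)%C by ring. rewrite Q. ring. }
  set (S := Rabs K + Rabs K' + 1).
  assert (HS : 0 < S) by (assert (A := Rabs_pos K); assert (B := Rabs_pos K'); unfold S; lra).
  (* Comparing both remainders at the real increment [t] gives [|l - m| <= S t]; the last bound on
     [t] makes this at most [|l - m| / 2]. *)
  set (t := Rmin (Rmin (e / 2) (e' / 2)) (Cmod (l - m)%C / (2 * S))).
  assert (Ht : 0 < t).
  { repeat apply Rmin_pos; try lra. apply Rdiv_lt_0_compat; lra. }
  assert (T1 : t <= e / 2) by (eapply Rle_trans; [apply Rmin_l|apply Rmin_l]).
  assert (T2 : t <= e' / 2) by (eapply Rle_trans; [apply Rmin_l|apply Rmin_r]).
  assert (T3 : t <= Cmod (l - m)%C / (2 * S)) by apply Rmin_r.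
  assert (Ct : Cmod (RtoC t) = t) by (rewrite Cmod_R, Rabs_pos_eq; lra).
  specialize (H (RtoC t)). specialize (H' (RtoC t)). rewrite Ct in H, H'.
  specialize (H ltac:(lra)). specialize (H' ltac:(lra)).
  assert (X := Cmod_minus_le (f (z + t) - f z - m * t)%C (f (z + t) - f z - l * t)%C).
  replace (f (z + t) - f z - m * t - (f (z + t) - f z - l * t))%C
    with ((l - m) * t)%C in X by ring.
  rewrite Cmod_mult, Ct in X.
  assert (K <= Rabs K) by apply Rle_abs. assert (K' <= Rabs K') by apply Rle_abs.
  assert (Y : Cmod (l - m)%C * t <= S * t * t) by (unfold S; nra).
  assert (Z : Cmod (l - m)%C <= S * t) by nra.
  assert (t * (2 * S) <= Cmod (l - m)%C).
  { replace (Cmod (l - m)%C) with (Cmod (l - m)%C / (2 * S) * (2 * S)) by (field; lra).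
    apply Rmult_le_compat_r; lra. }
  lra.
Qed.

Lemma cderiv_eq (f : C -> C) (z l m : C) : cderiv f z l -> l = m -> cderiv f z m.
Proof. intros H E; rewrite <- E; exact H. Qed.

Lemma cderiv_opp (f : C -> C) (z l : C) : cderiv f z l -> cderiv (fun x => - f x)%C z (- l)%C.
Proof.
  intros (e & K & He & H). apply (cderiv_intro _ _ _ e K He). intros h Hh.
  replace (- f (z + h) - - f z - - l * h)%C with (- (f (z + h) - f z - l * h))%C by ring.
  rewrite Cmod_opp. auto.
Qed.

Lemma cderiv_minus (f g : C -> C) (z l m : C) : cderiv f z l -> cderiv g z m ->
  cderiv (fun x => f x - g x)%C z (l - m)%C.
Proof. intros H H'. exact (cderiv_plus _ _ _ _ _ H (cderiv_opp _ _ _ H')). Qed.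

Lemma cderiv_pow (f : C -> C) (n : nat) (z l : C) : cderiv f z l ->
  cderiv (fun x => f x ^ S n)%C z (INR (S n) * f z ^ n * l)%C.
Proof.
  intros H. induction n as [|n IH].
  - apply cderiv_ext with f.
    + exists 1; split; [lra|]. intros; simpl; ring.
    + eapply cderiv_eq; [exact H|]. simpl. ring.
  - eapply cderiv_eq; [exact (cderiv_mult _ _ _ _ _ H IH)|].
    rewrite (S_INR (S n)), RtoC_plus, !Cpow_S. ring.
Qed.

Lemma cderiv_shift (f : C -> C) (a z l : C) :
  cderiv f (z + a)%C l -> cderiv (fun x => f (x + a))%C z l.
Proof.
  intros (e & K & He & H). apply (cderiv_intro _ _ _ e K He). intros h Hh.
  replace (z + h + a)%C with (z + a + h)%C by ring. auto.
Qed.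

Lemma ccont_scal (f : C -> C) (a z : C) : ccont f z -> ccont (fun x => a * f x)%C z.
Proof.
  intros H eps He. set (k := Cmod a + 1).
  assert (Ha := Cmod_ge_0 a). assert (Hk : 0 < k) by (unfold k; lra).
  destruct (H (eps / k)) as (d & Hd & H'); [apply Rdiv_lt_0_compat; lra|].
  exists d; split; [exact Hd|]. intros h Hh. specialize (H' h Hh).
  replace (a * f (z + h) - a * f z)%C with (a * (f (z + h) - f z))%C by ring.
  rewrite Cmod_mult.
  assert (eps = eps / k * k) by (field; lra).
  assert (X := Cmod_ge_0 (f (z + h) - f z)%C).
  apply Rle_lt_trans with (Cmod (f (z + h) - f z)%C * k); [unfold k; nra|nra].
Qed.

(** * Boundedness near a puncture *)

(** The [O(1)] of Laurent expansions at 0. The point 0 is left out because remainders are obtained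
    by dividing by powers of [h]. Closure under ring operations lets a tactic bound any explicit
    combination of remainders. *)
Definition bdd0 (f : C -> C) : Prop :=
  exists eps K, 0 < eps /\ forall h : C, h <> 0%C -> Cmod h < eps -> Cmod (f h) <= K.

Lemma bdd0_ext (f g : C -> C) :
  (exists eps, 0 < eps /\ forall h : C, h <> 0%C -> Cmod h < eps -> f h = g h) ->
  bdd0 f -> bdd0 g.
Proof.
  intros (e & He & H) (e' & K & He' & H').
  exists (Rmin e e'), K. split; [apply Rmin_pos; lra|]. intros h H0 Hh.
  rewrite <- H; [apply H'| |]; auto; (eapply Rlt_le_trans; [exact Hh|]);
    [apply Rmin_r|apply Rmin_l].
Qed.

Lemma bdd0_const (c : C) : bdd0 (fun _ => c).
Proof. exists 1, (Cmod c). split; [lra|]. intros; lra. Qed.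

Lemma bdd0_id : bdd0 (fun h => h).
Proof. exists 1, 1. split; [lra|]. intros; lra. Qed.

Lemma bdd0_plus (f g : C -> C) : bdd0 f -> bdd0 g -> bdd0 (fun h => f h + g h)%C.
Proof.
  intros (e & K & He & H) (e' & K' & He' & H').
  exists (Rmin e e'), (K + K'). split; [apply Rmin_pos; lra|]. intros h H0 Hh.
  eapply Rle_trans; [apply Cmod_triangle|]. apply Rplus_le_compat; [apply H|apply H'];
    auto; (eapply Rlt_le_trans; [exact Hh|]); [apply Rmin_l|apply Rmin_r].
Qed.

Lemma bdd0_mult (f g : C -> C) : bdd0 f -> bdd0 g -> bdd0 (fun h => f h * g h)%C.
Proof.
  intros (e & K & He & H) (e' & K' & He' & H').
  exists (Rmin e e'), (K * K'). split; [apply Rmin_pos; lra|]. intros h H0 Hh.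
  rewrite Cmod_mult. apply Rmult_le_compat; try apply Cmod_ge_0; [apply H|apply H'];
    auto; (eapply Rlt_le_trans; [exact Hh|]); [apply Rmin_l|apply Rmin_r].
Qed.

Lemma bdd0_opp (f : C -> C) : bdd0 f -> bdd0 (fun h => - f h)%C.
Proof.
  intros (e & K & He & H). exists e, K. split; [exact He|].
  intros h H0 Hh. rewrite Cmod_opp. auto.
Qed.

Lemma bdd0_pow (f : C -> C) (n : nat) : bdd0 f -> bdd0 (fun h => f h ^ n)%C.
Proof.
  intros H. induction n as [|n IH].
  - apply bdd0_ext with (fun _ => 1%C); [|apply bdd0_const].
    exists 1; split; [lra|]. intros; simpl; ring.
  - apply bdd0_ext with (fun h => f h * f h ^ n)%C; [|exact (bdd0_mult _ _ H IH)].
    exists 1; split; [lra|]. intros; rewrite Cpow_S; reflexivity.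
Qed.

Lemma bdd0_small (f : C -> C) (a : R) : bdd0 f -> 0 < a ->
  exists eps, 0 < eps /\ forall h : C, h <> 0%C -> Cmod h < eps -> Cmod (h * f h)%C < a.
Proof.
  intros (e & K & He & H) Ha. set (k := Rabs K + 1).
  assert (Hk : 0 < k) by (assert (A := Rabs_pos K); unfold k; lra).
  exists (Rmin e (a / k)).
  split; [apply Rmin_pos; [exact He|apply Rdiv_lt_0_compat; lra]|]. intros h H0 Hh.
  assert (Hh1 : Cmod h < e) by (eapply Rlt_le_trans; [exact Hh|apply Rmin_l]).
  assert (Hh2 : Cmod h < a / k) by (eapply Rlt_le_trans; [exact Hh|apply Rmin_r]).
  specialize (H h H0 Hh1). rewrite Cmod_mult.
  assert (Hp := Cmod_ge_0 h). assert (HK := Rle_abs K).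
  assert (a = a / k * k) by (field; lra).
  apply Rle_lt_trans with (Cmod h * k); [|nra].
  apply Rmult_le_compat_l; unfold k; lra.
Qed.

Lemma bdd0_inv (f : C -> C) (a : C) : bdd0 f -> a <> 0%C ->
  bdd0 (fun h => / (a + h * f h))%C /\
  exists eps, 0 < eps /\ forall h : C, h <> 0%C -> Cmod h < eps -> (a + h * f h)%C <> 0%C.
Proof.
  intros H Ha. assert (Pa : 0 < Cmod a) by (apply Cmod_gt_0; exact Ha).
  destruct (bdd0_small f (Cmod a / 2) H) as (e & He & Hs); [lra|].
  assert (L : forall h : C, h <> 0%C -> Cmod h < e -> Cmod a / 2 <= Cmod (a + h * f h)%C).
  { intros h H0 Hh. specialize (Hs h H0 Hh).
    assert (T := Cmod_triangle_sub a (- (h * f h))%C).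
    rewrite Cmod_opp in T.
    replace (a - - (h * f h))%C with (a + h * f h)%C in T by ring. lra. }
  split; exists e.
  - exists (/ (Cmod a / 2)). split; [exact He|]. intros h H0 Hh.
    specialize (L h H0 Hh).
    rewrite Cmod_inv by (apply Cmod_gt_0; lra). apply Rinv_le_contravar; lra.
  - split; [exact He|]. intros h H0 Hh. apply Cmod_gt_0. specialize (L h H0 Hh). lra.
Qed.

(** * Complex functions along real paths *)

(** Differentiability is taken componentwise, so that real integrals and the real mean value theorem
    apply to [Re] and [Im]. *)
Definition pderiv (p : R -> C) (t : R) (v : C) : Prop :=
  is_derive (fun s => Re (p s)) t (Re v) /\ is_derive (fun s => Im (p s)) t (Im v).

Lemma pderiv_intro (p : R -> C) (t : R) (v : C) :
  (forall eps, 0 < eps -> exists d, 0 < d /\ forall s, Rabs s < d ->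
     Cmod (p (t + s)%R - p t - v * s)%C <= eps * Rabs s) -> pderiv p t v.
Proof.
  intros H. split; apply is_derive_Reals; intros eps He;
  destruct (H (eps / 2)) as (d & Hd & H'); try lra;
  exists (mkposreal d Hd); intros s Hs0 Hs; specialize (H' s Hs);
  assert (Ps := Rabs_pos_lt s Hs0).
  - assert (Q := re_le_Cmod (p (t + s)%R - p t - v * s)%C).
    replace (Re (p (t + s)%R - p t - v * s)%C)
      with (((Re (p (t + s)) - Re (p t)) / s - Re v) * s) in Q
      by (destruct (p (t+s)), (p t), v; simpl; field; exact Hs0).
    rewrite Rabs_mult in Q. nra.
  - assert (Q := Cmod_Im_le (p (t + s)%R - p t - v * s)%C).
    replace (Im (p (t + s)%R - p t - v * s)%C)
      with (((Im (p (t + s)) - Im (p t)) / s - Im v) * s) in Q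
      by (destruct (p (t+s)), (p t), v; simpl; field; exact Hs0).
    rewrite Rabs_mult in Q. nra.
Qed.

Lemma pderiv_elim (p : R -> C) (t : R) (v : C) : pderiv p t v ->
  forall eps, 0 < eps -> exists d, 0 < d /\ forall s, Rabs s < d ->
     Cmod (p (t + s)%R - p t - v * s)%C <= eps * Rabs s.
Proof.
  intros [H1 H2] eps He. apply is_derive_Reals in H1. apply is_derive_Reals in H2.
  destruct (H1 (eps / 2) ltac:(lra)) as [d1 D1].
  destruct (H2 (eps / 2) ltac:(lra)) as [d2 D2].
  exists (Rmin d1 d2). split; [apply Rmin_pos; apply cond_pos|]. intros s Hs.
  destruct (Req_dec s 0) as [E|E].
  - subst s. rewrite Rplus_0_r.
    replace (p t - p t - v * 0)%C with (RtoC 0) by ring.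
    rewrite Cmod_0, Rabs_R0. lra.
  - specialize (D1 s E ltac:(eapply Rlt_le_trans; [exact Hs|apply Rmin_l])).
    specialize (D2 s E ltac:(eapply Rlt_le_trans; [exact Hs|apply Rmin_r])).
    assert (Ps := Rabs_pos_lt s E).
    eapply Rle_trans; [apply Cmod_le_Re_Im|].
    replace (Re (p (t + s)%R - p t - v * s)%C)
      with (((Re (p (t + s)) - Re (p t)) / s - Re v) * s)
      by (destruct (p (t+s)), (p t), v; simpl; field; exact E).
    replace (Im (p (t + s)%R - p t - v * s)%C)
      with (((Im (p (t + s)) - Im (p t)) / s - Im v) * s)
      by (destruct (p (t+s)), (p t), v; simpl; field; exact E).
    rewrite !Rabs_mult. nra.
Qed.

Lemma pderiv_comp (f : C -> C) (p : R -> C) (t : R) (v l : C) :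
  pderiv p t v -> cderiv f (p t) l -> pderiv (fun s => f (p s)) t (l * v)%C.
Proof.
  intros Hp Hf. apply pderiv_intro. intros eps He.
  destruct (cderiv_lip _ _ _ Hf) as (e & K & Pe & HK & Hq).
  set (A := Cmod v + 1). set (B := Cmod l + 1).
  assert (Pv := Cmod_ge_0 v). assert (Pl := Cmod_ge_0 l).
  assert (PA : 0 < A) by (unfold A; lra). assert (PB : 0 < B) by (unfold B; lra).
  destruct (pderiv_elim p t v Hp (Rmin 1 (eps / (2 * B)))) as (d & Hd & D).
  { apply Rmin_pos; [lra|apply Rdiv_lt_0_compat; lra]. }
  assert (PK : 0 < 2 * (K + 1) * A ^ 2) by (assert (0 < A ^ 2) by nra; nra).
  (* [A] bounds the speed of the path. The three radii make the path nearly linear, keep it in the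
     disc where [f] is controlled, and push the quadratic remainder of [f] below [eps / 2]. *)
  exists (Rmin d (Rmin (e / A) (eps / (2 * (K + 1) * A ^ 2)))).
  split; [repeat apply Rmin_pos; try (apply Rdiv_lt_0_compat); lra|].
  intros s Hs.
  assert (S1 : Rabs s < d) by (eapply Rlt_le_trans; [exact Hs|apply Rmin_l]).
  assert (S2 : Rabs s < e / A)
    by (eapply Rlt_le_trans; [exact Hs|eapply Rle_trans; [apply Rmin_r|apply Rmin_l]]).
  assert (S3 : Rabs s < eps / (2 * (K + 1) * A ^ 2))
    by (eapply Rlt_le_trans; [exact Hs|eapply Rle_trans; [apply Rmin_r|apply Rmin_r]]).
  specialize (D s S1). assert (Ps := Rabs_pos s).
  assert (M1 := Rmin_l 1 (eps / (2 * B))). assert (M2 := Rmin_r 1 (eps / (2 * B))).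
  set (h := (p (t + s)%R - p t)%C).
  assert (Hh : Cmod h <= A * Rabs s).
  { replace h with ((p (t + s)%R - p t - v * s) + v * s)%C by (unfold h; ring).
    eapply Rle_trans; [apply Cmod_triangle|]. rewrite Cmod_mult, Cmod_R. unfold A. nra. }
  assert (Hh2 : Cmod h < e).
  { apply Rle_lt_trans with (1 := Hh).
    replace e with (A * (e / A)) by (field; lra). apply Rmult_lt_compat_l; assumption. }
  destruct (Hq h Hh2) as [Q _].
  replace (p t + h)%C with (p (t + s)%R) in Q by (unfold h; ring).
  replace (f (p (t + s)%R) - f (p t) - l * v * s)%C
    with ((f (p (t + s)%R) - f (p t) - l * h) + l * (p (t + s)%R - p t - v * s))%C
    by (unfold h; ring).
  eapply Rle_trans; [apply Cmod_triangle|]. rewrite Cmod_mult.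
  assert (X1 : Cmod l * Cmod (p (t + s)%R - p t - v * s)%C <= eps / 2 * Rabs s).
  { assert (Cmod (p (t + s)%R - p t - v * s)%C <= eps / (2 * B) * Rabs s) by nra.
    assert (E : eps / 2 = B * (eps / (2 * B))) by (field; lra). rewrite E.
    assert (0 < eps / (2 * B)) by (apply Rdiv_lt_0_compat; lra).
    rewrite Rmult_assoc. apply Rmult_le_compat; try apply Cmod_ge_0; [unfold B; lra|lra]. }
  assert (X2 : K * Cmod h ^ 2 <= eps / 2 * Rabs s).
  { assert (Z0 := Cmod_ge_0 h).
    assert (Cmod h ^ 2 <= (A * Rabs s) ^ 2) by (apply pow_incr; split; assumption).
    assert (K * Cmod h ^ 2 <= (K + 1) * (A * Rabs s) ^ 2).
    { apply Rmult_le_compat; try lra. apply pow2_ge_0. }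
    assert (E : eps / 2 = (eps / (2 * (K + 1) * A ^ 2)) * ((K + 1) * A ^ 2))
      by (field; split; lra).
    rewrite E.
    assert (0 <= (K + 1) * A ^ 2 * Rabs s) by (apply Rmult_le_pos; nra).
    nra. }
  lra.
Qed.

Lemma pderiv_continuous (p : R -> C) (t : R) (v : C) : pderiv p t v ->
  forall eps, 0 < eps -> exists d, 0 < d /\ forall s, Rabs s < d ->
    Cmod (p (t + s)%R - p t)%C < eps.
Proof.
  intros H eps He. destruct (pderiv_elim p t v H 1 ltac:(lra)) as (d & Hd & D).
  set (A := Cmod v + 1). assert (Pv := Cmod_ge_0 v).
  assert (PA : 0 < A) by (unfold A; lra).
  exists (Rmin d (eps / A)).
  split; [apply Rmin_pos; [lra|apply Rdiv_lt_0_compat; lra]|]. intros s Hs.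
  assert (S1 : Rabs s < d) by (eapply Rlt_le_trans; [exact Hs|apply Rmin_l]).
  assert (S2 : Rabs s < eps / A) by (eapply Rlt_le_trans; [exact Hs|apply Rmin_r]).
  specialize (D s S1).
  replace (p (t + s)%R - p t)%C with ((p (t + s)%R - p t - v * s) + v * s)%C by ring.
  eapply Rle_lt_trans; [apply Cmod_triangle|]. rewrite Cmod_mult, Cmod_R.
  assert (eps = eps / A * A) by (field; lra). assert (Ps := Rabs_pos s).
  apply Rle_lt_trans with (Rabs s * A); [unfold A; lra|nra].
Qed.

(** * Lattice sums *)

(** Shifting the index by [N] makes the range symmetric, [|m| <= N]. A square partial sum is then an
    iterated [zsum] by mere conversion, and passing to [S N] adds one term at each end. *)
Definition zsum (N : nat) (F : Z -> C) : C :=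
  sum_n (fun i => F (Z.of_nat i - Z.of_nat N)%Z) (2 * N).

Lemma sum_n_first (a : nat -> C) (n : nat) :
  sum_n a (S n) = (a O + sum_n (fun k => a (S k)) n)%C.
Proof.
  induction n as [|n IH].
  - rewrite sum_Sn, !sum_O. reflexivity.
  - rewrite sum_Sn, IH, sum_Sn. symmetry. apply Cplus_assoc.
Qed.

Lemma zsum_0 (F : Z -> C) : zsum 0 F = F 0%Z.
Proof. unfold zsum. simpl. rewrite sum_O. reflexivity. Qed.

Lemma zsum_S (N : nat) (F : Z -> C) :
  zsum (S N) F = (F (- Z.of_nat (S N))%Z + zsum N F + F (Z.of_nat (S N)))%C.
Proof.
  unfold zsum. replace (2 * S N)%nat with (S (S (2 * N))) by lia.
  rewrite sum_Sn, sum_n_first.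
  rewrite (sum_n_ext _ (fun i => F (Z.of_nat i - Z.of_nat N)%Z))
    by (intros k; f_equal; lia).
  replace (Z.of_nat 0 - Z.of_nat (S N))%Z with (- Z.of_nat (S N))%Z by lia.
  replace (Z.of_nat (S (S (2 * N))) - Z.of_nat (S N))%Z with (Z.of_nat (S N)) by lia.
  reflexivity.
Qed.

Lemma zsum_ext (N : nat) (F G : Z -> C) :
  (forall m, (Z.abs m <= Z.of_nat N)%Z -> F m = G m) -> zsum N F = zsum N G.
Proof.
  induction N as [|N IH]; intros H.
  - rewrite !zsum_0. apply H. lia.
  - rewrite !zsum_S, IH by (intros; apply H; lia). f_equal; [f_equal|]; apply H; lia.
Qed.

Lemma zsum_plus (N : nat) (F G : Z -> C) :
  zsum N (fun m => F m + G m)%C = (zsum N F + zsum N G)%C.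
Proof.
  induction N as [|N IH]; [rewrite !zsum_0; reflexivity|].
  rewrite !zsum_S, IH. ring.
Qed.

Lemma zsum_scal (N : nat) (a : C) (F : Z -> C) :
  zsum N (fun m => a * F m)%C = (a * zsum N F)%C.
Proof.
  induction N as [|N IH]; [rewrite !zsum_0; reflexivity|].
  rewrite !zsum_S, IH. ring.
Qed.

Lemma zsum_reverse (N : nat) (F : Z -> C) : zsum N (fun m => F (- m)%Z) = zsum N F.
Proof.
  induction N as [|N IH]; [rewrite !zsum_0; reflexivity|].
  rewrite !zsum_S, IH, Z.opp_involutive. ring.
Qed.

Lemma zsum_telescope (N : nat) (F : Z -> C) :
  zsum N (fun m => F (m + 1)%Z - F m)%C
  = (F (Z.of_nat N + 1)%Z - F (- Z.of_nat N)%Z)%C.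
Proof.
  induction N as [|N IH]; [rewrite !zsum_0; reflexivity|].
  rewrite zsum_S, IH.
  replace (- Z.of_nat (S N) + 1)%Z with (- Z.of_nat N)%Z by lia.
  replace (Z.of_nat N + 1)%Z with (Z.of_nat (S N)) by lia. ring.
Qed.

Lemma zsum_switch (N M : nat) (F : Z -> Z -> C) :
  zsum N (fun m => zsum M (F m)) = zsum M (fun n => zsum N (fun m => F m n)).
Proof. unfold zsum. apply sum_n_switch. Qed.

Lemma zsum_bound (N : nat) (F : Z -> C) (B : R) :
  (forall m, (Z.abs m <= Z.of_nat N)%Z -> Cmod (F m) <= B) ->
  Cmod (zsum N F) <= (2 * INR N + 1) * B.
Proof.
  induction N as [|N IH]; intros H.
  - rewrite zsum_0. specialize (H 0%Z ltac:(lia)). simpl INR. lra.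
  - rewrite zsum_S, S_INR.
    assert (H1 := H (- Z.of_nat (S N))%Z ltac:(lia)).
    assert (H2 := H (Z.of_nat (S N)) ltac:(lia)).
    specialize (IH ltac:(intros; apply H; lia)).
    eapply Rle_trans; [apply Cmod_triangle|].
    assert (T := Cmod_triangle (F (- Z.of_nat (S N))%Z) (zsum N F)). lra.
Qed.

(** The maximum norm of the index pair, clamped so that it is at least 1 without excluding the
    origin. *)
Definition lnorm (m n : Z) : R := IZR (Z.max 1 (Z.max (Z.abs m) (Z.abs n))).

Lemma lnorm_ge_1 (m n : Z) : 1 <= lnorm m n.
Proof. unfold lnorm. apply IZR_le. lia. Qed.

Definition nonzero_pair (m n : Z) : Prop := m <> 0%Z \/ n <> 0%Z.

Definition lterm (w1 w2 : C) (f : C -> C) (m n : Z) : C :=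
  if (Z.eqb m 0 && Z.eqb n 0)%bool then RtoC 0 else f (lattice_point w1 w2 m n).

Lemma lattice_partial_sum_zsum (w1 w2 : C) (f : C -> C) (N : nat) :
  lattice_partial_sum w1 w2 f N = zsum N (fun m => zsum N (lterm w1 w2 f m)).
Proof. reflexivity. Qed.

Lemma lterm_nonzero (w1 w2 : C) (f : C -> C) (m n : Z) : nonzero_pair m n ->
  lterm w1 w2 f m n = f (lattice_point w1 w2 m n).
Proof.
  intros H. unfold lterm.
  destruct (Z.eqb_spec m 0), (Z.eqb_spec n 0); simpl; try reflexivity.
  destruct H; contradiction.
Qed.

Lemma lterm_zero (w1 w2 : C) (f : C -> C) : lterm w1 w2 f 0 0 = 0%C.
Proof. reflexivity. Qed.

Lemma pair_cases (m n : Z) : nonzero_pair m n \/ m = 0%Z /\ n = 0%Z.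
Proof. unfold nonzero_pair. lia. Qed.

(** Cubic decay is what a planar lattice needs: [8 k] points have maximum norm [k], so that shell
    contributes [O(1 / k ^ 2)]. *)
Definition lbound (w1 w2 : C) (f : C -> C) (B : R) : Prop :=
  forall m n, nonzero_pair m n ->
    Cmod (f (lattice_point w1 w2 m n)) <= B / lnorm m n ^ 3.

Definition is_lsum (w1 w2 : C) (f : C -> C) (S : C) : Prop :=
  forall eps, 0 < eps -> exists N0, forall N, (N0 <= N)%nat ->
    Cmod (lattice_partial_sum w1 w2 f N - S)%C < eps.

(** With [x = N + 1], the new shell has [8 x] points and contributes at most [8 B / x ^ 2]. This is
    at most [16 B / x - 16 B / (x + 1)] since [x >= 1], a difference that telescopes in the Cauchy
    estimate. *)
Lemma lattice_partial_sum_step (w1 w2 : C) (f : C -> C) (B : R) (N : nat) :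
  0 <= B -> lbound w1 w2 f B ->
  Cmod (lattice_partial_sum w1 w2 f (S N) - lattice_partial_sum w1 w2 f N)%C
    <= 16 * B / INR (S N) - 16 * B / INR (S (S N)).
Proof.
  intros HB H. rewrite !lattice_partial_sum_zsum.
  set (g := lterm w1 w2 f). set (k := Z.of_nat (S N)).
  set (b := B / INR (S N) ^ 3).
  assert (PN : 0 < INR (S N)) by (apply lt_0_INR; lia).
  assert (Hg : forall m n, (Z.max (Z.abs m) (Z.abs n) = k)%Z -> Cmod (g m n) <= b).
  { intros m n E. unfold g. assert (Q : nonzero_pair m n) by (unfold nonzero_pair; lia).
    rewrite lterm_nonzero by exact Q. eapply Rle_trans; [apply H, Q|].
    unfold lnorm, b. rewrite E, Z.max_r by lia. unfold k. rewrite <- INR_IZR_INZ.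
    apply Rle_refl. }
  rewrite zsum_S. fold k.
  (* The shell consists of the two complete rows [m = - k] and [m = k] and of the two new ends of
     each old row. *)
  replace (zsum N (fun m => zsum (S N) (g m))) with
    (zsum N (fun m => zsum N (g m)) + zsum N (fun m => g m (- k)%Z + g m k))%C.
  2:{ rewrite <- zsum_plus. apply zsum_ext. intros m _. rewrite zsum_S. fold k. ring. }
  replace (zsum (S N) (g (- k)%Z)
     + (zsum N (fun m => zsum N (g m)) + zsum N (fun m => g m (- k)%Z + g m k))
     + zsum (S N) (g k) - zsum N (fun m => zsum N (g m)))%C
    with (zsum (S N) (g (- k)%Z) + zsum (S N) (g k)
          + zsum N (fun m => g m (- k)%Z + g m k))%C by ring.
  assert (B1 : Cmod (zsum (S N) (g (- k)%Z)) <= (2 * INR (S N) + 1) * b)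
    by (apply zsum_bound; intros; apply Hg; lia).
  assert (B2 : Cmod (zsum (S N) (g k)) <= (2 * INR (S N) + 1) * b)
    by (apply zsum_bound; intros; apply Hg; lia).
  assert (B3 : Cmod (zsum N (fun m => g m (- k)%Z + g m k)%C) <= (2 * INR N + 1) * (2 * b)).
  { apply zsum_bound. intros m Hm. eapply Rle_trans; [apply Cmod_triangle|].
    assert (A1 := Hg m (- k)%Z ltac:(lia)). assert (A2 := Hg m k ltac:(lia)). lra. }
  eapply Rle_trans; [apply Cmod_triangle|].
  eapply Rle_trans; [apply Rplus_le_compat; [apply Cmod_triangle|apply Rle_refl]|].
  apply Rle_trans with (8 * INR (S N) * b).
  { rewrite S_INR in *. nra. }
  unfold b. rewrite (S_INR (S N)). set (x := INR (S N)) in *.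
  replace (8 * x * (B / x ^ 3)) with (8 * B / x ^ 2) by (field; lra).
  assert (P1x : 1 <= x) by (unfold x; rewrite S_INR; assert (Y := pos_INR N); lra).
  apply Rminus_le.
  replace (8 * B / x ^ 2 - (16 * B / x - 16 * B / (x + 1)))
    with (8 * B * ((1 - x) / (x ^ 2 * (x + 1)))) by (field; lra).
  assert (0 <= (x - 1) / (x ^ 2 * (x + 1))).
  { apply Rmult_le_pos; [lra|]. left. apply Rinv_0_lt_compat. nra. }
  replace ((1 - x) / (x ^ 2 * (x + 1))) with (- ((x - 1) / (x ^ 2 * (x + 1))))
    by (field; lra).
  nra.
Qed.

Lemma lattice_partial_sum_cauchy (w1 w2 : C) (f : C -> C) (B : R) (N k : nat) :
  0 <= B -> lbound w1 w2 f B ->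
  Cmod (lattice_partial_sum w1 w2 f (N + k) - lattice_partial_sum w1 w2 f N)%C
    <= 16 * B / INR (S N).
Proof.
  intros HB H.
  assert (P : forall M, 0 <= 16 * B / INR (S M)).
  { intros M. apply Rmult_le_pos; [lra|]. left. apply Rinv_0_lt_compat, lt_0_INR. lia. }
  apply Rle_trans with (16 * B / INR (S N) - 16 * B / INR (S (N + k)));
    [|specialize (P (N + k)%nat); lra].
  induction k as [|k IH].
  - rewrite Nat.add_0_r.
    replace (lattice_partial_sum w1 w2 f N - lattice_partial_sum w1 w2 f N)%C
      with (RtoC 0) by ring.
    rewrite Cmod_0. lra.
  - assert (Q := lattice_partial_sum_step w1 w2 f B (N + k) HB H).
    replace (N + S k)%nat with (S (N + k)) by lia.
    replace (lattice_partial_sum w1 w2 f (S (N + k)) - lattice_partial_sum w1 w2 f N)%C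
      with ((lattice_partial_sum w1 w2 f (S (N + k)) - lattice_partial_sum w1 w2 f (N + k))
       + (lattice_partial_sum w1 w2 f (N + k) - lattice_partial_sum w1 w2 f N))%C by ring.
    eapply Rle_trans; [apply Cmod_triangle|]. lra.
Qed.

Lemma is_lsum_lim (w1 w2 : C) (f : C -> C) (S : C) : is_lsum w1 w2 f S ->
  lattice_sum w1 w2 f = S.
Proof.
  intros H. unfold lattice_sum.
  replace (Lim_seq (fun N => Re (lattice_partial_sum w1 w2 f N))) with (Finite (Re S)).
  2:{ symmetry. apply is_lim_seq_unique, is_lim_seq_Reals. intros eps He.
      destruct (H eps He) as [N0 HN]. exists N0. intros N HN'.
      eapply Rle_lt_trans; [|apply (HN N HN')]. unfold Rdist.
      eapply Rle_trans; [|apply re_le_Cmod]. apply Req_le. f_equal. }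
  replace (Lim_seq (fun N => Im (lattice_partial_sum w1 w2 f N))) with (Finite (Im S)).
  2:{ symmetry. apply is_lim_seq_unique, is_lim_seq_Reals. intros eps He.
      destruct (H eps He) as [N0 HN]. exists N0. intros N HN'.
      eapply Rle_lt_trans; [|apply (HN N HN')]. unfold Rdist.
      eapply Rle_trans; [|apply Cmod_Im_le]. apply Req_le. f_equal. }
  destruct S; reflexivity.
Qed.

Lemma is_lsum_unique (w1 w2 : C) (f : C -> C) (S T : C) :
  is_lsum w1 w2 f S -> is_lsum w1 w2 f T -> S = T.
Proof. intros H H'. rewrite <- (is_lsum_lim _ _ _ _ H). apply is_lsum_lim, H'. Qed.

Lemma inv_INR_small (c eps : R) : 0 <= c -> 0 < eps ->
  exists N0, forall N, (N0 <= N)%nat -> c / INR (S N) < eps.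
Proof.
  intros Hc He. destruct (INR_unbounded (c / eps)) as [N0 HN]. exists N0. intros N H.
  assert (P : 0 < INR (S N)) by (apply lt_0_INR; lia).
  assert (INR N0 <= INR (S N)) by (apply le_INR; lia).
  apply Rmult_lt_reg_r with (INR (S N)); [exact P|].
  replace (c / INR (S N) * INR (S N)) with (c / eps * eps) by (field; lra).
  rewrite Rmult_comm. apply Rmult_lt_compat_l; lra.
Qed.

(** [Lim_seq] is total, so [lattice_sum] carries information only once both components are known to
    converge. *)
Lemma lsum_ex (w1 w2 : C) (f : C -> C) (B : R) : 0 <= B -> lbound w1 w2 f B ->
  is_lsum w1 w2 f (lattice_sum w1 w2 f).
Proof.
  intros HB H.
  (* [p] stands for [Re] and [Im] alike: additive and dominated by the modulus. *)
  assert (HC : forall p : C -> R, (forall z, Rabs (p z) <= Cmod z) ->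
            (forall z w, p (z - w)%C = p z - p w) ->
            exists l, Un_cv (fun N => p (lattice_partial_sum w1 w2 f N)) l).
  { intros p Hp Hl. destruct (Rcomplete.R_complete (fun N => p (lattice_partial_sum w1 w2 f N)))
      as [l Hlim]; [|exists l; exact Hlim].
    assert (Key : forall eps, 0 < eps -> exists N0, forall n m, (N0 <= n)%nat -> (n <= m)%nat ->
       Rdist (p (lattice_partial_sum w1 w2 f m)) (p (lattice_partial_sum w1 w2 f n)) < eps).
    { intros eps He. destruct (inv_INR_small (16 * B) eps ltac:(lra) He) as [N0 HN].
      exists N0. intros n m Hn Hm. unfold Rdist. rewrite <- Hl.
      eapply Rle_lt_trans; [apply Hp|]. eapply Rle_lt_trans; [|apply (HN n Hn)].
      replace m with (n + (m - n))%nat by lia.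
      apply lattice_partial_sum_cauchy; assumption. }
    intros eps He. destruct (Key eps He) as [N0 HN]. exists N0. intros n m Hn Hm.
    destruct (Nat.le_ge_cases n m); [rewrite Rdist_sym|]; apply HN; lia. }
  destruct (HC Re) as [a Ha]; [apply re_le_Cmod|reflexivity|].
  destruct (HC Im) as [b Hb]; [apply Cmod_Im_le|reflexivity|].
  assert (L : is_lsum w1 w2 f (a, b)).
  { intros eps He. destruct (Ha (eps / 2) ltac:(lra)) as [N1 H1].
    destruct (Hb (eps / 2) ltac:(lra)) as [N2 H2].
    exists (Nat.max N1 N2). intros N HN.
    specialize (H1 N ltac:(lia)). specialize (H2 N ltac:(lia)). unfold Rdist in *.
    eapply Rle_lt_trans; [apply Cmod_le_Re_Im|].
    replace (Re (lattice_partial_sum w1 w2 f N - (a, b))%C)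
      with (Re (lattice_partial_sum w1 w2 f N) - a) by reflexivity.
    replace (Im (lattice_partial_sum w1 w2 f N - (a, b))%C)
      with (Im (lattice_partial_sum w1 w2 f N) - b) by reflexivity.
    lra. }
  rewrite (is_lsum_lim _ _ _ _ L). exact L.
Qed.

(** The Cauchy estimate started at [N = 0], where the square contains only the origin and the
    partial sum is 0. Being explicit in [B], it transfers bounds that are uniform in a parameter
    from the terms to the sum. *)
Lemma is_lsum_bound (w1 w2 : C) (f : C -> C) (S : C) (B : R) : 0 <= B ->
  lbound w1 w2 f B -> is_lsum w1 w2 f S -> Cmod S <= 16 * B.
Proof.
  intros HB H HS. apply le_epsilon. intros eps He. destruct (HS eps He) as [N0 HN].
  specialize (HN N0 ltac:(lia)).
  assert (Q := lattice_partial_sum_cauchy w1 w2 f B 0 N0 HB H). simpl in Q.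
  replace (lattice_partial_sum w1 w2 f 0) with (RtoC 0) in Q
    by (rewrite lattice_partial_sum_zsum, !zsum_0; reflexivity).
  replace (lattice_partial_sum w1 w2 f N0 - 0)%C with (lattice_partial_sum w1 w2 f N0) in Q
    by ring.
  assert (T := Cmod_triangle_sub S (S - lattice_partial_sum w1 w2 f N0)%C).
  replace (S - (S - lattice_partial_sum w1 w2 f N0))%C
    with (lattice_partial_sum w1 w2 f N0) in T by ring.
  rewrite (Cmod_minus_sym S) in T. lra.
Qed.

Lemma is_lsum_plus (w1 w2 : C) (f g : C -> C) (S T : C) :
  is_lsum w1 w2 f S -> is_lsum w1 w2 g T ->
  is_lsum w1 w2 (fun w => f w + g w)%C (S + T)%C.
Proof.
  intros H H' eps He. destruct (H (eps / 2) ltac:(lra)) as [N1 H1].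
  destruct (H' (eps / 2) ltac:(lra)) as [N2 H2].
  exists (Nat.max N1 N2). intros N HN.
  specialize (H1 N ltac:(lia)). specialize (H2 N ltac:(lia)).
  replace (lattice_partial_sum w1 w2 (fun w => f w + g w)%C N)
    with (lattice_partial_sum w1 w2 f N + lattice_partial_sum w1 w2 g N)%C.
  2:{ rewrite !lattice_partial_sum_zsum, <- zsum_plus. apply zsum_ext. intros m _.
      rewrite <- zsum_plus. apply zsum_ext. intros n _. unfold lterm.
      destruct (_ && _)%bool; [ring|reflexivity]. }
  replace (lattice_partial_sum w1 w2 f N + lattice_partial_sum w1 w2 g N - (S + T))%C
    with ((lattice_partial_sum w1 w2 f N - S) + (lattice_partial_sum w1 w2 g N - T))%C by ring.
  eapply Rle_lt_trans; [apply Cmod_triangle|]. lra.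
Qed.

Lemma is_lsum_scal (w1 w2 : C) (a : C) (f : C -> C) (S : C) :
  is_lsum w1 w2 f S -> is_lsum w1 w2 (fun w => a * f w)%C (a * S)%C.
Proof.
  intros H eps He. set (k := Cmod a + 1).
  assert (Ha := Cmod_ge_0 a). assert (Hk : 0 < k) by (unfold k; lra).
  destruct (H (eps / k)) as [N0 HN]; [apply Rdiv_lt_0_compat; lra|].
  exists N0. intros N H1. specialize (HN N H1).
  replace (lattice_partial_sum w1 w2 (fun w => a * f w)%C N)
    with (a * lattice_partial_sum w1 w2 f N)%C.
  2:{ rewrite !lattice_partial_sum_zsum, <- zsum_scal. apply zsum_ext. intros m _.
      rewrite <- zsum_scal. apply zsum_ext. intros n _. unfold lterm.
      destruct (_ && _)%bool; [ring|reflexivity]. }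
  replace (a * lattice_partial_sum w1 w2 f N - a * S)%C
    with (a * (lattice_partial_sum w1 w2 f N - S))%C by ring.
  rewrite Cmod_mult.
  assert (eps = eps / k * k) by (field; lra).
  assert (X := Cmod_ge_0 (lattice_partial_sum w1 w2 f N - S)%C).
  apply Rle_lt_trans with (Cmod (lattice_partial_sum w1 w2 f N - S)%C * k); [unfold k; nra|nra].
Qed.

Lemma is_lsum_ext (w1 w2 : C) (f g : C -> C) (S : C) :
  (forall m n, nonzero_pair m n ->
     f (lattice_point w1 w2 m n) = g (lattice_point w1 w2 m n)) ->
  is_lsum w1 w2 f S -> is_lsum w1 w2 g S.
Proof.
  intros E H eps He. destruct (H eps He) as [N0 HN]. exists N0. intros N H1.
  replace (lattice_partial_sum w1 w2 g N) with (lattice_partial_sum w1 w2 f N);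
    [apply HN, H1|].
  rewrite !lattice_partial_sum_zsum. apply zsum_ext. intros m _. apply zsum_ext.
  intros n _. destruct (pair_cases m n) as [Q|[-> ->]].
  - rewrite !lterm_nonzero by exact Q. apply E, Q.
  - reflexivity.
Qed.

Lemma lattice_point_opp (w1 w2 : C) (m n : Z) :
  lattice_point w1 w2 (- m) (- n) = (- lattice_point w1 w2 m n)%C.
Proof. unfold lattice_point. rewrite !opp_IZR, !RtoC_opp. ring. Qed.

Lemma is_lsum_reflect (w1 w2 : C) (f : C -> C) (S : C) :
  is_lsum w1 w2 f S -> is_lsum w1 w2 (fun w => f (- w)%C) S.
Proof.
  intros H eps He. destruct (H eps He) as [N0 HN]. exists N0. intros N H1.
  replace (lattice_partial_sum w1 w2 (fun w => f (- w)%C) N)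
    with (lattice_partial_sum w1 w2 f N); [apply HN, H1|].
  rewrite !lattice_partial_sum_zsum, <- zsum_reverse. apply zsum_ext. intros m _.
  rewrite <- zsum_reverse. apply zsum_ext. intros n _.
  destruct (pair_cases m n) as [Q|[-> ->]]; [|reflexivity].
  rewrite !lterm_nonzero by (unfold nonzero_pair in *; lia).
  rewrite lattice_point_opp. reflexivity.
Qed.

Lemma is_lsum_odd (w1 w2 : C) (f : C -> C) (S : C) :
  (forall m n, nonzero_pair m n ->
     f (- lattice_point w1 w2 m n)%C = (- f (lattice_point w1 w2 m n))%C) ->
  is_lsum w1 w2 f S -> S = 0%C.
Proof.
  intros E H. assert (H1 := is_lsum_reflect _ _ _ _ H).
  assert (H2 := is_lsum_scal w1 w2 (RtoC (-1)) f S H).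
  assert (Q : S = (RtoC (-1) * S)%C).
  { apply (is_lsum_unique w1 w2 (fun w => f (- w)%C)); [exact H1|].
    apply is_lsum_ext with (2 := H2). intros m n P. rewrite E by exact P. ring. }
  assert (D : (RtoC 2 * S = 0)%C).
  { replace (RtoC 2 * S)%C with (S - RtoC (-1) * S)%C by ring. rewrite <- Q. ring. }
  apply Cmod_eq_0. assert (D' : Cmod (RtoC 2 * S)%C = 0) by (rewrite D; apply Cmod_0).
  rewrite Cmod_mult, Cmod_R, Rabs_pos_eq in D' by lra. lra.
Qed.

(** * Geometry of the lattice *)

Lemma lattice_point_add (w1 w2 : C) (m n m' n' : Z) :
  lattice_point w1 w2 (m + m') (n + n')
  = (lattice_point w1 w2 m n + lattice_point w1 w2 m' n')%C.
Proof. unfold lattice_point. rewrite !plus_IZR, !RtoC_plus. ring. Qed.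

Lemma lattice_point_0 (w1 w2 : C) : lattice_point w1 w2 0 0 = 0%C.
Proof. unfold lattice_point. ring. Qed.

Lemma in_lattice_0 (w1 w2 : C) : in_lattice w1 w2 0%C.
Proof. exists 0%Z, 0%Z. symmetry. apply lattice_point_0. Qed.

Lemma in_lattice_add (w1 w2 z w : C) : in_lattice w1 w2 w ->
  (in_lattice w1 w2 (z + w)%C <-> in_lattice w1 w2 z).
Proof.
  intros (m & n & ->). split; intros (m' & n' & E).
  - exists (m' + - m)%Z, (n' + - n)%Z. rewrite lattice_point_add, lattice_point_opp, <- E. ring.
  - exists (m' + m)%Z, (n' + n)%Z. rewrite lattice_point_add, <- E. reflexivity.
Qed.

Lemma in_lattice_opp (w1 w2 z : C) : in_lattice w1 w2 z -> in_lattice w1 w2 (- z)%C.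
Proof.
  intros (m & n & ->). exists (- m)%Z, (- n)%Z. symmetry. apply lattice_point_opp.
Qed.

(* Pairing a lattice point with [w1] or [w2] under [Im (z * Cconj w)] isolates
   one of its two integer coordinates. *)
Lemma lattice_point_lower (w1 w2 : C) : lattice_basis w1 w2 ->
  exists k, 0 < k /\ forall m n, nonzero_pair m n ->
    k * lnorm m n <= Cmod (lattice_point w1 w2 m n).
Proof.
  intros H. set (D := Rabs (Im (w1 * Cconj w2)%C)).
  assert (PD : 0 < D) by (apply Rabs_pos_lt; exact H).
  set (A := Cmod w1 + Cmod w2 + 1).
  assert (P1' := Cmod_ge_0 w1). assert (P2' := Cmod_ge_0 w2).
  exists (D / A). split; [apply Rdiv_lt_0_compat; unfold A; lra|]. intros m n Q.
  set (w := lattice_point w1 w2 m n). assert (Pw := Cmod_ge_0 w).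
  assert (B1 : Rabs (IZR m) * D <= Cmod w * Cmod w2).
  { rewrite <- (Cmod_conj w2), <- Cmod_mult. eapply Rle_trans; [|apply Cmod_Im_le].
    unfold D. rewrite <- Rabs_mult. apply Req_le. f_equal.
    unfold w, lattice_point. destruct w1, w2; simpl; ring. }
  assert (B2 : Rabs (IZR n) * D <= Cmod w * Cmod w1).
  { rewrite <- (Cmod_conj w1), <- Cmod_mult. eapply Rle_trans; [|apply Cmod_Im_le].
    unfold D. rewrite <- Rabs_mult, <- Rabs_Ropp. apply Req_le. f_equal.
    unfold w, lattice_point. destruct w1, w2; simpl; ring. }
  rewrite <- abs_IZR in B1, B2.
  assert (HA : D * lnorm m n <= Cmod w * A).
  { unfold lnorm. rewrite Z.max_r by (unfold nonzero_pair in Q; lia).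
    destruct (Z.max_spec (Z.abs m) (Z.abs n)) as [[_ E]|[_ E]]; rewrite E; unfold A; nra. }
  apply Rmult_le_reg_r with A; [unfold A; lra|].
  replace (D / A * lnorm m n * A) with (D * lnorm m n) by (field; unfold A; lra).
  exact HA.
Qed.

Lemma lattice_point_neq_0 (w1 w2 : C) (m n : Z) : lattice_basis w1 w2 ->
  nonzero_pair m n -> lattice_point w1 w2 m n <> 0%C.
Proof.
  intros H Q. destruct (lattice_point_lower w1 w2 H) as (k & Hk & Hl).
  apply Cmod_gt_0. assert (L := lnorm_ge_1 m n). specialize (Hl m n Q). nra.
Qed.

Lemma list_argmin {A : Type} (g : A -> R) (a : A) (l : list A) : List.In a l ->
  exists x, List.In x l /\ forall y, List.In y l -> g x <= g y.
Proof.
  revert a. induction l as [|b l IH]; intros a Ha; [destruct Ha|].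
  destruct l as [|b' l'].
  - exists b. split; [left; reflexivity|]. intros y [<-|[]]. lra.
  - destruct (IH b' (or_introl eq_refl)) as (x & Hx & Hm).
    destruct (Rle_dec (g x) (g b)) as [E|E].
    + exists x. split; [right; exact Hx|]. intros y [<-|Hy]; auto.
    + exists b. split; [left; reflexivity|]. intros y [<-|Hy]; [lra|].
      specialize (Hm y Hy). lra.
Qed.

Lemma box_enumeration (K : nat) : exists l : list (Z * Z), forall m n,
  (Z.max (Z.abs m) (Z.abs n) <= Z.of_nat K)%Z -> List.In (m, n) l.
Proof.
  set (r := List.map (fun i => (Z.of_nat i - Z.of_nat K)%Z) (List.seq 0 (2 * K + 1))).
  assert (Hr : forall m, (Z.abs m <= Z.of_nat K)%Z -> List.In m r).
  { intros m Hm. apply List.in_map_iff. exists (Z.to_nat (m + Z.of_nat K)).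
    split; [lia|]. apply List.in_seq. lia. }
  exists (List.list_prod r r). intros m n H. apply List.in_prod; apply Hr; lia.
Qed.

Lemma box_positive_min (g : Z -> Z -> R) (K : nat) :
  (forall m n, nonzero_pair m n -> 0 < g m n) ->
  exists eta, 0 < eta /\ forall m n, nonzero_pair m n ->
    (Z.max (Z.abs m) (Z.abs n) <= Z.of_nat K)%Z -> eta <= g m n.
Proof.
  intros H. destruct (box_enumeration K) as [l Hl].
  set (l' := List.filter (fun p => negb (Z.eqb (fst p) 0 && Z.eqb (snd p) 0)) l).
  assert (Hl' : forall m n, List.In (m, n) l' <-> List.In (m, n) l /\ nonzero_pair m n).
  { intros m n. unfold l'. rewrite List.filter_In. simpl. unfold nonzero_pair.
    destruct (Z.eqb_spec m 0), (Z.eqb_spec n 0); simpl; intuition congruence. }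
  destruct l' as [|p0 t] eqn:El.
  - exists 1. split; [lra|]. intros m n Q B. exfalso.
    apply (proj2 (Hl' m n)). split; auto.
  - destruct (list_argmin (fun p => g (fst p) (snd p)) p0 (p0 :: t) (or_introl eq_refl))
      as ([m0 n0] & H0 & Hm).
    exists (g m0 n0). split; [apply H, (proj2 (proj1 (Hl' m0 n0) H0))|].
    intros m n Q B. apply (Hm (m, n)). apply Hl'. split; auto.
Qed.

(** For large indices [|w| >= k * lnorm] exceeds twice [|z| + 1]; the remaining finitely many points
    have a positive minimal distance [eta] from [z]. Dividing [eta / 2] by the box size turns it
    into a bound linear in [lnorm]. *)
Lemma lattice_separation (w1 w2 z : C) : lattice_basis w1 w2 ->
  (forall m n, nonzero_pair m n -> z <> lattice_point w1 w2 m n) ->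
  exists c eps, 0 < c /\ 0 < eps /\ forall h, Cmod h < eps ->
    forall m n, nonzero_pair m n -> c * lnorm m n <= Cmod (z + h - lattice_point w1 w2 m n)%C.
Proof.
  intros HB Hz. destruct (lattice_point_lower w1 w2 HB) as (k & Hk & Hl).
  assert (Pz := Cmod_ge_0 z).
  destruct (INR_unbounded (2 * (Cmod z + 1) / k)) as [K0 HK0].
  set (K := S K0). assert (HK : 2 * (Cmod z + 1) <= k * INR K).
  { unfold K. rewrite S_INR. replace (2 * (Cmod z + 1)) with (k * (2 * (Cmod z + 1) / k))
      by (field; lra). apply Rmult_le_compat_l; lra. }
  assert (PK : 1 <= INR K) by (unfold K; rewrite S_INR; assert (Y := pos_INR K0); lra).
  destruct (box_positive_min (fun m n => Cmod (z - lattice_point w1 w2 m n)%C) K)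
    as (eta & He & Hm).
  { intros m n Q. apply Cmod_gt_0. intros E. apply (Hz m n Q).
    replace z with (z - lattice_point w1 w2 m n + lattice_point w1 w2 m n)%C by ring.
    rewrite E. ring. }
  exists (Rmin (k / 2) (eta / (2 * INR K))), (Rmin 1 (eta / 2)).
  split; [apply Rmin_pos; [lra|apply Rdiv_lt_0_compat; lra]|].
  split; [apply Rmin_pos; lra|]. intros h Hh m n Q.
  assert (Hh1 : Cmod h < 1) by (eapply Rlt_le_trans; [exact Hh|apply Rmin_l]).
  assert (Hh2 : Cmod h < eta / 2) by (eapply Rlt_le_trans; [exact Hh|apply Rmin_r]).
  assert (L1 := lnorm_ge_1 m n). set (w := lattice_point w1 w2 m n).
  destruct (Rle_dec (INR K) (lnorm m n)) as [C1|C1].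
  - apply Rle_trans with (k / 2 * lnorm m n);
      [apply Rmult_le_compat_r; [lra|apply Rmin_l]|].
    assert (T := Cmod_triangle_sub w (z + h)%C). rewrite Cmod_minus_sym in T.
    assert (T' := Cmod_triangle z h). specialize (Hl m n Q). fold w in Hl.
    assert (k * INR K <= k * lnorm m n) by (apply Rmult_le_compat_l; lra). lra.
  - apply Rle_trans with (eta / (2 * INR K) * lnorm m n);
      [apply Rmult_le_compat_r; [lra|apply Rmin_r]|].
    assert (B : (Z.max (Z.abs m) (Z.abs n) <= Z.of_nat K)%Z).
    { unfold lnorm in C1. rewrite INR_IZR_INZ in C1.
      assert (IZR (Z.max 1 (Z.max (Z.abs m) (Z.abs n))) < IZR (Z.of_nat K)) as C2 by lra.
      apply lt_IZR in C2. lia. }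
    specialize (Hm m n Q B). simpl in Hm. fold w in Hm.
    assert (T := Cmod_triangle_sub (z - w)%C (- h)%C). rewrite Cmod_opp in T.
    replace (z - w - - h)%C with (z + h - w)%C in T by ring.
    apply Rle_trans with (eta / 2); [|lra].
    replace (eta / 2) with (eta / (2 * INR K) * INR K) by (field; lra).
    apply Rmult_le_compat_l; [left; apply Rdiv_lt_0_compat; lra|lra].
Qed.

(** Outside a large box no lattice point is closer to [z] than the origin, so a minimum over the box
    is global. *)
Lemma nearest_lattice_point (w1 w2 z : C) : lattice_basis w1 w2 ->
  exists p, in_lattice w1 w2 p /\
    forall q, in_lattice w1 w2 q -> Cmod (p - z)%C <= Cmod (q - z)%C.
Proof.
  intros HB. destruct (lattice_point_lower w1 w2 HB) as (k & Hk & Hl).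
  assert (Pz := Cmod_ge_0 z).
  destruct (INR_unbounded (2 * Cmod z / k)) as [K HK].
  destruct (box_enumeration K) as [l Hbox].
  destruct (list_argmin (fun p => Cmod (lattice_point w1 w2 (fst p) (snd p) - z)%C)
     (0%Z, 0%Z) l) as ([m0 n0] & _ & Hm); [apply Hbox; lia|].
  exists (lattice_point w1 w2 m0 n0). split; [exists m0, n0; reflexivity|].
  intros q (m & n & ->).
  destruct (Z_le_gt_dec (Z.max (Z.abs m) (Z.abs n)) (Z.of_nat K)) as [B|B].
  - apply (Hm (m, n)), Hbox, B.
  - apply Rle_trans with (Cmod (lattice_point w1 w2 0 0 - z)%C);
      [apply (Hm (0%Z, 0%Z)), Hbox; lia|].
    rewrite lattice_point_0. replace (0 - z)%C with (- z)%C by ring. rewrite Cmod_opp.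
    assert (Q : nonzero_pair m n) by (unfold nonzero_pair; lia).
    specialize (Hl m n Q). assert (T := Cmod_triangle_sub (lattice_point w1 w2 m n) z).
    assert (INR K <= lnorm m n).
    { unfold lnorm. rewrite INR_IZR_INZ. apply IZR_le. lia. }
    assert (k * INR K <= k * lnorm m n) by (apply Rmult_le_compat_l; lra).
    assert (2 * Cmod z = k * (2 * Cmod z / k)) by (field; lra).
    assert (k * (2 * Cmod z / k) <= k * INR K) by (apply Rmult_le_compat_l; lra).
    lra.
Qed.

Lemma not_in_lattice_near (w1 w2 z : C) : lattice_basis w1 w2 ->
  exists eps, 0 < eps /\ forall h : C, h <> 0%C -> Cmod h < eps ->
    ~ in_lattice w1 w2 (z + h)%C.
Proof.
  intros HB.
  assert (L0 : exists eps, 0 < eps /\ forall h : C, h <> 0%C -> Cmod h < eps ->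
             ~ in_lattice w1 w2 h).
  { destruct (lattice_point_lower w1 w2 HB) as (k & Hk & Hl).
    exists k. split; [exact Hk|]. intros h H0 Hh (m & n & E).
    destruct (pair_cases m n) as [Q|[-> ->]].
    - specialize (Hl m n Q). assert (L := lnorm_ge_1 m n). rewrite <- E in Hl. nra.
    - rewrite lattice_point_0 in E. contradiction. }
  destruct (classic (in_lattice w1 w2 z)) as [Z|Z].
  - destruct L0 as (e & He & H). exists e. split; [exact He|].
    intros h H0 Hh C1. apply (H h H0 Hh).
    rewrite Cplus_comm in C1. apply (in_lattice_add w1 w2 h z Z), C1.
  - destruct (nearest_lattice_point w1 w2 z HB) as (p & Hp & Hm).
    exists (Cmod (p - z)%C). split.
    { apply Cmod_gt_0. intros E. apply Z. replace z with p; [exact Hp|].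
      replace p with (p - z + z)%C by ring. rewrite E. ring. }
    intros h _ Hh C1. specialize (Hm _ C1).
    replace (z + h - z)%C with h in Hm by ring. lra.
Qed.

(** * Maximum principle *)

Ltac continuity_2d :=
  repeat (first [assumption | apply continuity_2d_pt_const | apply continuity_2d_pt_id1
    | apply continuity_2d_pt_id2 | apply continuity_2d_pt_plus
    | apply continuity_2d_pt_opp | apply continuity_2d_pt_mult]).

Definition cis (t : R) : C := (cos t, sin t).

Lemma Cmod_cis (t : R) : Cmod (cis t) = 1.
Proof.
  rewrite <- sqrt_1. unfold Cmod, cis, fst, snd. f_equal.
  assert (H := sin2_cos2 t). unfold Rsqr in H. lra.
Qed.

Lemma pderiv_cis (c w : C) (t : R) : pderiv (fun s => c + w * cis s)%C t (Ci * w * cis t)%C.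
Proof.
  unfold pderiv, cis. destruct c, w. simpl. split; auto_derive; auto; ring.
Qed.

Lemma pderiv_line (c w : C) (t : R) : pderiv (fun s => c + RtoC s * w)%C t w.
Proof.
  unfold pderiv. destruct c, w. simpl. split; auto_derive; auto; ring.
Qed.

Lemma pderiv_ext (p q : R -> C) (t : R) (v : C) :
  (forall s, p s = q s) -> pderiv p t v -> pderiv q t v.
Proof.
  intros E [H1 H2]. split; [eapply is_derive_ext; [|exact H1]|eapply is_derive_ext; [|exact H2]];
    intros s; simpl; rewrite E; reflexivity.
Qed.

(** Bridge from [ccont] to the two-variable continuity that differentiation under the integral and
    compactness of a rectangle require. *)
Lemma ccont_comp_2d (g : C -> C) (A B : R -> R -> R) (x y : R) :
  continuity_2d_pt A x y -> continuity_2d_pt B x y -> ccont g (A x y, B x y) ->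
  continuity_2d_pt (fun u v => Re (g (A u v, B u v))) x y /\
  continuity_2d_pt (fun u v => Im (g (A u v, B u v))) x y.
Proof.
  intros HA HB Hg.
  assert (H : forall eps : posreal, locally_2d (fun u v =>
    Cmod (g (A u v, B u v) - g (A x y, B x y))%C < eps) x y).
  { intros eps. destruct (Hg eps (cond_pos eps)) as (d & Hd & H').
    assert (Hd2 : 0 < d / 2) by lra.
    eapply locally_2d_impl; [|apply locally_2d_and;
      [exact (HA (mkposreal _ Hd2))|exact (HB (mkposreal _ Hd2))]].
    apply locally_2d_forall. intros u v [H1 H2]. simpl in H1, H2.
    set (h := (A u v - A x y, B u v - B x y) : C). specialize (H' h).
    replace ((A x y, B x y) + h)%C with ((A u v, B u v) : C) in H'
      by (apply injective_projections; simpl; ring).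
    apply H'. eapply Rle_lt_trans; [apply Cmod_le_Re_Im|]. simpl. lra. }
  split; intros eps; (eapply locally_2d_impl; [|exact (H eps)]);
    apply locally_2d_forall; intros u v Huv; eapply Rle_lt_trans; try exact Huv.
  - apply (re_le_Cmod (g (A u v, B u v) - g (A x y, B x y))%C).
  - apply (Cmod_Im_le (g (A u v, B u v) - g (A x y, B x y))%C).
Qed.

Lemma continuity_2d_pt_snd (F : R -> R -> R) (x y : R) :
  continuity_2d_pt F x y -> continuous (fun t => F x t) y.
Proof.
  intros H. apply continuity_pt_filterlim. intros eps He.
  destruct (H (mkposreal eps He)) as [d Hd]. exists d. split; [apply cond_pos|].
  intros t [_ Ht]. apply Hd; [|exact Ht]. rewrite Rminus_diag, Rabs_R0. apply cond_pos.
Qed.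

Lemma RInt_zero_nonneg (h : R -> R) (a b x : R) :
  (forall t, a <= t <= b -> continuous h t) -> (forall t, a <= t <= b -> 0 <= h t) ->
  RInt h a b = 0 -> a < x < b -> h x = 0.
Proof.
  intros Hc Hp HI Hx.
  destruct (Rle_lt_or_eq_dec 0 (h x)) as [H|H]; [apply Hp; lra| |auto]. exfalso.
  assert (Hcx : continuity_pt h x) by (apply continuity_pt_filterlim, Hc; lra).
  destruct (Hcx (h x) H) as (d & Hd & Hd').
  set (e := Rmin (d / 2) (Rmin (x - a) (b - x))).
  assert (E1 : e <= d / 2) by apply Rmin_l.
  assert (E2 : e <= x - a) by (eapply Rle_trans; [apply Rmin_r|apply Rmin_l]).
  assert (E3 : e <= b - x) by (eapply Rle_trans; [apply Rmin_r|apply Rmin_r]).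
  assert (E0 : 0 < e) by (repeat apply Rmin_pos; lra).
  assert (Ex : forall u v, a <= u -> u <= v -> v <= b -> ex_RInt h u v).
  { intros u v U1 U2 U3. apply (ex_RInt_continuous (V := R_CompleteNormedModule)).
    intros t. rewrite Rmin_left, Rmax_right by lra. intros Ht. apply Hc. lra. }
  assert (I1 : 0 <= RInt h a (x - e))
    by (apply RInt_ge_0; [lra|apply Ex; lra|intros; apply Hp; lra]).
  assert (I3 : 0 <= RInt h (x + e) b)
    by (apply RInt_ge_0; [lra|apply Ex; lra|intros; apply Hp; lra]).
  assert (I2 : 0 < RInt h (x - e) (x + e)).
  { apply RInt_gt_0; [lra| |intros; apply Hc; lra]. intros t Ht.
    destruct (Req_dec t x) as [->|N]; [exact H|].
    assert (Q : Rabs (h t - h x) < h x).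
    { apply Hd'. split; [split; [exact I|auto]|]. simpl. unfold Rdist.
      apply Rabs_def1; lra. }
    apply Rabs_def2 in Q. lra. }
  assert (C1 := RInt_Chasles h a (x - e) (x + e)
    (Ex a (x - e) ltac:(lra) ltac:(lra) ltac:(lra))
    (Ex (x - e) (x + e) ltac:(lra) ltac:(lra) ltac:(lra))).
  assert (C2 := RInt_Chasles h a (x + e) b
    (Ex a (x + e) ltac:(lra) ltac:(lra) ltac:(lra))
    (Ex (x + e) b ltac:(lra) ltac:(lra) ltac:(lra))).
  change (RInt h a (x - e) + RInt h (x - e) (x + e) = RInt h a (x + e)) in C1.
  change (RInt h a (x + e) + RInt h (x + e) b = RInt h a b) in C2. lra.
Qed.

Lemma RInt_const_R (a b c : R) : RInt (fun _ => c) a b = (b - a) * c :> R.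
Proof. exact (RInt_const a b c). Qed.

(** The mean over the circle of radius [s |v|] has zero derivative in [s] and equals [Re (f c)] at
    [s = 0]. Circles are parametrized from the direction [v], so that angle 0 is the point
    [c + s v]. Nothing is assumed on the boundary of the disc, hence [s < 1]. *)
Lemma circle_mean_value (f g : C -> C) (c v : C) :
  (forall z, Cmod (z - c)%C < Cmod v -> cderiv f z (g z) /\ ccont g z) ->
  forall s, 0 <= s < 1 ->
  (forall t, continuous (fun t => Re (f (c + RtoC s * v * cis t)%C)) t) /\
  RInt (fun t => Re (f (c + RtoC s * v * cis t)%C)) (- PI) PI = 2 * PI * Re (f c) :> R.
Proof.
  intros H.
  (* For [v = 0] the disc is empty and the hypothesis says nothing, but the integrand is
     constant. *)
  destruct (Req_dec (Cmod v) 0) as [V0|V0].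
  { intros s Hs. apply Cmod_eq_0 in V0. subst v. split.
    - intros t. apply continuous_ext with (fun _ => Re (f c)); [|apply continuous_const].
      intros x. do 2 f_equal. ring.
    - transitivity (RInt (V := R_CompleteNormedModule) (fun _ => Re (f c)) (- PI) PI).
      { apply RInt_ext. intros t _.
        replace (c + RtoC s * 0 * cis t)%C with c by ring. reflexivity. }
      rewrite RInt_const_R. ring. }
  assert (Vp : 0 < Cmod v) by (assert (Y := Cmod_ge_0 v); lra).
  assert (PP := PI_RGT_0).
  set (p := fun s t => (c + RtoC s * v * cis t)%C).
  assert (Hin : forall s t, -1 < s < 1 -> Cmod (p s t - c)%C < Cmod v).
  { intros s t Hs. unfold p.
    replace (c + RtoC s * v * cis t - c)%C with (RtoC s * v * cis t)%C by ring.
    rewrite !Cmod_mult, Cmod_cis, Cmod_R.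
    assert (Rabs s < 1) by (apply Rabs_def1; lra). nra. }
  set (U := fun s t => Re (f (p s t))).
  set (DU := fun s t => Re (g (p s t) * (v * cis t))%C).
  assert (Ds : forall s t, -1 < s < 1 -> is_derive (fun u => U u t) s (DU s t)).
  { intros s t Hs. refine (proj1 (pderiv_comp f (fun u => p u t) s (v * cis t)%C (g (p s t)) _ _)).
    - apply pderiv_ext with (2 := pderiv_line c (v * cis t)%C s).
      intros u. unfold p. ring.
    - apply H, Hin, Hs. }
  assert (Dt : forall s t, -1 < s < 1 ->
     pderiv (fun t => f (p s t)) t (g (p s t) * (Ci * (RtoC s * v) * cis t))%C).
  { intros s t Hs. apply pderiv_comp; [apply pderiv_cis|]. apply H, Hin, Hs. }
  assert (Ct : forall s t, -1 < s < 1 -> continuous (fun t => U s t) t).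
  { intros s t Hs. apply (ex_derive_continuous (K := R_AbsRing) (V := R_NormedModule)).
    eexists. exact (proj1 (Dt s t Hs)). }
  assert (CDU : forall s t, -1 < s < 1 -> continuity_2d_pt DU s t).
  { intros s t Hs.
    set (A := fun u w => Re c + (u * Re v * cos w - u * Im v * sin w)).
    set (B := fun u w => Im c + (u * Re v * sin w + u * Im v * cos w)).
    assert (Ep : forall u w, p u w = (A u w, B u w)).
    { intros u w. unfold p, A, B, cis. destruct c, v.
      apply injective_projections; simpl; ring. }
    assert (Ccos : continuity_2d_pt (fun _ w => cos w) s t)
      by (apply continuity_1d_2d_pt_comp; [apply continuity_cos|apply continuity_2d_pt_id2]).
    assert (Csin : continuity_2d_pt (fun _ w => sin w) s t)
      by (apply continuity_1d_2d_pt_comp; [apply continuity_sin|apply continuity_2d_pt_id2]).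
    assert (CA : continuity_2d_pt A s t).
    { unfold A. continuity_2d. }
    assert (CB : continuity_2d_pt B s t).
    { unfold B. continuity_2d. }
    destruct (ccont_comp_2d g A B s t CA CB) as [G1 G2].
    { rewrite <- Ep. apply H, Hin, Hs. }
    apply continuity_2d_pt_ext with
      (fun u w => Re (g (A u w, B u w)) * (Re v * cos w - Im v * sin w)
        - Im (g (A u w, B u w)) * (Re v * sin w + Im v * cos w)).
    { intros u w. unfold DU. rewrite Ep. destruct (g (A u w, B u w)), v. unfold cis. simpl. ring. }
    continuity_2d. }
  assert (Nb : forall s, -1 < s < 1 -> exists d : posreal, forall u, Rabs (u - s) < d -> -1 < u < 1).
  { intros s Hs. assert (Hd : 0 < Rmin (1 + s) (1 - s)) by (apply Rmin_pos; lra).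
    exists (mkposreal _ Hd). simpl. intros u Hu. apply Rabs_def2 in Hu.
    assert (M1 := Rmin_l (1 + s) (1 - s)). assert (M2 := Rmin_r (1 + s) (1 - s)). lra. }
  assert (DM : forall s, -1 < s < 1 ->
     is_derive (fun u => RInt (fun t => U u t) (- PI) PI) s (RInt (fun t => DU s t) (- PI) PI)).
  { intros s Hs. destruct (Nb s Hs) as [d Hd].
    assert (E : RInt (fun t => DU s t) (- PI) PI
                = RInt (fun t => Derive (fun u => U u t) s) (- PI) PI).
    { apply RInt_ext. intros t _. symmetry. apply is_derive_unique, Ds, Hs. }
    rewrite E. apply is_derive_RInt_param.
    - exists d. intros u Hu t _. eexists. apply Ds, Hd, Hu.
    - intros t _. apply continuity_2d_pt_ext_loc with DU; [|apply CDU, Hs].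
      exists d. intros u w Hu _. symmetry. apply is_derive_unique, Ds, Hd, Hu.
    - exists d. intros u Hu. apply (ex_RInt_continuous (V := R_CompleteNormedModule)).
      intros t _. apply Ct, Hd, Hu. }
  (* By the Cauchy-Riemann equations the radial derivative of [Re f] is
     [1 / s] times the angular derivative of [Im f], whose mean vanishes. *)
  assert (Z : forall s, 0 < s < 1 -> RInt (fun t => DU s t) (- PI) PI = 0 :> R).
  { intros s Hs.
    assert (I : is_RInt (fun t => DU s t) (- PI) PI
       (minus (Im (f (p s PI)) / s) (Im (f (p s (- PI))) / s))).
    { apply (is_RInt_derive (fun t => Im (f (p s t)) / s)).
      - intros t _. assert (Q := proj2 (Dt s t ltac:(lra))).
        assert (Q' := is_derive_scal _ _ (/ s) _ Q).
        replace (DU s t) with (/ s * Im (g (p s t) * (Ci * (RtoC s * v) * cis t))%C).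
        { eapply is_derive_ext; [|exact Q']. intros x. simpl. unfold Rdiv. ring. }
        unfold DU. destruct (g (p s t)), v. unfold cis. simpl. field. lra.
      - intros t _. apply continuity_2d_pt_snd, CDU. lra. }
    replace (p s (- PI)) with (p s PI) in I.
    2:{ unfold p, cis. rewrite cos_neg, sin_neg, sin_PI, Ropp_0. reflexivity. }
    rewrite (is_RInt_unique _ _ _ _ I). unfold minus, plus, opp; simpl. ring. }
  intros s Hs. split; [intros t; apply Ct; lra|].
  assert (M0 : RInt (fun t => U 0 t) (- PI) PI = 2 * PI * Re (f c) :> R).
  { transitivity (RInt (V := R_CompleteNormedModule) (fun _ => Re (f c)) (- PI) PI).
    - apply RInt_ext. intros t _. unfold U, p.
      replace (c + RtoC 0 * v * cis t)%C with c by ring. reflexivity.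
    - rewrite RInt_const_R. ring. }
  rewrite <- M0. change (RInt (fun t => U s t) (- PI) PI = RInt (fun t => U 0 t) (- PI) PI).
  destruct (Req_dec s 0) as [->|S0]; [reflexivity|].
  destruct (MVT_gen (fun u => RInt (fun t => U u t) (- PI) PI) 0 s (fun _ => 0))
    as (x & _ & Hx).
  - rewrite Rmin_left, Rmax_right by lra. intros x Hx.
    assert (Q := DM x ltac:(lra)). rewrite Z in Q by lra. exact Q.
  - rewrite Rmin_left, Rmax_right by lra. intros x Hx.
    apply continuity_pt_filterlim.
    apply (ex_derive_continuous (K := R_AbsRing) (V := R_NormedModule)
      (fun u => RInt (fun t => U u t) (- PI) PI)).
    eexists. apply DM. lra.
  - lra.
Qed.

(** On each circle [Re (f c) - Re f] is continuous, nonnegative and of zero mean, hence 0 at angle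
    0; integrating over [[- PI, PI]] makes this angle an interior point. *)
Lemma max_principle_ray (f g : C -> C) (c v : C) :
  (forall z, Cmod (z - c)%C < Cmod v -> cderiv f z (g z) /\ ccont g z) ->
  (forall z, Re (f z) <= Re (f c)) ->
  forall s, 0 <= s < 1 -> Re (f (c + RtoC s * v)%C) = Re (f c).
Proof.
  intros H Hm s Hs. destruct (circle_mean_value f g c v H s Hs) as [Hc HI].
  assert (PP := PI_RGT_0).
  set (U := fun t => Re (f (c + RtoC s * v * cis t)%C)) in *.
  assert (Hc' : forall t, continuous (fun t => Re (f c) - U t) t).
  { intros t. apply (continuous_minus (V := R_NormedModule) (fun _ => Re (f c)) U);
      [apply continuous_const|apply Hc]. }
  assert (Z : RInt (fun t => Re (f c) - U t) (- PI) PI = 0).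
  { assert (ex_RInt U (- PI) PI)
      by (apply (ex_RInt_continuous (V := R_CompleteNormedModule)); intros; apply Hc).
    assert (E := RInt_minus (V := R_CompleteNormedModule) (fun _ => Re (f c)) U (- PI) PI
       (ex_RInt_const (V := R_CompleteNormedModule) _ _ _) H0).
    eapply eq_trans; [exact E|]. rewrite HI.
    rewrite RInt_const_R. unfold minus, plus, opp; simpl. ring. }
  assert (Q := RInt_zero_nonneg _ (- PI) PI 0 (fun t _ => Hc' t)
     (fun t _ => ltac:(unfold U; specialize (Hm (c + RtoC s * v * cis t)%C); lra)) Z ltac:(lra)).
  unfold U, cis in Q. rewrite cos_0, sin_0 in Q.
  replace (RtoC s * v * (1, 0))%C with (RtoC s * v)%C in Q; [lra|].
  change ((1, 0) : C) with (RtoC 1). ring.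
Qed.

(** Without a maximum, each point of the rectangle has a neighbourhood on which [F] stays below one
    fixed value of [F]; finitely many neighbourhoods cover the rectangle, and the largest of their
    values yields the contradiction. *)
Lemma max_on_rectangle (F : R -> R -> R) (a b a' b' : R) : a <= b -> a' <= b' ->
  (forall x y, a <= x <= b -> a' <= y <= b' -> continuity_2d_pt F x y) ->
  exists x0 y0, forall x y, a <= x <= b -> a' <= y <= b' -> F x y <= F x0 y0.
Proof.
  intros Hab Hab' Hc. apply NNPP. intros HN.
  assert (Hup : forall x y, exists x' y', a <= x' <= b /\ a' <= y' <= b' /\ F x y < F x' y').
  { intros x y. apply NNPP. intros Q. apply HN. exists x, y. intros x' y' H1 H2.
    apply Rnot_lt_le. intros L. apply Q. exists x', y'. auto. }
  assert (Hloc : forall t : R * R, exists d : posreal,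
     a <= fst t <= b -> a' <= snd t <= b' -> exists x' y', a <= x' <= b /\ a' <= y' <= b' /\
       forall u v, Rabs (u - fst t) < d -> Rabs (v - snd t) < d -> F u v < F x' y').
  { intros [x y]. simpl.
    (* The gauge passed to compactness must be total, so points outside the rectangle get the dummy
       radius 1. *)
    destruct (classic (a <= x <= b /\ a' <= y <= b')) as [[B1 B2]|B];
      [|exists (mkposreal 1 Rlt_0_1); tauto].
    destruct (Hup x y) as (x' & y' & H1 & H2 & H3).
    assert (P : 0 < F x' y' - F x y) by lra.
    destruct (Hc x y B1 B2 (mkposreal _ P)) as [d Hd]. exists d. intros _ _.
    exists x', y'. split; [exact H1|]. split; [exact H2|]. intros u v Hu Hv.
    specialize (Hd u v Hu Hv). simpl in Hd. apply Rabs_def2 in Hd. lra. }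
  set (delta := fun t => proj1_sig (constructive_indefinite_description _ (Hloc t))).
  assert (Hdelta : forall x y, a <= x <= b -> a' <= y <= b' ->
     exists x' y', a <= x' <= b /\ a' <= y' <= b' /\
       forall u v, Rabs (u - x) < delta (x, y) -> Rabs (v - y) < delta (x, y) -> F u v < F x' y').
  { intros x y. exact (proj2_sig (constructive_indefinite_description _ (Hloc (x, y)))). }
  apply (compactness_list 2 (a, (a', tt)) (b, (b', tt)) (fun t => delta (fst t, fst (snd t)))).
  intros [l Hl].
  (* A best value dominating one of the finitely many neighbourhoods lies itself
     in one of them, hence is beaten. *)
  assert (Hbest : forall l : list (R * (R * unit)), exists x0 y0,
     a <= x0 <= b /\ a' <= y0 <= b' /\ forall t, List.In t l ->
       a <= fst t <= b -> a' <= fst (snd t) <= b' ->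
       forall u v, Rabs (u - fst t) < delta (fst t, fst (snd t)) ->
         Rabs (v - fst (snd t)) < delta (fst t, fst (snd t)) -> F u v < F x0 y0).
  { clear l Hl. induction l as [|[x [y []]] l IH].
    - exists a, a'. split; [lra|]. split; [lra|]. intros t [].
    - destruct IH as (x0 & y0 & B1 & B2 & IH).
      destruct (classic (a <= x <= b /\ a' <= y <= b')) as [[D1 D2]|D].
      + destruct (Hdelta x y D1 D2) as (x' & y' & E1 & E2 & E3).
        destruct (Rle_dec (F x0 y0) (F x' y')) as [Q|Q].
        * exists x', y'. split; [exact E1|]. split; [exact E2|].
          intros t [<-|Ht] T1 T2 u v Hu Hv; [apply E3; assumption|].
          eapply Rlt_le_trans; [apply (IH t Ht T1 T2 u v Hu Hv)|exact Q].
        * exists x0, y0. split; [exact B1|]. split; [exact B2|].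
          intros t [<-|Ht] T1 T2 u v Hu Hv; [|apply (IH t Ht T1 T2 u v Hu Hv)].
          specialize (E3 u v Hu Hv). lra.
      + exists x0, y0. split; [exact B1|]. split; [exact B2|].
        intros t [<-|Ht] T1 T2 u v Hu Hv; [exfalso; simpl in *; tauto|].
        apply (IH t Ht T1 T2 u v Hu Hv). }
  destruct (Hbest l) as (x0 & y0 & B1 & B2 & HB).
  destruct (Hl (x0, (y0, tt))) as ([x [y []]] & Ht & Hb & Hcl); [simpl; tauto|].
  simpl in Hb, Hcl.
  assert (Q := HB (x, (y, tt)) Ht ltac:(simpl; tauto) ltac:(simpl; tauto) x0 y0
    ltac:(simpl; tauto) ltac:(simpl; tauto)). lra.
Qed.

Lemma lattice_reduction (w1 w2 z : C) : lattice_basis w1 w2 ->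
  exists s t p, 0 <= s <= 1 /\ 0 <= t <= 1 /\ in_lattice w1 w2 p /\
    z = (RtoC s * w1 + RtoC t * w2 + p)%C.
Proof.
  intros H. set (D := Im (w1 * Cconj w2)%C). assert (HD : D <> 0) by exact H.
  set (x := Im (z * Cconj w2)%C / D). set (y := - Im (z * Cconj w1)%C / D).
  assert (E : z = (RtoC x * w1 + RtoC y * w2)%C).
  { unfold x, y. unfold D in *. destruct z, w1, w2. simpl in *.
    apply injective_projections; simpl; field; lra. }
  (* [up x] is the least integer above [x], so [up x - 1] is the integer part. *)
  destruct (archimed x) as [X1 X2]. destruct (archimed y) as [Y1 Y2].
  exists (x - IZR (up x - 1)), (y - IZR (up y - 1)), (lattice_point w1 w2 (up x - 1) (up y - 1)).
  rewrite !minus_IZR. split; [lra|]. split; [lra|].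
  split; [do 2 eexists; reflexivity|].
  rewrite E at 1. unfold lattice_point. rewrite !minus_IZR, !RtoC_minus. ring.
Qed.

Lemma lattice_liouville_re (w1 w2 : C) (F G : C -> C) : lattice_basis w1 w2 ->
  (forall z p, in_lattice w1 w2 p -> F (z + p)%C = F z) ->
  (forall z, ccont F z) ->
  (forall z, in_lattice w1 w2 z -> F z = 0%C) ->
  (forall z, ~ in_lattice w1 w2 z -> cderiv F z (G z) /\ ccont G z) ->
  forall z, Re (F z) <= 0.
Proof.
  intros HB Hper Hc H0 Hd.
  assert (Hmax : exists c, forall z, Re (F z) <= Re (F c)).
  { destruct (max_on_rectangle (fun s t => Re (F (RtoC s * w1 + RtoC t * w2)%C)) 0 1 0 1)
      as (s0 & t0 & Hm); [lra|lra| |].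
    - intros x y _ _.
      set (A := fun u v => u * Re w1 + v * Re w2). set (B := fun u v => u * Im w1 + v * Im w2).
      assert (Ep : forall u v, (RtoC u * w1 + RtoC v * w2)%C = (A u v, B u v))
        by (intros; unfold A, B; destruct w1, w2; apply injective_projections; simpl; ring).
      apply continuity_2d_pt_ext with (fun u v => Re (F (A u v, B u v)));
        [intros; rewrite Ep; reflexivity|].
      apply ccont_comp_2d; [| |apply Hc]; unfold A, B;
      continuity_2d.
    - exists (RtoC s0 * w1 + RtoC t0 * w2)%C. intros z.
      destruct (lattice_reduction w1 w2 z HB) as (s & t & p & Hs & Ht & Hp & ->).
      rewrite (Hper _ _ Hp). apply Hm; assumption. }
  destruct Hmax as [c Hm]. intros z. apply Rle_trans with (1 := Hm z).
  destruct (classic (in_lattice w1 w2 c)) as [L|L]; [rewrite (H0 c L); simpl; lra|].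
  destruct (nearest_lattice_point w1 w2 c HB) as (p & Hp & Hnear).
  (* The open disc of radius [|p - c|] about [c] contains no lattice point because [p] is a nearest
     one. *)
  assert (Hray : forall s, 0 <= s < 1 -> Re (F (c + RtoC s * (p - c))%C) = Re (F c)).
  { apply max_principle_ray with G; [|exact Hm]. intros x Hx. apply Hd. intros Lx.
    specialize (Hnear x Lx). lra. }
  apply Rnot_lt_le. intros Hpos.
  destruct (Hc p (Re (F c)) Hpos) as (d & Hd0 & Hd').
  set (v := (p - c)%C). set (k := Cmod v + 1).
  assert (Hk : 0 < k) by (assert (Y := Cmod_ge_0 v); unfold k; lra).
  set (e := Rmin 1 (d / (2 * k))).
  assert (He : 0 < e) by (apply Rmin_pos; [lra|apply Rdiv_lt_0_compat; lra]).
  assert (E1 : e <= 1) by apply Rmin_l. assert (E2 : e <= d / (2 * k)) by apply Rmin_r.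
  (* The point [c + (1 - e) v] is [p - e v]: there [Re F] keeps the positive value [Re (F c)], while
     continuity at [p], where [F] is 0, makes [F] smaller than that. *)
  specialize (Hray (1 - e) ltac:(lra)). fold v in Hray.
  specialize (Hd' (RtoC (- e) * v)%C).
  replace (p + RtoC (- e) * v)%C with (c + RtoC (1 - e) * v)%C in Hd'
    by (unfold v; rewrite RtoC_opp, RtoC_minus; ring).
  rewrite (H0 p Hp) in Hd'. replace (F (c + RtoC (1 - e) * v) - 0)%C
    with (F (c + RtoC (1 - e) * v)%C) in Hd' by ring.
  assert (Q : Cmod (RtoC (- e) * v)%C < d).
  { rewrite Cmod_mult, Cmod_R, Rabs_Ropp, Rabs_pos_eq by lra.
    apply Rle_lt_trans with (d / (2 * k) * k).
    - apply Rmult_le_compat; try lra; [apply Cmod_ge_0|unfold k; lra].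
    - replace (d / (2 * k) * k) with (d / 2) by (field; lra). lra. }
  specialize (Hd' Q). assert (T := re_le_Cmod (F (c + RtoC (1 - e) * v)%C)).
  rewrite Hray in T. assert (T' := Rle_abs (Re (F c))). lra.
Qed.

Lemma lattice_liouville (w1 w2 : C) (F G : C -> C) : lattice_basis w1 w2 ->
  (forall z p, in_lattice w1 w2 p -> F (z + p)%C = F z) ->
  (forall z, ccont F z) ->
  (forall z, in_lattice w1 w2 z -> F z = 0%C) ->
  (forall z, ~ in_lattice w1 w2 z -> cderiv F z (G z) /\ ccont G z) ->
  forall z, F z = 0%C.
Proof.
  intros HB Hper Hc H0 Hd z.
  (* The one-sided bound on the real part, applied to [F] times 1, -1, [Ci] and [- Ci], annihilates
     both components. *)
  assert (Key : forall a : C, Re (a * F z)%C <= 0).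
  { intros a. apply (lattice_liouville_re w1 w2 (fun x => a * F x)%C (fun x => a * G x)%C HB).
    - intros x p Hp. rewrite (Hper x p Hp). reflexivity.
    - intros x. apply ccont_scal, Hc.
    - intros x Hx. rewrite (H0 x Hx). ring.
    - intros x Hx. destruct (Hd x Hx) as [D1 D2]. split; [|apply ccont_scal, D2].
      eapply cderiv_eq; [exact (cderiv_mult _ _ _ _ _ (cderiv_const a x) D1)|]. cbv beta. ring. }
  assert (K1 := Key 1%C). assert (K2 := Key (-1)%C). assert (K3 := Key Ci).
  assert (K4 := Key (- Ci)%C). destruct (F z) as [x y]. simpl in *.
  apply injective_projections; simpl; lra.
Qed.

(** * The sums over the nonzero lattice points *)

(** The origin is allowed: the sums over nonzero lattice points are holomorphic there, which is what
    the Laurent expansions of [wp] and its derivatives rest on. *)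
Definition regular (w1 w2 z : C) : Prop :=
  forall m n, nonzero_pair m n -> z <> lattice_point w1 w2 m n.

Lemma regular_0 (w1 w2 : C) : lattice_basis w1 w2 -> regular w1 w2 0%C.
Proof.
  intros HB m n Q E. apply (lattice_point_neq_0 w1 w2 m n HB Q). symmetry. exact E.
Qed.

Lemma regular_not_in_lattice (w1 w2 z : C) : ~ in_lattice w1 w2 z -> regular w1 w2 z.
Proof. intros H m n _ E. apply H. exists m, n. exact E. Qed.

Lemma regular_inv_bound (w1 w2 z : C) : lattice_basis w1 w2 -> regular w1 w2 z ->
  exists A eps, 0 < A /\ 0 < eps /\ forall h, Cmod h < eps -> forall m n, nonzero_pair m n ->
    (z + h - lattice_point w1 w2 m n)%C <> 0%C /\
    Cmod (/ (z + h - lattice_point w1 w2 m n))%C <= A / lnorm m n.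
Proof.
  intros HB Hz. destruct (lattice_separation w1 w2 z HB Hz) as (c & e & Hc & He & H).
  exists (/ c), e. split; [apply Rinv_0_lt_compat, Hc|]. split; [exact He|].
  intros h Hh m n Q. specialize (H h Hh m n Q). assert (L := lnorm_ge_1 m n).
  assert (P : 0 < c * lnorm m n) by nra.
  assert (N : (z + h - lattice_point w1 w2 m n)%C <> 0%C) by (apply Cmod_gt_0; lra).
  split; [exact N|]. rewrite Cmod_inv by exact N.
  replace (/ c / lnorm m n) with (/ (c * lnorm m n)) by (field; lra).
  apply Rinv_le_contravar; lra.
Qed.

Lemma regular_near (w1 w2 z : C) : lattice_basis w1 w2 -> regular w1 w2 z ->
  exists eps, 0 < eps /\ forall h, Cmod h < eps -> regular w1 w2 (z + h)%C.
Proof.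
  intros HB Hz. destruct (regular_inv_bound w1 w2 z HB Hz) as (A & e & HA & He & H).
  exists e. split; [exact He|]. intros h Hh m n Q E. apply (proj1 (H h Hh m n Q)).
  rewrite E. ring.
Qed.

Lemma lattice_point_inv_bound (w1 w2 : C) : lattice_basis w1 w2 ->
  exists A, 0 < A /\ forall m n, nonzero_pair m n ->
    Cmod (/ lattice_point w1 w2 m n)%C <= A / lnorm m n.
Proof.
  intros HB. destruct (lattice_point_lower w1 w2 HB) as (k & Hk & H).
  exists (/ k). split; [apply Rinv_0_lt_compat, Hk|]. intros m n Q. specialize (H m n Q).
  assert (L := lnorm_ge_1 m n). assert (P : 0 < k * lnorm m n) by nra.
  rewrite Cmod_inv by (apply lattice_point_neq_0; assumption).
  replace (/ k / lnorm m n) with (/ (k * lnorm m n)) by (field; lra).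
  apply Rinv_le_contravar; lra.
Qed.

Lemma pow_lnorm_bound (A : R) (k : nat) (m n : Z) : 0 < A -> (3 <= k)%nat ->
  (A / lnorm m n) ^ k <= A ^ k / lnorm m n ^ 3.
Proof.
  intros HA Hk. assert (L := lnorm_ge_1 m n). unfold Rdiv. rewrite Rpow_mult_distr, pow_inv.
  apply Rmult_le_compat_l; [apply pow_le; lra|].
  apply Rinv_le_contravar; [apply pow_lt; lra|]. apply Rle_pow; assumption.
Qed.

(** The term of the origin is kept apart, so that this sum remains holomorphic at 0. Exponents
    [k >= 3] converge absolutely as they stand; exponent 2 needs the correction built into
    [esum2]. *)
Definition esum (w1 w2 : C) (k : nat) (z : C) : C :=
  lattice_sum w1 w2 (fun w => / (z - w) ^ k)%C.

Definition esum2 (w1 w2 : C) (z : C) : C :=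
  lattice_sum w1 w2 (fun w => / (z - w) ^ 2 - / w ^ 2)%C.

Lemma esum_lbound (w1 w2 : C) (k : nat) (z : C) : lattice_basis w1 w2 -> regular w1 w2 z ->
  (3 <= k)%nat -> exists B, 0 <= B /\ lbound w1 w2 (fun w => / (z - w) ^ k)%C B.
Proof.
  intros HB Hz Hk. destruct (regular_inv_bound w1 w2 z HB Hz) as (A & e & HA & He & H).
  exists (A ^ k). split; [apply pow_le; lra|]. intros m n Q.
  destruct (H 0%C ltac:(rewrite Cmod_0; exact He) m n Q) as [N I]. rewrite Cplus_0_r in N, I.
  rewrite <- Cpow_inv, Cmod_pow by exact N.
  eapply Rle_trans; [apply pow_incr; split; [apply Cmod_ge_0|exact I]|].
  apply pow_lnorm_bound; assumption.
Qed.

Lemma is_lsum_esum (w1 w2 : C) (k : nat) (z : C) : lattice_basis w1 w2 -> regular w1 w2 z ->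
  (3 <= k)%nat -> is_lsum w1 w2 (fun w => / (z - w) ^ k)%C (esum w1 w2 k z).
Proof.
  intros HB Hz Hk. destruct (esum_lbound w1 w2 k z HB Hz Hk) as (B & HB0 & HBd).
  exact (lsum_ex _ _ _ B HB0 HBd).
Qed.

Lemma is_lsum_esum2 (w1 w2 : C) (z : C) : lattice_basis w1 w2 -> regular w1 w2 z ->
  is_lsum w1 w2 (fun w => / (z - w) ^ 2 - / w ^ 2)%C (esum2 w1 w2 z).
Proof.
  intros HB Hz. destruct (regular_inv_bound w1 w2 z HB Hz) as (A & e & HA & He & H).
  destruct (lattice_point_inv_bound w1 w2 HB) as (A0 & HA0 & H0).
  assert (Pz := Cmod_ge_0 z).
  apply lsum_ex with (Cmod z * (A * A0 * (A + A0))).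
  { repeat apply Rmult_le_pos; lra. }
  intros m n Q. assert (L := lnorm_ge_1 m n).
  destruct (H 0%C ltac:(rewrite Cmod_0; exact He) m n Q) as [N I]. rewrite Cplus_0_r in N, I.
  assert (N0 := lattice_point_neq_0 w1 w2 m n HB Q). specialize (H0 m n Q).
  set (w := lattice_point w1 w2 m n) in *.
  (* A difference of squares whose factor [/ (z - w) + / w] equals [z / ((z - w) * w)]: this gains
     the power of decay that a single inverse square lacks. *)
  replace (/ (z - w) ^ 2 - / w ^ 2)%C
    with (z * (/ (z - w) * / w * (/ (z - w) - / w)))%C
    by (field; split; assumption).
  rewrite !Cmod_mult.
  replace (Cmod z * (A * A0 * (A + A0)) / lnorm m n ^ 3)
    with (Cmod z * ((A / lnorm m n) * (A0 / lnorm m n) * (A / lnorm m n + A0 / lnorm m n)))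
    by (field; lra).
  apply Rmult_le_compat_l; [exact Pz|].
  apply Rmult_le_compat; [apply Rmult_le_pos; apply Cmod_ge_0|apply Cmod_ge_0| |].
  - apply Rmult_le_compat; try apply Cmod_ge_0; assumption.
  - eapply Rle_trans; [apply Cmod_minus_le|]. lra.
Qed.

(** Here [a] and [b] stand for [1 / x] and [1 / (x + h)], whose relation is [b - a = - h a b]. The
    remainder of [x ^ (-k)] after the linear term carries [k + 2] inverse factors, enough for cubic
    decay as soon as [k >= 1]. *)
Lemma inv_pow_taylor_bound (k : nat) : exists K, 0 <= K /\ forall a b h X,
  (b - a = - (h * a * b))%C -> Cmod a <= X -> Cmod b <= X ->
  Cmod (b ^ k - a ^ k + INR k * a ^ S k * h)%C <= K * Cmod h ^ 2 * X ^ (k + 2).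
Proof.
  induction k as [|k (K & HK & IH)].
  - exists 0. split; [lra|]. intros a b h X _ _ _. simpl INR.
    replace (b ^ 0 - a ^ 0 + 0 * a ^ 1 * h)%C with (RtoC 0) by (simpl; ring).
    rewrite Cmod_0. lra.
  - exists (K + INR (S k)). split; [assert (Y := pos_INR (S k)); lra|].
    intros a b h X E Ha Hb. specialize (IH a b h X E Ha Hb).
    assert (PX : 0 <= X) by (eapply Rle_trans; [apply Cmod_ge_0|exact Ha]).
    replace (b ^ S k - a ^ S k + INR (S k) * a ^ S (S k) * h)%C
      with (b * (b ^ k - a ^ k + INR k * a ^ S k * h)
            + INR (S k) * (h ^ 2 * (a ^ S (S k) * b)))%C.
    (* The recursion holds only modulo the relation [D]; the subtracted product is the explicit
       cofactor times [D], so that [ring] closes the rest. *)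
    2:{ assert (D : (b - a + h * a * b = 0)%C) by (rewrite E; ring).
        transitivity (b ^ S k - a ^ S k + INR (S k) * a ^ S (S k) * h
          - a ^ k * (b - a + h * a * b) * (1 - INR (S k) * h * a))%C; [|rewrite D; ring].
        rewrite S_INR, RtoC_plus, !Cpow_S. ring. }
    eapply Rle_trans; [apply Cmod_triangle|].
    rewrite !Cmod_mult, !Cmod_pow, Cmod_R, (Rabs_pos_eq (INR (S k))) by apply pos_INR.
    rewrite !Rmult_plus_distr_r. apply Rplus_le_compat.
    + replace (K * Cmod h ^ 2 * X ^ (S k + 2)) with (X * (K * Cmod h ^ 2 * X ^ (k + 2)))
        by (simpl; ring).
      apply Rmult_le_compat; try apply Cmod_ge_0; assumption.
    + rewrite Rmult_assoc. apply Rmult_le_compat_l; [apply pos_INR|].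
      apply Rmult_le_compat_l; [apply pow2_ge_0|].
      replace (X ^ (S k + 2)) with (X ^ S (S k) * X)
        by (replace (S k + 2)%nat with (S (S (S k))) by lia; simpl; ring).
      apply Rmult_le_compat; [apply pow_le, Cmod_ge_0|apply Cmod_ge_0| |exact Hb].
      apply pow_incr. split; [apply Cmod_ge_0|exact Ha].
Qed.

(** Term-by-term differentiation in one estimate: termwise remainders bounded by [B * |h| ^ 2] with
    cubic decay add up to at most [16 B |h| ^ 2], exactly the shape demanded by [cderiv]. *)
Lemma cderiv_lsum (w1 w2 : C) (F : C -> C -> C) (f D : C -> C) (z d : C) (eps B : R) :
  0 < eps -> 0 <= B ->
  (forall h, Cmod h < eps -> is_lsum w1 w2 (F (z + h)%C) (f (z + h)%C)) ->
  is_lsum w1 w2 D d ->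
  (forall h, Cmod h < eps -> lbound w1 w2
     (fun w => F (z + h)%C w - F z w - D w * h)%C (B * Cmod h ^ 2)) ->
  cderiv f z d.
Proof.
  intros He HB HF HD Hb. apply (cderiv_intro _ _ _ eps (16 * B) He). intros h Hh.
  rewrite Rmult_assoc. apply (is_lsum_bound w1 w2
     (fun w => F (z + h)%C w - F z w - D w * h)%C); [apply Rmult_le_pos; [exact HB|apply pow2_ge_0]
     |apply Hb, Hh|].
  assert (F0 := HF 0%C ltac:(rewrite Cmod_0; exact He)). rewrite Cplus_0_r in F0.
  assert (Q := is_lsum_plus _ _ _ _ _ _ (HF h Hh)
    (is_lsum_plus _ _ _ _ _ _ (is_lsum_scal w1 w2 (RtoC (-1)) _ _ F0)
      (is_lsum_scal w1 w2 (- h)%C _ _ HD))).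
  simpl in Q.
  replace (f (z + h) - f z - d * h)%C
    with (f (z + h) + (RtoC (-1) * f z + - h * d))%C by ring.
  apply is_lsum_ext with (2 := Q). intros m n _. ring.
Qed.

(** The function [a] is the convergence correction, independent of the variable and so invisible to
    the derivative: 0 for [k >= 3], and [/ w ^ 2] for [k = 2]. *)
Lemma cderiv_inv_pow_lsum (w1 w2 : C) (k : nat) (z : C) (a : C -> C) (f : C -> C) (d : C) :
  (1 <= k)%nat -> lattice_basis w1 w2 -> regular w1 w2 z ->
  (forall x, regular w1 w2 x -> is_lsum w1 w2 (fun w => / (x - w) ^ k - a w)%C (f x)) ->
  is_lsum w1 w2 (fun w => / (z - w) ^ S k)%C d ->
  cderiv f z (- INR k * d)%C.
Proof.
  intros Hk HB Hz Hf Hd.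
  destruct (regular_inv_bound w1 w2 z HB Hz) as (A & e1 & HA & He1 & H).
  destruct (regular_near w1 w2 z HB Hz) as (e2 & He2 & Hr).
  destruct (inv_pow_taylor_bound k) as (K & HK & HT).
  apply (cderiv_lsum w1 w2 (fun x w => / (x - w) ^ k - a w)%C f
    (fun w => - INR k * / (z - w) ^ S k)%C z _ (Rmin e1 e2) (K * A ^ (k + 2))).
  - apply Rmin_pos; assumption.
  - apply Rmult_le_pos; [exact HK|apply pow_le; lra].
  - intros h Hh. apply Hf, Hr. eapply Rlt_le_trans; [exact Hh|apply Rmin_r].
  - apply is_lsum_scal, Hd.
  - intros h Hh m n Q. assert (L := lnorm_ge_1 m n).
    destruct (H h ltac:(eapply Rlt_le_trans; [exact Hh|apply Rmin_l]) m n Q) as [N1 I1].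
    destruct (H 0%C ltac:(rewrite Cmod_0; exact He1) m n Q) as [N0 I0].
    rewrite Cplus_0_r in N0, I0. set (w := lattice_point w1 w2 m n) in *.
    replace (/ (z + h - w) ^ k - a w - (/ (z - w) ^ k - a w) - - INR k * / (z - w) ^ S k * h)%C
      with ((/ (z + h - w)) ^ k - (/ (z - w)) ^ k + INR k * (/ (z - w)) ^ S k * h)%C
      by (rewrite !Cpow_inv by assumption; ring).
    eapply Rle_trans; [apply HT; [|exact I0|exact I1]|].
    + field; split; assumption.
    + replace (K * A ^ (k + 2) * Cmod h ^ 2 / lnorm m n ^ 3)
        with (K * Cmod h ^ 2 * (A ^ (k + 2) / lnorm m n ^ 3)) by (field; lra).
      apply Rmult_le_compat_l; [apply Rmult_le_pos; [exact HK|apply pow2_ge_0]|].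
      apply pow_lnorm_bound; [exact HA|lia].
Qed.

Lemma cderiv_esum (w1 w2 : C) (k : nat) (z : C) : (3 <= k)%nat ->
  lattice_basis w1 w2 -> regular w1 w2 z ->
  cderiv (esum w1 w2 k) z (- INR k * esum w1 w2 (S k) z)%C.
Proof.
  intros Hk HB Hz. apply (cderiv_inv_pow_lsum w1 w2 k z (fun _ => 0%C)); try assumption; [lia| |].
  - intros x Hx. apply is_lsum_ext with (2 := is_lsum_esum w1 w2 k x HB Hx Hk).
    intros m n _. ring.
  - apply is_lsum_esum; try assumption. lia.
Qed.

Lemma cderiv_esum2 (w1 w2 z : C) : lattice_basis w1 w2 -> regular w1 w2 z ->
  cderiv (esum2 w1 w2) z (- 2 * esum w1 w2 3 z)%C.
Proof.
  intros HB Hz. apply cderiv_eq with (- INR 2 * esum w1 w2 3 z)%C;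
    [|replace (INR 2) with 2 by (simpl; ring); ring].
  apply (cderiv_inv_pow_lsum w1 w2 2 z (fun w => / w ^ 2)%C); try assumption; [lia| |].
  - intros x Hx. apply is_lsum_esum2; assumption.
  - apply is_lsum_esum; try assumption. lia.
Qed.

(** * The Weierstrass function *)

Definition wp1 (w1 w2 z : C) : C := (- 2 * / z ^ 3 - 2 * esum w1 w2 3 z)%C.
Definition wp2 (w1 w2 z : C) : C := (6 * / z ^ 4 + 6 * esum w1 w2 4 z)%C.

Lemma not_in_lattice_neq_0 (w1 w2 z : C) : ~ in_lattice w1 w2 z -> z <> 0%C.
Proof. intros H ->. apply H, in_lattice_0. Qed.

Lemma cderiv_inv_pow (k : nat) (z : C) : z <> 0%C ->
  cderiv (fun x => / x ^ S k)%C z (- INR (S k) * / z ^ S (S k))%C.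
Proof.
  intros Hz. eapply cderiv_eq.
  - apply cderiv_inv; [apply cderiv_pow, cderiv_id|apply Cpow_nz, Hz].
  - rewrite !Cpow_S. field. split; [apply Cpow_nz, Hz|exact Hz].
Qed.

Lemma cderiv_wp (w1 w2 z : C) : lattice_basis w1 w2 -> ~ in_lattice w1 w2 z ->
  cderiv (wp w1 w2) z (wp1 w1 w2 z).
Proof.
  intros HB Hz. eapply cderiv_eq.
  - apply (cderiv_plus (fun x => / x ^ 2)%C (esum2 w1 w2)).
    + apply cderiv_inv_pow, (not_in_lattice_neq_0 w1 w2), Hz.
    + apply cderiv_esum2; [exact HB|apply regular_not_in_lattice, Hz].
  - unfold wp1. replace (INR 2) with 2 by (simpl; ring). ring.
Qed.

Lemma cderiv_wp1 (w1 w2 z : C) : lattice_basis w1 w2 -> ~ in_lattice w1 w2 z ->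
  cderiv (wp1 w1 w2) z (wp2 w1 w2 z).
Proof.
  intros HB Hz. eapply cderiv_eq.
  - apply (cderiv_minus (fun x => - 2 * / x ^ 3)%C (fun x => 2 * esum w1 w2 3 x)%C).
    + apply cderiv_mult; [apply cderiv_const|].
      apply cderiv_inv_pow, (not_in_lattice_neq_0 w1 w2), Hz.
    + apply cderiv_mult; [apply cderiv_const|].
      apply cderiv_esum; [lia|exact HB|apply regular_not_in_lattice, Hz].
  - unfold wp2. replace (INR 3) with 3 by (simpl; ring). ring.
Qed.

Lemma cderiv_wp2 (w1 w2 z : C) : lattice_basis w1 w2 -> ~ in_lattice w1 w2 z ->
  cderiv (wp2 w1 w2) z (- 24 * / z ^ 5 - 24 * esum w1 w2 5 z)%C.
Proof.
  intros HB Hz. eapply cderiv_eq.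
  - apply (cderiv_plus (fun x => 6 * / x ^ 4)%C (fun x => 6 * esum w1 w2 4 x)%C).
    + apply cderiv_mult; [apply cderiv_const|].
      apply cderiv_inv_pow, (not_in_lattice_neq_0 w1 w2), Hz.
    + apply cderiv_mult; [apply cderiv_const|].
      apply cderiv_esum; [lia|exact HB|apply regular_not_in_lattice, Hz].
  - replace (INR 4) with 4 by (simpl; ring). ring.
Qed.

Lemma esum_reflect (w1 w2 : C) (k : nat) (z : C) : lattice_basis w1 w2 ->
  ~ in_lattice w1 w2 z -> (3 <= k)%nat ->
  esum w1 w2 k (- z)%C = ((-1) ^ k * esum w1 w2 k z)%C.
Proof.
  intros HB Hz Hk.
  assert (Hz' : ~ in_lattice w1 w2 (- z)%C).
  { intros Q. apply Hz. replace z with (- - z)%C by ring. apply in_lattice_opp, Q. }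
  apply (is_lsum_unique w1 w2 (fun w => / (- z - w) ^ k)%C).
  - apply is_lsum_esum; [exact HB|apply regular_not_in_lattice, Hz'|exact Hk].
  - assert (Q := is_lsum_scal w1 w2 ((-1) ^ k)%C _ _ (is_lsum_reflect _ _ _ _
      (is_lsum_esum w1 w2 k z HB (regular_not_in_lattice _ _ _ Hz) Hk))).
    apply is_lsum_ext with (2 := Q). intros m n _.
    set (w := lattice_point w1 w2 m n). simpl.
    assert (N : (z - - w)%C <> 0%C).
    { intros E. apply Hz. exists (- m)%Z, (- n)%Z. rewrite lattice_point_opp. fold w.
      replace z with (z - - w + - w)%C by ring. rewrite E. ring. }
    assert (M : RtoC (-1) <> 0%C) by (intros E; apply RtoC_inj in E; lra).
    replace (- z - w)%C with (/ (-1) * (z - - w))%C by (field; exact M).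
    rewrite Cpow_mult_l, Cpow_inv by exact M.
    field. split; apply Cpow_nz; assumption.
Qed.

Lemma wp_even (w1 w2 z : C) : lattice_basis w1 w2 -> ~ in_lattice w1 w2 z ->
  wp w1 w2 (- z)%C = wp w1 w2 z.
Proof.
  intros HB Hz.
  assert (Hz' : ~ in_lattice w1 w2 (- z)%C).
  { intros Q. apply Hz. replace z with (- - z)%C by ring. apply in_lattice_opp, Q. }
  change (/ (- z) ^ 2 + esum2 w1 w2 (- z) = / z ^ 2 + esum2 w1 w2 z)%C.
  f_equal; [f_equal; ring|].
  apply (is_lsum_unique w1 w2 (fun w => / (- z - w) ^ 2 - / w ^ 2)%C).
  - apply is_lsum_esum2; [exact HB|apply regular_not_in_lattice, Hz'].
  - assert (Q := is_lsum_reflect _ _ _ _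
      (is_lsum_esum2 w1 w2 z HB (regular_not_in_lattice _ _ _ Hz))).
    apply is_lsum_ext with (2 := Q). intros m n _. cbv beta.
    set (w := lattice_point w1 w2 m n).
    replace ((- z - w) ^ 2)%C with ((z - - w) ^ 2)%C by ring.
    replace ((- w) ^ 2)%C with (w ^ 2)%C by ring. reflexivity.
Qed.

Lemma wp1_odd (w1 w2 z : C) : lattice_basis w1 w2 -> ~ in_lattice w1 w2 z ->
  wp1 w1 w2 (- z)%C = (- wp1 w1 w2 z)%C.
Proof.
  intros HB Hz. unfold wp1. rewrite esum_reflect by (assumption || lia).
  field. exact (not_in_lattice_neq_0 _ _ _ Hz).
Qed.

(** * Periodicity *)

Lemma zsum_delta (N : nat) (x : C) :
  zsum N (fun m => if Z.eqb m 0 then x else 0%C) = x.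
Proof.
  induction N as [|N IH]; [rewrite zsum_0; reflexivity|].
  rewrite zsum_S, IH.
  replace (Z.eqb (- Z.of_nat (S N)) 0) with false by (symmetry; apply Z.eqb_neq; lia).
  replace (Z.eqb (Z.of_nat (S N)) 0) with false by (symmetry; apply Z.eqb_neq; lia).
  ring.
Qed.

(** Includes the origin and omits the correction [/ w ^ 2], which is the same for [z] and [z + w1]
    and cancels in their difference. Working with finite squares avoids any question about
    convergence of the uncorrected series. *)
Definition full_sum (w1 w2 z : C) (N : nat) : C :=
  zsum N (fun m => zsum N (fun n => / (z - lattice_point w1 w2 m n) ^ 2))%C.

Lemma full_sum_partial (w1 w2 z : C) (N : nat) :
  (/ z ^ 2 + lattice_partial_sum w1 w2 (fun w => / (z - w) ^ 2 - / w ^ 2) N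
   = full_sum w1 w2 z N - lattice_partial_sum w1 w2 (fun w => / w ^ 2) N)%C.
Proof.
  assert (E : full_sum w1 w2 z N = (lattice_partial_sum w1 w2
      (fun w => / (z - w) ^ 2 - / w ^ 2) N + lattice_partial_sum w1 w2 (fun w => / w ^ 2) N
      + / z ^ 2)%C); [|rewrite E; ring].
  rewrite <- (zsum_delta N (/ z ^ 2)%C), !lattice_partial_sum_zsum, <- !zsum_plus.
  unfold full_sum. apply zsum_ext. intros m _. rewrite <- zsum_plus.
  destruct (Z.eqb_spec m 0) as [->|Hm].
  - rewrite <- (zsum_delta N (/ z ^ 2)%C), <- zsum_plus. apply zsum_ext. intros n _.
    destruct (Z.eqb_spec n 0) as [->|Hn].
    + rewrite !lterm_zero, lattice_point_0.
      replace (z - 0)%C with z by ring. ring.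
    + rewrite !lterm_nonzero by (right; exact Hn). ring.
  - rewrite Cplus_0_r. apply zsum_ext. intros n _.
    rewrite !lterm_nonzero by (left; exact Hm). ring.
Qed.

(** Translation by [w1] shifts the index [m] by one, so for fixed [n] the difference telescopes in
    [m]. *)
Lemma full_sum_shift (w1 w2 z : C) (N : nat) :
  (full_sum w1 w2 (z + w1) N - full_sum w1 w2 z N
   = zsum N (fun n => / (z - lattice_point w1 w2 (- Z.of_nat N - 1) n) ^ 2
                      + - / (z - lattice_point w1 w2 (Z.of_nat N) n) ^ 2))%C.
Proof.
  unfold full_sum.
  rewrite (zsum_switch N N (fun m n => / (z + w1 - lattice_point w1 w2 m n) ^ 2)%C),
    (zsum_switch N N (fun m n => / (z - lattice_point w1 w2 m n) ^ 2)%C).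
  replace (zsum N (fun n => zsum N (fun m => / (z + w1 - lattice_point w1 w2 m n) ^ 2))
    - zsum N (fun n => zsum N (fun m => / (z - lattice_point w1 w2 m n) ^ 2)))%C
    with (zsum N (fun n => zsum N (fun m => / (z + w1 - lattice_point w1 w2 m n) ^ 2))
    + -1 * zsum N (fun n => zsum N (fun m => / (z - lattice_point w1 w2 m n) ^ 2)))%C by ring.
  rewrite <- zsum_scal, <- zsum_plus. apply zsum_ext. intros n _.
  rewrite <- zsum_scal, <- zsum_plus.
  set (F := fun m => (- / (z - lattice_point w1 w2 (m - 1) n) ^ 2)%C).
  transitivity (zsum N (fun m => F (m + 1)%Z - F m)%C).
  - apply zsum_ext. intros m _. unfold F.
    replace (m + 1 - 1)%Z with m by lia.
    replace (z + w1 - lattice_point w1 w2 m n)%C with (z - lattice_point w1 w2 (m - 1) n)%C.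
    + ring.
    + unfold lattice_point. rewrite minus_IZR, RtoC_minus. ring.
  - rewrite zsum_telescope. unfold F. replace (Z.of_nat N + 1 - 1)%Z with (Z.of_nat N) by lia.
    ring.
Qed.

(** Shifting the square leaves [2 (2 N + 1)] border terms of size at most [(A / N) ^ 2], a total of
    [O(1 / N)]. Periodicity thus comes directly for [wp], with no constant of integration to
    determine. *)
Lemma wp_period1 (w1 w2 z : C) : lattice_basis w1 w2 -> ~ in_lattice w1 w2 z ->
  wp w1 w2 (z + w1)%C = wp w1 w2 z.
Proof.
  intros HB Hz.
  assert (L1 : in_lattice w1 w2 w1) by (exists 1%Z, 0%Z; unfold lattice_point; ring).
  assert (Hz1 : ~ in_lattice w1 w2 (z + w1)%C) by (rewrite (in_lattice_add w1 w2 z w1 L1); exact Hz).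
  destruct (regular_inv_bound w1 w2 z HB (regular_not_in_lattice _ _ _ Hz))
    as (A & e & HA & He & H).
  set (d := Cmod (wp w1 w2 (z + w1) - wp w1 w2 z)%C).
  assert (Hd : d <= 0).
  { apply le_epsilon. intros eps Heps. rewrite Rplus_0_l.
    assert (P1' := is_lsum_esum2 w1 w2 z HB (regular_not_in_lattice _ _ _ Hz)).
    assert (P2' := is_lsum_esum2 w1 w2 (z + w1)%C HB (regular_not_in_lattice _ _ _ Hz1)).
    destruct (P1' (eps / 3) ltac:(lra)) as [N1 H1].
    destruct (P2' (eps / 3) ltac:(lra)) as [N2 H2].
    destruct (inv_INR_small (8 * A ^ 2) (eps / 3)) as [N3 H3]; [nra|lra|].
    set (N := S (Nat.max N1 (Nat.max N2 N3))).
    specialize (H1 N ltac:(lia)). specialize (H2 N ltac:(lia)).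
    specialize (H3 (Nat.max N1 (Nat.max N2 N3)) ltac:(lia)). fold N in H3.
    assert (PN : 1 <= INR N) by (unfold N; rewrite S_INR;
      assert (Y := pos_INR (Nat.max N1 (Nat.max N2 N3))); lra).
    assert (T : Cmod (full_sum w1 w2 (z + w1) N - full_sum w1 w2 z N)%C <= 8 * A ^ 2 / INR N).
    { rewrite full_sum_shift.
      apply Rle_trans with ((2 * INR N + 1) * (2 * (A / INR N) ^ 2)).
      - apply zsum_bound. intros n _.
        assert (G : forall m, (Z.of_nat N <= Z.abs m)%Z ->
          Cmod (/ (z - lattice_point w1 w2 m n) ^ 2)%C <= (A / INR N) ^ 2).
        { intros m Hm. assert (Q : nonzero_pair m n) by (left; lia).
          destruct (H 0%C ltac:(rewrite Cmod_0; exact He) m n Q) as [X I].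
          rewrite Cplus_0_r in X, I. rewrite <- Cpow_inv, Cmod_pow by exact X.
          apply pow_incr. split; [apply Cmod_ge_0|]. eapply Rle_trans; [exact I|].
          apply Rmult_le_compat_l; [lra|]. apply Rinv_le_contravar; [lra|].
          unfold lnorm. rewrite INR_IZR_INZ. apply IZR_le. lia. }
        eapply Rle_trans; [apply Cmod_triangle|]. rewrite Cmod_opp.
        assert (G1 := G (- Z.of_nat N - 1)%Z ltac:(lia)).
        assert (G2 := G (Z.of_nat N) ltac:(lia)). lra.
      - replace ((2 * INR N + 1) * (2 * (A / INR N) ^ 2))
          with ((A ^ 2 / INR N) * ((4 * INR N + 2) / INR N)) by (field; lra).
        replace (8 * A ^ 2 / INR N) with ((A ^ 2 / INR N) * 8) by (field; lra).
        apply Rmult_le_compat_l.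
        + apply Rmult_le_pos; [apply pow2_ge_0|]. left. apply Rinv_0_lt_compat. lra.
        + apply Rmult_le_reg_r with (INR N); [lra|].
          replace ((4 * INR N + 2) / INR N * INR N) with (4 * INR N + 2) by (field; lra). lra. }
    assert (F1 := full_sum_partial w1 w2 z N). assert (F2 := full_sum_partial w1 w2 (z + w1)%C N).
    set (c := lattice_partial_sum w1 w2 (fun w => / w ^ 2)%C N) in *.
    set (p1 := lattice_partial_sum w1 w2 (fun w => / (z - w) ^ 2 - / w ^ 2)%C N) in *.
    set (p2 := lattice_partial_sum w1 w2 (fun w => / (z + w1 - w) ^ 2 - / w ^ 2)%C N) in *.
    unfold d. change (wp w1 w2 (z + w1)) with (/ (z + w1) ^ 2 + esum2 w1 w2 (z + w1))%C.
    change (wp w1 w2 z) with (/ z ^ 2 + esum2 w1 w2 z)%C.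
    replace (/ (z + w1) ^ 2 + esum2 w1 w2 (z + w1) - (/ z ^ 2 + esum2 w1 w2 z))%C
      with ((p1 - esum2 w1 w2 z) - (p2 - esum2 w1 w2 (z + w1))
            + ((/ (z + w1) ^ 2 + p2) - (/ z ^ 2 + p1)))%C by ring.
    rewrite F1, F2.
    replace (full_sum w1 w2 (z + w1) N - c - (full_sum w1 w2 z N - c))%C
      with (full_sum w1 w2 (z + w1) N - full_sum w1 w2 z N)%C by ring.
    eapply Rle_trans; [apply Cmod_triangle|].
    assert (X := Cmod_minus_le (p1 - esum2 w1 w2 z)%C (p2 - esum2 w1 w2 (z + w1))%C). lra. }
  assert (D0 : d = 0) by (apply Rle_antisym; [exact Hd|apply Cmod_ge_0]).
  apply Cmod_eq_0 in D0.
  replace (wp w1 w2 (z + w1)%C) with (wp w1 w2 (z + w1) - wp w1 w2 z + wp w1 w2 z)%C by ring.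
  rewrite D0. ring.
Qed.

Lemma lattice_point_swap (w1 w2 : C) (m n : Z) :
  lattice_point w2 w1 n m = lattice_point w1 w2 m n.
Proof. apply Cplus_comm. Qed.

Lemma in_lattice_swap (w1 w2 z : C) : in_lattice w2 w1 z -> in_lattice w1 w2 z.
Proof. intros (m & n & ->). exists n, m. apply lattice_point_swap. Qed.

Lemma lattice_basis_swap (w1 w2 : C) : lattice_basis w1 w2 -> lattice_basis w2 w1.
Proof.
  unfold lattice_basis. intros H E. apply H. destruct w1, w2. simpl in *. lra.
Qed.

(** Square partial sums are symmetric in the two generators, so the second period follows from the
    first. *)
Lemma wp_swap (w1 w2 z : C) : wp w2 w1 z = wp w1 w2 z.
Proof.
  assert (E : forall f N, lattice_partial_sum w2 w1 f N = lattice_partial_sum w1 w2 f N).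
  { intros f N. rewrite !lattice_partial_sum_zsum, zsum_switch.
    apply zsum_ext. intros m _. apply zsum_ext. intros n _.
    unfold lterm. rewrite lattice_point_swap, Bool.andb_comm. reflexivity. }
  unfold wp, lattice_sum. f_equal. f_equal; f_equal; apply Lim_seq_ext; intros N; rewrite E;
    reflexivity.
Qed.

Lemma wp_period2 (w1 w2 z : C) : lattice_basis w1 w2 -> ~ in_lattice w1 w2 z ->
  wp w1 w2 (z + w2)%C = wp w1 w2 z.
Proof.
  intros HB Hz. rewrite <- !(wp_swap w1 w2). apply wp_period1.
  - apply lattice_basis_swap, HB.
  - intros Q. apply Hz, in_lattice_swap, Q.
Qed.

Lemma period_multiple (w1 w2 w : C) (f : C -> C) (m : Z) : in_lattice w1 w2 w ->
  (forall z, ~ in_lattice w1 w2 z -> f (z + w)%C = f z) ->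
  forall z, ~ in_lattice w1 w2 z ->
    ~ in_lattice w1 w2 (z + RtoC (IZR m) * w)%C /\ f (z + RtoC (IZR m) * w)%C = f z.
Proof.
  intros Hw H.
  assert (Hn : forall k : nat, forall z, ~ in_lattice w1 w2 z ->
     ~ in_lattice w1 w2 (z + RtoC (INR k) * w)%C /\ f (z + RtoC (INR k) * w)%C = f z).
  { induction k as [|k IH]; intros z Hz.
    - simpl INR. replace (z + 0 * w)%C with z by ring. auto.
    - destruct (IH z Hz) as [I1 I2]. rewrite S_INR, RtoC_plus.
      replace (z + (INR k + 1) * w)%C with (z + INR k * w + w)%C by ring.
      split; [rewrite in_lattice_add by exact Hw; exact I1|]. rewrite H by exact I1. exact I2. }
  assert (Hn' : forall k : nat, forall z, ~ in_lattice w1 w2 z ->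
     ~ in_lattice w1 w2 (z + RtoC (- INR k) * w)%C /\ f (z + RtoC (- INR k) * w)%C = f z).
  { induction k as [|k IH]; intros z Hz.
    - simpl INR. rewrite Ropp_0. replace (z + 0 * w)%C with z by ring. auto.
    - destruct (IH z Hz) as [I1 I2].
      set (y := (z + RtoC (- INR (S k)) * w)%C).
      assert (Ey : (y + w)%C = (z + RtoC (- INR k) * w)%C).
      { unfold y. rewrite S_INR, !RtoC_opp, RtoC_plus. ring. }
      assert (I3 : ~ in_lattice w1 w2 y)
        by (rewrite <- (in_lattice_add w1 w2 y w Hw), Ey; exact I1).
      split; [exact I3|]. rewrite <- (H y I3), Ey. exact I2. }
  intros z Hz. destruct (Z_le_gt_dec 0 m) as [P|P].
  - rewrite <- (Z2Nat.id m), <- INR_IZR_INZ by exact P. apply Hn, Hz.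
  - replace (IZR m) with (- INR (Z.to_nat (- m)))
      by (rewrite INR_IZR_INZ, Z2Nat.id, opp_IZR by lia; ring).
    apply Hn', Hz.
Qed.

Lemma wp_periodic (w1 w2 z p : C) : lattice_basis w1 w2 -> in_lattice w1 w2 p ->
  ~ in_lattice w1 w2 z -> wp w1 w2 (z + p)%C = wp w1 w2 z.
Proof.
  intros HB (m & n & ->) Hz. unfold lattice_point.
  assert (L1 : in_lattice w1 w2 w1) by (exists 1%Z, 0%Z; unfold lattice_point; ring).
  assert (L2 : in_lattice w1 w2 w2) by (exists 0%Z, 1%Z; unfold lattice_point; ring).
  rewrite Cplus_assoc.
  destruct (period_multiple w1 w2 w1 (wp w1 w2) m L1 (fun y => wp_period1 w1 w2 y HB) z Hz)
    as [I1 I2].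
  destruct (period_multiple w1 w2 w2 (wp w1 w2) n L2 (fun y => wp_period2 w1 w2 y HB) _ I1)
    as [_ I4].
  rewrite I4, I2. reflexivity.
Qed.

(** Near [z] the translate of [f] is [f] itself, so uniqueness of the derivative hands the period on
    to [g]; the series of the derivatives need not be shifted again. *)
Lemma periodic_deriv (w1 w2 p : C) (f g : C -> C) : lattice_basis w1 w2 ->
  in_lattice w1 w2 p ->
  (forall z, ~ in_lattice w1 w2 z -> f (z + p)%C = f z) ->
  (forall z, ~ in_lattice w1 w2 z -> cderiv f z (g z)) ->
  forall z, ~ in_lattice w1 w2 z -> g (z + p)%C = g z.
Proof.
  intros HB Hp Hf Hd z Hz. apply (cderiv_unique f z); [|apply Hd, Hz].
  apply cderiv_ext with (fun x => f (x + p)%C).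
  - destruct (not_in_lattice_near w1 w2 z HB) as (e & He & H). exists e. split; [exact He|].
    intros h Hh. apply Hf. destruct (Ceq_dec h 0%C) as [->|N]; [rewrite Cplus_0_r; exact Hz|].
    apply H; assumption.
  - apply cderiv_shift, Hd. rewrite in_lattice_add; assumption.
Qed.

Lemma wp1_periodic (w1 w2 z p : C) : lattice_basis w1 w2 -> in_lattice w1 w2 p ->
  ~ in_lattice w1 w2 z -> wp1 w1 w2 (z + p)%C = wp1 w1 w2 z.
Proof.
  intros HB Hp Hz. apply (periodic_deriv w1 w2 p (wp w1 w2)); try assumption.
  - intros x Hx. apply wp_periodic; assumption.
  - intros x Hx. apply cderiv_wp; assumption.
Qed.

Lemma wp2_periodic (w1 w2 z p : C) : lattice_basis w1 w2 -> in_lattice w1 w2 p ->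
  ~ in_lattice w1 w2 z -> wp2 w1 w2 (z + p)%C = wp2 w1 w2 z.
Proof.
  intros HB Hp Hz. apply (periodic_deriv w1 w2 p (wp1 w1 w2)); try assumption.
  - intros x Hx. apply wp1_periodic; assumption.
  - intros x Hx. apply cderiv_wp1; assumption.
Qed.

(** * Laurent expansions at the origin *)

Definition eisenstein (w1 w2 : C) (k : nat) : C := lattice_sum w1 w2 (fun w => / w ^ k)%C.

Lemma is_lsum_eisenstein (w1 w2 : C) (k : nat) : lattice_basis w1 w2 -> (3 <= k)%nat ->
  is_lsum w1 w2 (fun w => / w ^ k)%C (eisenstein w1 w2 k).
Proof.
  intros HB Hk. destruct (lattice_point_inv_bound w1 w2 HB) as (A & HA & H).
  apply lsum_ex with (A ^ k); [apply pow_le; lra|]. intros m n Q. specialize (H m n Q).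
  assert (N := lattice_point_neq_0 w1 w2 m n HB Q).
  rewrite <- Cpow_inv, Cmod_pow by exact N.
  eapply Rle_trans; [apply pow_incr; split; [apply Cmod_ge_0|exact H]|].
  apply pow_lnorm_bound; assumption.
Qed.

Lemma eisenstein_odd (w1 w2 : C) (k : nat) : lattice_basis w1 w2 -> (1 <= k)%nat ->
  eisenstein w1 w2 (2 * k + 1) = 0%C.
Proof.
  intros HB Hk. apply (is_lsum_odd w1 w2 (fun w => / w ^ (2 * k + 1))%C);
    [|apply is_lsum_eisenstein; [exact HB|lia]].
  intros m n Q. assert (N := lattice_point_neq_0 w1 w2 m n HB Q).
  set (w := lattice_point w1 w2 m n) in *. rewrite !Cpow_add_r, !Cpow_mult_r.
  replace ((- w) ^ 2)%C with (w ^ 2)%C by ring.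
  field. split; [exact N|apply Cpow_nz, Cpow_nz, N].
Qed.

(** Exact termwise remainders [h ^ k * t h w], with decay uniform in [h], yield an [O(h ^ k)] for
    the sum without power series. *)
Lemma bdd0_lsum (w1 w2 : C) (f : C -> C) (t : C -> C -> C) (k : nat) (B eps : R) :
  0 < eps -> 0 <= B ->
  (forall h : C, h <> 0%C -> Cmod h < eps -> is_lsum w1 w2 (fun w => h ^ k * t h w)%C (f h)) ->
  (forall h : C, h <> 0%C -> Cmod h < eps -> lbound w1 w2 (t h) B) ->
  bdd0 (fun h => f h / h ^ k)%C.
Proof.
  intros He HB Hs Hb. exists eps, (16 * B). split; [exact He|]. intros h H0 Hh.
  assert (Q := is_lsum_scal w1 w2 (/ h ^ k)%C _ _ (Hs h H0 Hh)).
  apply (is_lsum_bound w1 w2 (t h)); [exact HB|apply Hb; assumption|].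
  replace (f h / h ^ k)%C with (/ h ^ k * f h)%C by (unfold Cdiv; ring).
  apply is_lsum_ext with (2 := Q). intros m n _. simpl. field. apply Cpow_nz, H0.
Qed.

Lemma inv_pow_lnorm_bound (A x : R) (k : nat) (m n : Z) : 0 < A -> 0 <= x ->
  x <= A / lnorm m n -> (1 <= k)%nat -> x ^ k <= A ^ k / lnorm m n.
Proof.
  intros HA Hx H Hk. assert (L := lnorm_ge_1 m n).
  eapply Rle_trans; [apply pow_incr; split; [exact Hx|exact H]|].
  unfold Rdiv. rewrite Rpow_mult_distr, pow_inv.
  apply Rmult_le_compat_l; [apply pow_le; lra|].
  apply Rinv_le_contravar; [lra|]. rewrite <- (pow_1 (lnorm m n)) at 1.
  apply Rle_pow; assumption.
Qed.

(** Order 5 is dictated by the cubic equation: in [wp ^ 3] the tail is multiplied by [h ^ (-4)], and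
    a factor [h] must survive. Odd Eisenstein sums vanish, which leaves only even powers in front of
    the tail. *)
Lemma esum2_expansion (w1 w2 : C) : lattice_basis w1 w2 -> exists a, bdd0 a /\
  forall h : C, h <> 0%C -> esum2 w1 w2 h
    = (3 * eisenstein w1 w2 4 * h ^ 2 + 5 * eisenstein w1 w2 6 * h ^ 4 + h ^ 5 * a h)%C.
Proof.
  intros HB. set (G4 := eisenstein w1 w2 4). set (G6 := eisenstein w1 w2 6).
  exists (fun h => (esum2 w1 w2 h - 3 * G4 * h ^ 2 - 5 * G6 * h ^ 4) / h ^ 5)%C.
  split; [|intros h H0; field; exact H0].
  destruct (lattice_point_inv_bound w1 w2 HB) as (A0 & HA0 & H0').
  destruct (regular_inv_bound w1 w2 0%C HB (regular_0 w1 w2 HB)) as (A & e & HA & He & H).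
  destruct (regular_near w1 w2 0%C HB (regular_0 w1 w2 HB)) as (e2 & He2 & Hr).
  apply (bdd0_lsum w1 w2 _
    (* With [x = h / w], the series of [1 / (1 - x) ^ 2] cut after [5 x ^ 4] has the closed
       remainder [(6 x ^ 5 - 5 x ^ 6) / (1 - x) ^ 2]. Two powers of decay come from [h - w], the
       third from the bracket. *)
    (fun h w => (6 * (/ w) ^ 5 - 5 * h * (/ w) ^ 6) * (/ (h - w)) ^ 2)%C 5
    ((6 * A0 ^ 5 + 5 * A0 ^ 6) * A ^ 2) (Rmin 1 (Rmin e e2))).
  - repeat apply Rmin_pos; lra.
  - assert (0 < A0 ^ 5) by (apply pow_lt; lra). assert (0 < A0 ^ 6) by (apply pow_lt; lra).
    assert (0 < A ^ 2) by (apply pow_lt; lra). apply Rmult_le_pos; lra.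
  - intros h Hh0 Hh.
    assert (Hh1 : Cmod h < e)
      by (eapply Rlt_le_trans; [exact Hh|eapply Rle_trans; [apply Rmin_r|apply Rmin_l]]).
    assert (Hh2 : Cmod h < e2)
      by (eapply Rlt_le_trans; [exact Hh|eapply Rle_trans; [apply Rmin_r|apply Rmin_r]]).
    specialize (Hr h Hh2). rewrite Cplus_0_l in Hr.
    assert (Q := is_lsum_plus _ _ _ _ _ _
      (is_lsum_plus _ _ _ _ _ _ (is_lsum_esum2 w1 w2 h HB Hr)
        (is_lsum_scal w1 w2 (- 2 * h)%C _ _ (is_lsum_eisenstein w1 w2 3 HB ltac:(lia))))
      (is_lsum_plus _ _ _ _ _ _
        (is_lsum_scal w1 w2 (- 3 * h ^ 2)%C _ _ (is_lsum_eisenstein w1 w2 4 HB ltac:(lia)))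
        (is_lsum_plus _ _ _ _ _ _
          (is_lsum_scal w1 w2 (- 4 * h ^ 3)%C _ _ (is_lsum_eisenstein w1 w2 5 HB ltac:(lia)))
          (is_lsum_scal w1 w2 (- 5 * h ^ 4)%C _ _ (is_lsum_eisenstein w1 w2 6 HB ltac:(lia)))))).
    assert (E3 := eisenstein_odd w1 w2 1 HB ltac:(lia)).
    assert (E5 := eisenstein_odd w1 w2 2 HB ltac:(lia)). simpl Nat.add in E3, E5.
    rewrite E3, E5 in Q. fold G4 G6 in Q.
    match type of Q with is_lsum _ _ _ ?s =>
      replace (esum2 w1 w2 h - 3 * G4 * h ^ 2 - 5 * G6 * h ^ 4)%C with s by ring end.
    apply is_lsum_ext with (2 := Q). intros m n P. cbv beta.
    destruct (H h Hh1 m n P) as [N _]. rewrite Cplus_0_l in N.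
    assert (N0 := lattice_point_neq_0 w1 w2 m n HB P).
    field. split; assumption.
  - intros h Hh0 Hh m n P.
    assert (Hh1 : Cmod h < e)
      by (eapply Rlt_le_trans; [exact Hh|eapply Rle_trans; [apply Rmin_r|apply Rmin_l]]).
    assert (Hh3 : Cmod h < 1) by (eapply Rlt_le_trans; [exact Hh|apply Rmin_l]).
    destruct (H h Hh1 m n P) as [_ I]. rewrite Cplus_0_l in I. specialize (H0' m n P).
    set (w := lattice_point w1 w2 m n) in *. assert (L := lnorm_ge_1 m n).
    rewrite Cmod_mult, Cmod_pow.
    replace ((6 * A0 ^ 5 + 5 * A0 ^ 6) * A ^ 2 / lnorm m n ^ 3)
      with ((6 * A0 ^ 5 + 5 * A0 ^ 6) / lnorm m n * (A / lnorm m n) ^ 2) by (field; lra).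
    apply Rmult_le_compat; [apply Cmod_ge_0|apply pow_le, Cmod_ge_0| |].
    + eapply Rle_trans; [apply Cmod_minus_le|].
      rewrite !Cmod_mult, !Cmod_pow, !Cmod_R, !Rabs_pos_eq by lra.
      assert (X5 := inv_pow_lnorm_bound A0 _ 5 m n HA0 (Cmod_ge_0 _) H0' ltac:(lia)).
      assert (X6 := inv_pow_lnorm_bound A0 _ 6 m n HA0 (Cmod_ge_0 _) H0' ltac:(lia)).
      assert (P6 : 0 <= Cmod (/ w)%C ^ 6) by (apply pow_le, Cmod_ge_0).
      assert (Ph := Cmod_ge_0 h).
      replace ((6 * A0 ^ 5 + 5 * A0 ^ 6) / lnorm m n)
        with (6 * (A0 ^ 5 / lnorm m n) + 5 * (A0 ^ 6 / lnorm m n)) by (field; lra).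
      assert (Y : 5 * Cmod h * Cmod (/ w)%C ^ 6 <= 5 * Cmod (/ w)%C ^ 6) by nra.
      lra.
    + apply pow_incr. split; [apply Cmod_ge_0|exact I].
Qed.

Lemma esum3_expansion (w1 w2 : C) : lattice_basis w1 w2 -> exists b, bdd0 b /\
  forall h : C, h <> 0%C -> esum w1 w2 3 h
    = (- 3 * eisenstein w1 w2 4 * h - 10 * eisenstein w1 w2 6 * h ^ 3 + h ^ 4 * b h)%C.
Proof.
  intros HB. set (G4 := eisenstein w1 w2 4). set (G6 := eisenstein w1 w2 6).
  exists (fun h => (esum w1 w2 3 h + 3 * G4 * h + 10 * G6 * h ^ 3) / h ^ 4)%C.
  split; [|intros h H0; field; exact H0].
  destruct (lattice_point_inv_bound w1 w2 HB) as (A0 & HA0 & H0').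
  destruct (regular_inv_bound w1 w2 0%C HB (regular_0 w1 w2 HB)) as (A & e & HA & He & H).
  destruct (regular_near w1 w2 0%C HB (regular_0 w1 w2 HB)) as (e2 & He2 & Hr).
  apply (bdd0_lsum w1 w2 _
    (* With [x = h / w], the closed remainder of [1 / (1 - x) ^ 3] after
       [1 + 3 x + 6 x ^ 2 + 10 x ^ 3] is [(15 x ^ 4 - 24 x ^ 5 + 10 x ^ 6) / (1 - x) ^ 3]. The cube
       of [/ (h - w)] supplies all the decay, so the bracket need only be bounded. *)
    (fun h w => (15 * (/ w) ^ 4 - 24 * h * (/ w) ^ 5 + 10 * h ^ 2 * (/ w) ^ 6)
                * (/ (h - w)) ^ 3)%C 4
    ((15 * A0 ^ 4 + 24 * A0 ^ 5 + 10 * A0 ^ 6) * A ^ 3) (Rmin 1 (Rmin e e2))).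
  - repeat apply Rmin_pos; lra.
  - assert (0 < A0 ^ 4) by (apply pow_lt; lra). assert (0 < A0 ^ 5) by (apply pow_lt; lra).
    assert (0 < A0 ^ 6) by (apply pow_lt; lra). assert (0 < A ^ 3) by (apply pow_lt; lra).
    apply Rmult_le_pos; lra.
  - intros h Hh0 Hh.
    assert (Hh1 : Cmod h < e)
      by (eapply Rlt_le_trans; [exact Hh|eapply Rle_trans; [apply Rmin_r|apply Rmin_l]]).
    assert (Hh2 : Cmod h < e2)
      by (eapply Rlt_le_trans; [exact Hh|eapply Rle_trans; [apply Rmin_r|apply Rmin_r]]).
    specialize (Hr h Hh2). rewrite Cplus_0_l in Hr.
    assert (Q := is_lsum_plus _ _ _ _ _ _
      (is_lsum_plus _ _ _ _ _ _ (is_lsum_esum w1 w2 3 h HB Hr ltac:(lia))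
        (is_lsum_eisenstein w1 w2 3 HB ltac:(lia)))
      (is_lsum_plus _ _ _ _ _ _
        (is_lsum_scal w1 w2 (3 * h)%C _ _ (is_lsum_eisenstein w1 w2 4 HB ltac:(lia)))
        (is_lsum_plus _ _ _ _ _ _
          (is_lsum_scal w1 w2 (6 * h ^ 2)%C _ _ (is_lsum_eisenstein w1 w2 5 HB ltac:(lia)))
          (is_lsum_scal w1 w2 (10 * h ^ 3)%C _ _ (is_lsum_eisenstein w1 w2 6 HB ltac:(lia)))))).
    assert (E3 := eisenstein_odd w1 w2 1 HB ltac:(lia)).
    assert (E5 := eisenstein_odd w1 w2 2 HB ltac:(lia)). simpl Nat.add in E3, E5.
    rewrite E3, E5 in Q. fold G4 G6 in Q.
    match type of Q with is_lsum _ _ _ ?s =>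
      replace (esum w1 w2 3 h + 3 * G4 * h + 10 * G6 * h ^ 3)%C with s by ring end.
    apply is_lsum_ext with (2 := Q). intros m n P. cbv beta.
    destruct (H h Hh1 m n P) as [N _]. rewrite Cplus_0_l in N.
    assert (N0 := lattice_point_neq_0 w1 w2 m n HB P).
    field. split; assumption.
  - intros h Hh0 Hh m n P.
    assert (Hh1 : Cmod h < e)
      by (eapply Rlt_le_trans; [exact Hh|eapply Rle_trans; [apply Rmin_r|apply Rmin_l]]).
    assert (Hh3 : Cmod h < 1) by (eapply Rlt_le_trans; [exact Hh|apply Rmin_l]).
    destruct (H h Hh1 m n P) as [_ I]. rewrite Cplus_0_l in I. specialize (H0' m n P).
    set (w := lattice_point w1 w2 m n) in *. assert (L := lnorm_ge_1 m n).
    assert (X4 := inv_pow_lnorm_bound A0 _ 4 m n HA0 (Cmod_ge_0 _) H0' ltac:(lia)).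
    assert (X5 := inv_pow_lnorm_bound A0 _ 5 m n HA0 (Cmod_ge_0 _) H0' ltac:(lia)).
    assert (X6 := inv_pow_lnorm_bound A0 _ 6 m n HA0 (Cmod_ge_0 _) H0' ltac:(lia)).
    assert (P4 := pow_le _ 4 (Cmod_ge_0 (/ w)%C)). assert (P5 := pow_le _ 5 (Cmod_ge_0 (/ w)%C)).
    assert (P6 := pow_le _ 6 (Cmod_ge_0 (/ w)%C)). assert (Ph := Cmod_ge_0 h).
    rewrite Cmod_mult, Cmod_pow.
    apply Rle_trans with ((15 * A0 ^ 4 + 24 * A0 ^ 5 + 10 * A0 ^ 6) * (A ^ 3 / lnorm m n ^ 3)).
    + apply Rmult_le_compat; [apply Cmod_ge_0|apply pow_le, Cmod_ge_0| |].
      * eapply Rle_trans; [apply Cmod_triangle|].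
        eapply Rle_trans; [apply Rplus_le_compat; [apply Cmod_minus_le|apply Rle_refl]|].
        rewrite !Cmod_mult, !Cmod_pow, !Cmod_R, !Rabs_pos_eq by lra.
        assert (D : forall k, A0 ^ k / lnorm m n <= A0 ^ k).
        { intros k. rewrite <- (Rdiv_1_r (A0 ^ k)) at 2.
          apply Rmult_le_compat_l; [apply pow_le; lra|]. apply Rinv_le_contravar; lra. }
        assert (D4 := D 4%nat). assert (D5 := D 5%nat). assert (D6 := D 6%nat).
        assert (Y1 : 24 * Cmod h * Cmod (/ w)%C ^ 5 <= 24 * Cmod (/ w)%C ^ 5) by nra.
        assert (Z : Cmod h ^ 2 <= 1) by nra.
        assert (Y2 : 10 * Cmod h ^ 2 * Cmod (/ w)%C ^ 6 <= 10 * Cmod (/ w)%C ^ 6).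
        { rewrite Rmult_assoc. apply Rmult_le_compat_l; [lra|].
          rewrite <- (Rmult_1_l (Cmod (/ w)%C ^ 6)) at 2. apply Rmult_le_compat_r; assumption. }
        lra.
      * eapply Rle_trans; [apply pow_incr; split; [apply Cmod_ge_0|exact I]|].
        apply pow_lnorm_bound; [exact HA|lia].
    + right. field. lra.
Qed.

(** Only the value at 0 enters the second-order equation, so the Lipschitz bound of a differentiable
    function replaces an explicit remainder. *)
Lemma esum4_expansion (w1 w2 : C) : lattice_basis w1 w2 -> exists d, bdd0 d /\
  forall h : C, h <> 0%C -> esum w1 w2 4 h = (eisenstein w1 w2 4 + h * d h)%C.
Proof.
  intros HB. exists (fun h => (esum w1 w2 4 h - eisenstein w1 w2 4) / h)%C.
  split; [|intros h H0; field; exact H0].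
  assert (E : esum w1 w2 4 0%C = eisenstein w1 w2 4).
  { apply (is_lsum_unique w1 w2 (fun w => / (0 - w) ^ 4)%C).
    - apply is_lsum_esum; [exact HB|apply regular_0, HB|lia].
    - apply is_lsum_ext with (2 := is_lsum_eisenstein w1 w2 4 HB ltac:(lia)).
      intros m n _. f_equal. ring. }
  destruct (cderiv_lip _ _ _ (cderiv_esum w1 w2 4 0%C ltac:(lia) HB (regular_0 w1 w2 HB)))
    as (e & K & He & HK & H).
  exists e, K. split; [exact He|]. intros h H0 Hh. destruct (H h Hh) as [_ H'].
  rewrite Cplus_0_l, E in H'. rewrite Cmod_div by exact H0.
  assert (Ph : 0 < Cmod h) by (apply Cmod_gt_0; exact H0).
  apply Rmult_le_reg_r with (Cmod h); [exact Ph|].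
  unfold Rdiv. rewrite Rmult_assoc, Rinv_l by lra. lra.
Qed.

(** * The differential equations and surjectivity *)

(** Extended by 0 to the lattice, [f] is continuous there: periodicity carries the expansion
    [h * q h] at the origin to every lattice point. This removes the values of [wp] at its poles,
    which mean nothing, from the Liouville argument. *)
Lemma elliptic_vanishes (w1 w2 : C) (f df q : C -> C) : lattice_basis w1 w2 ->
  (forall z p, in_lattice w1 w2 p -> ~ in_lattice w1 w2 z -> f (z + p)%C = f z) ->
  (forall z, ~ in_lattice w1 w2 z -> cderiv f z (df z) /\ ccont df z) ->
  bdd0 q ->
  (exists eps, 0 < eps /\ forall h : C, h <> 0%C -> Cmod h < eps -> f h = (h * q h)%C) ->
  forall z, ~ in_lattice w1 w2 z -> f z = 0%C.
Proof.
  intros HB Hper Hd Hq (e & He & Hf) z Hz.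
  set (F := fun x => if excluded_middle_informative (in_lattice w1 w2 x) then RtoC 0 else f x).
  assert (FL : forall x, in_lattice w1 w2 x -> F x = 0%C).
  { intros x Hx. unfold F. destruct (excluded_middle_informative _); [reflexivity|contradiction]. }
  assert (FN : forall x, ~ in_lattice w1 w2 x -> F x = f x).
  { intros x Hx. unfold F. destruct (excluded_middle_informative _); [contradiction|reflexivity]. }
  rewrite <- (FN z Hz). revert z Hz.
  assert (Hloc : forall z, ~ in_lattice w1 w2 z -> exists eps, 0 < eps /\
     forall h, Cmod h < eps -> f (z + h)%C = F (z + h)%C).
  { intros z Hz. destruct (not_in_lattice_near w1 w2 z HB) as (e' & He' & H).
    exists e'. split; [exact He'|]. intros h Hh. symmetry. apply FN.
    destruct (Ceq_dec h 0%C) as [->|N]; [rewrite Cplus_0_r; exact Hz|].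
    apply H; assumption. }
  assert (Hall : forall z, F z = 0%C); [|intros z _; apply Hall].
  apply (lattice_liouville w1 w2 F df HB).
  - intros z p Hp. destruct (classic (in_lattice w1 w2 z)) as [Hz|Hz].
    + rewrite !FL; [reflexivity|exact Hz|]. apply in_lattice_add; assumption.
    + rewrite !FN; [apply Hper; assumption|exact Hz|]. rewrite in_lattice_add; assumption.
  - intros z. destruct (classic (in_lattice w1 w2 z)) as [Hz|Hz].
    + intros eps Heps. destruct (bdd0_small q eps Hq Heps) as (e1 & He1 & Hs).
      exists (Rmin e e1). split; [apply Rmin_pos; assumption|]. intros h Hh.
      rewrite (FL z Hz). replace (F (z + h) - 0)%C with (F (z + h)%C) by ring.
      destruct (classic (in_lattice w1 w2 (z + h)%C)) as [L|L];
        [rewrite (FL _ L), Cmod_0; exact Heps|].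
      assert (N : h <> 0%C) by (intros ->; rewrite Cplus_0_r in L; contradiction).
      assert (Lh : ~ in_lattice w1 w2 h).
      { intros Q. apply L. rewrite Cplus_comm. apply in_lattice_add; assumption. }
      rewrite (FN _ L), Cplus_comm, (Hper h z Hz Lh).
      rewrite (Hf h N) by (eapply Rlt_le_trans; [exact Hh|apply Rmin_l]).
      apply (Hs h N). eapply Rlt_le_trans; [exact Hh|apply Rmin_r].
    + apply ccont_ext with f; [apply Hloc, Hz|]. eapply cderiv_ccont, Hd, Hz.
  - exact FL.
  - intros z Hz. destruct (Hd z Hz) as [D1 D2]. split; [|exact D2].
    apply cderiv_ext with f; [apply Hloc, Hz|exact D1].
Qed.

Ltac bdd0 :=
  repeat (first [assumption | apply bdd0_const | apply bdd0_id | apply bdd0_pow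
    | apply bdd0_plus | apply bdd0_opp | apply bdd0_mult]).

Lemma wp_ode1 (w1 w2 : C) : lattice_basis w1 w2 -> forall z, ~ in_lattice w1 w2 z ->
  (wp1 w1 w2 z ^ 2 = 4 * wp w1 w2 z ^ 3 - lattice_g2 w1 w2 * wp w1 w2 z - lattice_g3 w1 w2)%C.
Proof.
  intros HB z Hz. set (g2 := lattice_g2 w1 w2). set (g3 := lattice_g3 w1 w2).
  destruct (esum2_expansion w1 w2 HB) as (a & Ha & Ea).
  destruct (esum3_expansion w1 w2 HB) as (b & Hb & Eb).
  set (G4 := eisenstein w1 w2 4) in *. set (G6 := eisenstein w1 w2 6) in *.
  assert (E2 : g2 = (60 * G4)%C) by reflexivity.
  assert (E3 : g3 = (140 * G6)%C) by reflexivity.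
  set (f := fun x => (wp1 w1 w2 x ^ 2 - 4 * wp w1 w2 x ^ 3 + g2 * wp w1 w2 x + g3)%C).
  assert (Hf : f z = 0%C).
  (* Near 0, [wp = h ^ (-2) + h ^ 2 * p] and [wp1 = - 2 h ^ (-3) + h * r]. The coefficients 60 and
     140 cancel the terms in [h ^ (-2)] and [h ^ 0], and what remains is [h] times the bounded
     function given below. *)
  { set (p := fun h => (3 * G4 + 5 * G6 * h ^ 2 + h ^ 3 * a h)%C).
    set (r := fun h => (6 * G4 + 20 * G6 * h ^ 2 - 2 * h ^ 3 * b h)%C).
    apply (elliptic_vanishes w1 w2 f
      (fun x => 2 * wp1 w1 w2 x * wp2 w1 w2 x - 12 * wp w1 w2 x ^ 2 * wp1 w1 w2 x
                + g2 * wp1 w1 w2 x)%C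
      (fun h => 8 * b h - 12 * a h + h * (r h ^ 2 - 12 * p h ^ 2 + g2 * p h)
                - 4 * h ^ 5 * p h ^ 3)%C); try assumption.
    - intros x q Hq Hx. unfold f. rewrite wp_periodic, wp1_periodic by assumption. reflexivity.
    - intros x Hx. split.
      + eapply cderiv_eq.
        * unfold f. eapply cderiv_plus; [|apply cderiv_const].
          eapply cderiv_plus; [|eapply cderiv_mult; [apply cderiv_const|apply cderiv_wp; assumption]].
          eapply cderiv_minus; [apply cderiv_pow, cderiv_wp1; assumption|].
          eapply cderiv_mult; [apply cderiv_const|apply cderiv_pow, cderiv_wp; assumption].
        * replace (INR 2) with 2 by (simpl; ring). replace (INR 3) with 3 by (simpl; ring). ring.
      + eapply cderiv_ccont. eapply cderiv_plus.
        * eapply cderiv_minus.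
          -- eapply cderiv_mult; [|apply cderiv_wp2; assumption].
             eapply cderiv_mult; [apply cderiv_const|apply cderiv_wp1; assumption].
          -- eapply cderiv_mult; [|apply cderiv_wp1; assumption].
             eapply cderiv_mult; [apply cderiv_const|apply cderiv_pow, cderiv_wp; assumption].
        * eapply cderiv_mult; [apply cderiv_const|apply cderiv_wp1; assumption].
    - unfold p, r. bdd0.
    - exists 1. split; [lra|]. intros h H0 _. unfold f.
      change (wp w1 w2 h) with (/ h ^ 2 + esum2 w1 w2 h)%C. unfold wp1.
      rewrite (Ea h H0), (Eb h H0), E2, E3. unfold p, r. field. exact H0. }
  unfold f in Hf.
  replace (wp1 w1 w2 z ^ 2)%C with ((wp1 w1 w2 z ^ 2 - 4 * wp w1 w2 z ^ 3 + g2 * wp w1 w2 z + g3)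
    + (4 * wp w1 w2 z ^ 3 - g2 * wp w1 w2 z - g3))%C by ring.
  rewrite Hf. ring.
Qed.

(** Differentiating the first-order equation would give this only after division by [wp1], which has
    zeros; a second use of the vanishing principle holds everywhere off the lattice. *)
Lemma wp_ode2 (w1 w2 : C) : lattice_basis w1 w2 -> forall z, ~ in_lattice w1 w2 z ->
  (wp2 w1 w2 z = 6 * wp w1 w2 z ^ 2 - lattice_g2 w1 w2 / 2)%C.
Proof.
  intros HB z Hz. set (g2 := lattice_g2 w1 w2).
  destruct (esum2_expansion w1 w2 HB) as (a & Ha & Ea).
  destruct (esum4_expansion w1 w2 HB) as (d & Hd & Ed).
  set (G4 := eisenstein w1 w2 4) in *. set (G6 := eisenstein w1 w2 6) in *.
  assert (E2 : g2 = (60 * G4)%C) by reflexivity.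
  set (f := fun x => (wp2 w1 w2 x - 6 * wp w1 w2 x ^ 2 + g2 / 2)%C).
  assert (Hf : f z = 0%C).
  { set (p := fun h => (3 * G4 + 5 * G6 * h ^ 2 + h ^ 3 * a h)%C).
    apply (elliptic_vanishes w1 w2 f
      (fun x => - 24 * / x ^ 5 - 24 * esum w1 w2 5 x - 12 * wp w1 w2 x * wp1 w1 w2 x)%C
      (fun h => 6 * d h - 60 * G6 * h - 12 * h ^ 2 * a h - 6 * h ^ 3 * p h ^ 2)%C);
      try assumption.
    - intros x q Hq Hx. unfold f. rewrite wp_periodic, wp2_periodic by assumption. reflexivity.
    - intros x Hx. split.
      + eapply cderiv_eq.
        * unfold f. eapply cderiv_plus; [|apply cderiv_const].
          eapply cderiv_minus; [apply cderiv_wp2; assumption|].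
          eapply cderiv_mult; [apply cderiv_const|apply cderiv_pow, cderiv_wp; assumption].
        * replace (INR 2) with 2 by (simpl; ring). ring.
      + eapply cderiv_ccont. eapply cderiv_minus.
        * eapply cderiv_minus.
          -- eapply cderiv_mult; [apply cderiv_const|].
             apply cderiv_inv_pow, (not_in_lattice_neq_0 w1 w2), Hx.
          -- eapply cderiv_mult; [apply cderiv_const|].
             apply cderiv_esum; [lia|exact HB|apply regular_not_in_lattice, Hx].
        * eapply cderiv_mult; [|apply cderiv_wp1; assumption].
          eapply cderiv_mult; [apply cderiv_const|apply cderiv_wp; assumption].
    - unfold p. bdd0.
    - exists 1. split; [lra|]. intros h H0 _. unfold f.
      change (wp w1 w2 h) with (/ h ^ 2 + esum2 w1 w2 h)%C. unfold wp2.
      rewrite (Ea h H0), (Ed h H0), E2. unfold p. field. exact H0. }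
  unfold f in Hf.
  replace (wp2 w1 w2 z)%C with ((wp2 w1 w2 z - 6 * wp w1 w2 z ^ 2 + g2 / 2)
    + (6 * wp w1 w2 z ^ 2 - g2 / 2))%C by ring.
  rewrite Hf. ring.
Qed.

(** Provides a concrete point off the lattice, at which a vanishing inverse becomes absurd. The
    coefficient [2 m - 1] is odd, hence nonzero. *)
Lemma half_period_not_in_lattice (w1 w2 : C) : lattice_basis w1 w2 ->
  ~ in_lattice w1 w2 (w1 / 2)%C.
Proof.
  intros HB (m & n & E).
  assert (N2 : RtoC 2 <> 0%C) by (intros Q; apply RtoC_inj in Q; lra).
  assert (Q : lattice_point w1 w2 (2 * m - 1) (2 * n) = 0%C).
  { unfold lattice_point in *. rewrite minus_IZR, !mult_IZR, RtoC_minus, !RtoC_mult.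
    transitivity (2 * ((RtoC (IZR m) * w1 + RtoC (IZR n) * w2) - w1 / 2))%C;
      [field; exact N2|rewrite <- E; ring]. }
  apply (lattice_point_neq_0 w1 w2 (2 * m - 1) (2 * n) HB); [left; lia|exact Q].
Qed.

(* If [wp] omits [c], then [1 / (wp - c)] is elliptic and vanishes at the only
   poles available. *)
Lemma wp_surjective (w1 w2 c : C) : lattice_basis w1 w2 ->
  exists z, ~ in_lattice w1 w2 z /\ wp w1 w2 z = c.
Proof.
  intros HB. apply NNPP. intros HN.
  assert (Hc : forall z, ~ in_lattice w1 w2 z -> (wp w1 w2 z - c)%C <> 0%C).
  { intros z Hz E. apply HN. exists z. split; [exact Hz|].
    replace (wp w1 w2 z) with (wp w1 w2 z - c + c)%C by ring. rewrite E. ring. }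
  destruct (esum2_expansion w1 w2 HB) as (a & Ha & Ea).
  (* Chosen so that [h ^ 2 * (wp h - c) = 1 + h * s h]; hence the inverse of [wp - c] is
     [h ^ 2 / (1 + h * s h)] near the origin. *)
  set (s := fun h => (h * (3 * eisenstein w1 w2 4 * h ^ 2 + 5 * eisenstein w1 w2 6 * h ^ 4
                    + h ^ 5 * a h - c))%C).
  assert (Hs : bdd0 s) by (unfold s; bdd0).
  destruct (bdd0_inv s 1%C Hs) as [Hi (e & He & Hn)]; [intros Q; apply RtoC_inj in Q; lra|].
  assert (Z := elliptic_vanishes w1 w2 (fun z => / (wp w1 w2 z - c))%C
    (fun z => - wp1 w1 w2 z / (wp w1 w2 z - c) ^ 2)%C
    (fun h => h * / (1 + h * s h))%C HB).
  assert (Hz := half_period_not_in_lattice w1 w2 HB).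
  assert (One : forall x : C, x <> 0%C -> (/ x)%C <> 0%C).
  { intros x Nx E. assert (Q := Cinv_r x Nx). rewrite E, Cmult_0_r in Q.
    apply RtoC_inj in Q. lra. }
  apply (One _ (Hc _ Hz)), Z; [| | | |exact Hz].
  - intros z p Hp Hz'. cbv beta. rewrite wp_periodic by assumption. reflexivity.
  - intros z Hz'. assert (D : cderiv (fun z => wp w1 w2 z - c)%C z (wp1 w1 w2 z)).
    { eapply cderiv_eq; [eapply cderiv_minus; [apply cderiv_wp; assumption|apply cderiv_const]|].
      ring. }
    split.
    + exact (cderiv_inv _ _ _ D (Hc z Hz')).
    + eapply cderiv_ccont. unfold Cdiv. eapply cderiv_mult.
      * apply cderiv_opp, cderiv_wp1; assumption.
      * exact (cderiv_inv _ _ _ (cderiv_pow _ 1 _ _ D) (Cpow_nz _ 2 (Hc z Hz'))).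
  - bdd0.
  - exists e. split; [exact He|]. intros h H0 Hh. specialize (Hn h H0 Hh).
    change (wp w1 w2 h) with (/ h ^ 2 + esum2 w1 w2 h)%C. rewrite (Ea h H0). unfold s in *.
    assert (N : (1 + h * (h * (3 * eisenstein w1 w2 4 * h ^ 2 + 5 * eisenstein w1 w2 6 * h ^ 4
                    + h ^ 5 * a h - c)) <> 0)%C) by exact Hn.
    set (x := (3 * eisenstein w1 w2 4 * h ^ 2 + 5 * eisenstein w1 w2 6 * h ^ 4
               + h ^ 5 * a h)%C) in *.
    replace (/ h ^ 2 + x - c)%C with ((1 + h * (h * (x - c))) / h ^ 2)%C by (field; exact H0).
    field. split; assumption.
Qed.

(** * The Weierstrass motion as a solution of a second-order equation *)

Lemma cderiv_of_bdd0 (f : C -> C) (z l : C) (k : C -> C) (eps : R) : 0 < eps -> bdd0 k ->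
  (forall h : C, h <> 0%C -> Cmod h < eps -> (f (z + h) - f z - l * h = h ^ 2 * k h)%C) ->
  cderiv f z l.
Proof.
  intros He (e & K & He' & HK) H.
  apply (cderiv_intro _ _ _ (Rmin eps e) (Rabs K)); [apply Rmin_pos; assumption|].
  intros h Hh. destruct (Ceq_dec h 0%C) as [->|N].
  - rewrite Cplus_0_r. replace (f z - f z - l * 0)%C with (RtoC 0) by ring.
    rewrite Cmod_0. assert (Y := Rabs_pos K). simpl. lra.
  - rewrite (H h N) by (eapply Rlt_le_trans; [exact Hh|apply Rmin_l]).
    rewrite Cmod_mult, Cmod_pow, Rmult_comm. apply Rmult_le_compat_r; [apply pow2_ge_0|].
    eapply Rle_trans; [apply HK; [exact N|eapply Rlt_le_trans; [exact Hh|apply Rmin_r]]|].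
    apply Rle_abs.
Qed.

Definition wden (w1 w2 : C) (beta : R) (z : C) : C := (4 * wp w1 w2 z - RtoC (beta / 3))%C.

(** The value [0] at the poles of [wp] is the limit of [/ wden]. *)
Definition mot (w1 w2 : C) (beta : R) (z : C) : C :=
  if excluded_middle_informative (in_lattice w1 w2 z) then RtoC 0
  else (/ wden w1 w2 beta z)%C.

Definition mot1 (w1 w2 : C) (beta : R) (z : C) : C :=
  if excluded_middle_informative (in_lattice w1 w2 z) then RtoC 0
  else (- (4 * wp1 w1 w2 z) / wden w1 w2 beta z ^ 2)%C.

Lemma mot_lattice (w1 w2 : C) (beta : R) (z : C) : in_lattice w1 w2 z ->
  mot w1 w2 beta z = 0%C /\ mot1 w1 w2 beta z = 0%C.
Proof.
  intros H. unfold mot, mot1.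
  destruct (excluded_middle_informative _); [split; reflexivity|contradiction].
Qed.

Lemma mot_off_lattice (w1 w2 : C) (beta : R) (z : C) : ~ in_lattice w1 w2 z ->
  mot w1 w2 beta z = (/ wden w1 w2 beta z)%C /\
  mot1 w1 w2 beta z = (- (4 * wp1 w1 w2 z) / wden w1 w2 beta z ^ 2)%C.
Proof.
  intros H. unfold mot, mot1.
  destruct (excluded_middle_informative _); [contradiction|split; reflexivity].
Qed.

Definition mot_defined (w1 w2 : C) (beta : R) (z : C) : Prop :=
  in_lattice w1 w2 z \/ wden w1 w2 beta z <> 0%C.

(** Half the derivative of [z + beta z ^ 2 + k3 z ^ 3 + k4 z ^ 4], the square of the velocity. In
    the application [k3 = alpha * c] and [k4 = alpha ^ 2 * delta]. *)
Definition force (beta k3 k4 : R) (z : C) : C :=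
  (/ 2 + RtoC beta * z + 3 / 2 * RtoC k3 * z ^ 2 + 2 * RtoC k4 * z ^ 3)%C.

(** The double pole of [wp] becomes a double zero of [mot]. [X] and [Y] are the parts of [wden] and
    [wp1] left after their principal parts [4 / h ^ 2] and [- 2 / h ^ 3], and [V] tends to
    [1 / 4]. *)
Lemma mot_near_lattice (w1 w2 : C) (beta : R) (p : C) : lattice_basis w1 w2 ->
  in_lattice w1 w2 p -> exists X Y V eps, bdd0 X /\ bdd0 Y /\ bdd0 V /\ 0 < eps /\
  forall h : C, h <> 0%C -> Cmod h < eps ->
    ~ in_lattice w1 w2 (p + h)%C /\ wden w1 w2 beta (p + h)%C <> 0%C /\
    (V h * (4 + h ^ 2 * X h) = 1)%C /\
    mot w1 w2 beta (p + h)%C = (h ^ 2 * V h)%C /\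
    mot1 w1 w2 beta (p + h)%C = (h * (8 - 4 * Y h * h ^ 3) * V h ^ 2)%C.
Proof.
  intros HB Hp.
  destruct (esum2_expansion w1 w2 HB) as (a & Ha & Ea).
  destruct (esum3_expansion w1 w2 HB) as (b & Hb & Eb).
  set (G4 := eisenstein w1 w2 4) in *. set (G6 := eisenstein w1 w2 6) in *.
  set (X := fun h => (4 * (3 * G4 * h ^ 2 + 5 * G6 * h ^ 4 + h ^ 5 * a h) - RtoC (beta / 3))%C).
  set (Y := fun h => (- 2 * (- 3 * G4 * h - 10 * G6 * h ^ 3 + h ^ 4 * b h))%C).
  assert (BX : bdd0 X) by (unfold X; bdd0). assert (BY : bdd0 Y) by (unfold Y; bdd0).
  destruct (bdd0_inv (fun h => h * X h)%C 4%C) as [BV (e & He & Hn)];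
    [bdd0|intros Q; apply RtoC_inj in Q; lra|].
  exists X, Y, (fun h => / (4 + h * (h * X h)))%C.
  destruct (not_in_lattice_near w1 w2 p HB) as (e1 & He1 & HL).
  exists (Rmin e e1). split; [exact BX|]. split; [exact BY|]. split; [exact BV|].
  split; [apply Rmin_pos; assumption|]. intros h H0 Hh.
  assert (N := Hn h H0 ltac:(eapply Rlt_le_trans; [exact Hh|apply Rmin_l])). cbv beta in N.
  assert (Lp := HL h H0 ltac:(eapply Rlt_le_trans; [exact Hh|apply Rmin_r])).
  assert (L : ~ in_lattice w1 w2 h).
  { intros Q. apply Lp. rewrite Cplus_comm. apply in_lattice_add; assumption. }
  assert (ED : wden w1 w2 beta (p + h)%C = ((4 + h * (h * X h)) / h ^ 2)%C).
  { unfold wden. rewrite Cplus_comm, wp_periodic by assumption.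
    change (wp w1 w2 h) with (/ h ^ 2 + esum2 w1 w2 h)%C. rewrite (Ea h H0).
    unfold X. field. exact H0. }
  assert (E1 : wp1 w1 w2 (p + h)%C = (- 2 / h ^ 3 + Y h)%C).
  { rewrite Cplus_comm, wp1_periodic by assumption. unfold wp1. rewrite (Eb h H0).
    unfold Y. field. exact H0. }
  split; [exact Lp|].
  split.
  { rewrite ED. intros E. apply N.
    replace (4 + h * (h * X h))%C with ((4 + h * (h * X h)) / h ^ 2 * h ^ 2)%C by (field; exact H0).
    rewrite E. ring. }
  destruct (mot_off_lattice w1 w2 beta (p + h)%C Lp) as [M0 M1]. rewrite M0, M1, ED, E1.
  split; [field; exact N|]. split; [field; split; assumption|]. field. split; assumption.
Qed.

Lemma mot_defined_near (w1 w2 : C) (beta : R) (z : C) : lattice_basis w1 w2 ->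
  mot_defined w1 w2 beta z ->
  exists eps, 0 < eps /\ forall h, Cmod h < eps -> mot_defined w1 w2 beta (z + h)%C.
Proof.
  intros HB Hz. destruct (classic (in_lattice w1 w2 z)) as [L|L].
  - destruct (mot_near_lattice w1 w2 beta z HB L) as (X & Y & V & e & _ & _ & _ & He & H).
    exists e. split; [exact He|]. intros h Hh.
    destruct (Ceq_dec h 0%C) as [->|N]; [rewrite Cplus_0_r; exact Hz|].
    right. apply (H h N Hh).
  - destruct Hz as [Hz|Hz]; [contradiction|].
    assert (D : ccont (wden w1 w2 beta) z).
    { eapply cderiv_ccont. unfold wden. eapply cderiv_minus; [|apply cderiv_const].
      eapply cderiv_mult; [apply cderiv_const|apply cderiv_wp; assumption]. }
    destruct (D (Cmod (wden w1 w2 beta z))) as (d & Hd & H); [apply Cmod_gt_0, Hz|].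
    exists d. split; [exact Hd|]. intros h Hh. right. intros E. specialize (H h Hh).
    rewrite E in H. replace (0 - wden w1 w2 beta z)%C with (- wden w1 w2 beta z)%C in H by ring.
    rewrite Cmod_opp in H. lra.
Qed.

Lemma mot_ext_near (w1 w2 : C) (z : C) (f g : C -> C) : lattice_basis w1 w2 ->
  ~ in_lattice w1 w2 z -> (forall x, ~ in_lattice w1 w2 x -> f x = g x) ->
  exists eps, 0 < eps /\ forall h, Cmod h < eps -> f (z + h)%C = g (z + h)%C.
Proof.
  intros HB L E. destruct (not_in_lattice_near w1 w2 z HB) as (e & He & H).
  exists e. split; [exact He|]. intros h Hh. apply E.
  destruct (Ceq_dec h 0%C) as [->|N]; [rewrite Cplus_0_r; exact L|]. apply H; assumption.
Qed.

Lemma cderiv_mot (w1 w2 : C) (beta k3 k4 g2 g3 : R) (z : C) :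
  lattice_basis w1 w2 -> lattice_g2 w1 w2 = RtoC g2 -> lattice_g3 w1 w2 = RtoC g3 ->
  g2 = / 4 * (beta ^ 2 / 3 - k3) -> g3 = / 8 * (beta * k3 / 6 - k4 / 2 - beta ^ 3 / 27) ->
  mot_defined w1 w2 beta z ->
  cderiv (mot w1 w2 beta) z (mot1 w1 w2 beta z) /\
  cderiv (mot1 w1 w2 beta) z (force beta k3 k4 (mot w1 w2 beta z)).
Proof.
  intros HB E2 E3 D2 D3 Hz.
  destruct (classic (in_lattice w1 w2 z)) as [L|L].
  - destruct (mot_near_lattice w1 w2 beta z HB L)
      as (X & Y & V & e & BX & BY & BV & He & H).
    destruct (mot_lattice w1 w2 beta z L) as [M0 M1]. rewrite M0, M1. split.
    + apply (cderiv_of_bdd0 _ _ _ V e He BV). intros h H0 Hh.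
      destruct (H h H0 Hh) as (_ & _ & _ & W & _). rewrite W, M0. ring.
    + apply (cderiv_of_bdd0 _ _ _ (fun h => (- 4 * Y h * h ^ 2 - 4 * h * X h
         - h ^ 3 * X h ^ 2 * / 2) * V h ^ 2)%C e He); [bdd0|].
      intros h H0 Hh. destruct (H h H0 Hh) as (_ & _ & EV & _ & W). rewrite W, M1.
      unfold force.
      (* The slope [force 0 = 1 / 2] is rewritten as half the square of [V * (4 + h ^ 2 * X) = 1];
         the leading [8 * V ^ 2] then cancels exactly and [h ^ 2] factors out. *)
      transitivity (h * (8 - 4 * Y h * h ^ 3) * V h ^ 2
        - / 2 * (V h * (4 + h ^ 2 * X h)) ^ 2 * h)%C; [rewrite EV; ring|]. field.
  - destruct Hz as [Hz|Hz]; [contradiction|].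
    assert (D : cderiv (wden w1 w2 beta) z (4 * wp1 w1 w2 z)%C).
    { eapply cderiv_eq.
      - unfold wden. eapply cderiv_minus; [|apply cderiv_const].
        eapply cderiv_mult; [apply cderiv_const|apply cderiv_wp; assumption].
      - cbv beta. ring. }
    destruct (mot_off_lattice w1 w2 beta z L) as [M0 M1]. rewrite M0, M1. split.
    + apply cderiv_ext with (fun x => / wden w1 w2 beta x)%C.
      * apply (mot_ext_near w1 w2 z (fun x => / wden w1 w2 beta x)%C (mot w1 w2 beta) HB L).
        intros x Hx. symmetry. apply (mot_off_lattice w1 w2 beta x Hx).
      * exact (cderiv_inv _ _ _ D Hz).
    + apply cderiv_ext with (fun x => - (4 * wp1 w1 w2 x) * / wden w1 w2 beta x ^ 2)%C.
      * apply (mot_ext_near w1 w2 z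
          (fun x => - (4 * wp1 w1 w2 x) * / wden w1 w2 beta x ^ 2)%C (mot1 w1 w2 beta) HB L).
        intros x Hx. symmetry. apply (mot_off_lattice w1 w2 beta x Hx).
      * eapply cderiv_eq.
        -- apply cderiv_mult.
           ++ apply cderiv_opp, cderiv_mult; [apply cderiv_const|apply cderiv_wp1; assumption].
           ++ exact (cderiv_inv _ _ _ (cderiv_pow _ 1 _ _ D) (Cpow_nz _ 2 Hz)).
        -- assert (O1 := wp_ode1 w1 w2 HB z L). assert (O2 := wp_ode2 w1 w2 HB z L).
           rewrite E2, E3 in O1. rewrite E2 in O2.
           replace (INR 2) with 2 by (simpl; ring).
           set (Dz := wden w1 w2 beta z) in *.
           (* The two differential equations eliminate [wp2] and [wp1 ^ 2], and [wp] is expressed by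
              [Dz]; with the given [g2] and [g3] the result is the polynomial [force] in
              [1 / Dz]. *)
           assert (Ep : wp w1 w2 z = ((Dz + RtoC (beta / 3)) / 4)%C).
           { unfold Dz, wden. field. }
           rewrite O2.
           transitivity (- 4 * (6 * wp w1 w2 z ^ 2 - RtoC g2 / 2) / Dz ^ 2
              + 32 * wp1 w1 w2 z ^ 2 / Dz ^ 3)%C; [field; exact Hz|].
           rewrite O1, Ep. subst g2 g3. unfold force.
           repeat rewrite ?RtoC_mult, ?RtoC_minus, ?RtoC_plus, ?RtoC_div, ?RtoC_inv, ?RtoC_pow
             by lra.
           field. exact Hz.
Qed.

(** * Uniqueness of solutions along the real line *)

(** To the right of [x] the product of [D] with [exp (- K t)] cannot increase, to the left its
    product with [exp (K t)] cannot decrease; both are nonnegative and vanish at [x]. *)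
Lemma gronwall_zero (D D' : R -> R) (K x e : R) :
  (forall t, Rabs (t - x) < e -> is_derive D t (D' t)) ->
  (forall t, Rabs (t - x) < e -> Rabs (D' t) <= K * D t) ->
  (forall t, 0 <= D t) -> D x = 0 ->
  forall t, Rabs (t - x) < e -> D t = 0.
Proof.
  intros Hd Hb Hp H0 t Ht. apply Rle_antisym; [|apply Hp].
  assert (Hin : forall c, Rmin x t <= c <= Rmax x t -> Rabs (c - x) < e).
  { intros c. unfold Rmin, Rmax. destruct (Rle_dec x t); intros Hc;
    apply Rabs_def2 in Ht; apply Rabs_def1; lra. }
  assert (Hexp : forall k, (forall c, Rmin x t <= c <= Rmax x t ->
     is_derive (fun s => D s * exp (k * s)) c ((D' c + k * D c) * exp (k * c)))).
  { intros k c Hc. specialize (Hd c (Hin c Hc)). auto_derive.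
    - eexists; exact Hd.
    - replace (Derive (fun s => D s) c) with (D' c)
        by (symmetry; apply is_derive_unique, Hd). ring. }
  assert (Hmvt : forall k, exists c, Rmin x t <= c <= Rmax x t /\
     D t * exp (k * t) = (D' c + k * D c) * exp (k * c) * (t - x)).
  { intros k. destruct (MVT_gen (fun s => D s * exp (k * s)) x t
      (fun c => (D' c + k * D c) * exp (k * c))) as (c & Hc & E).
    - intros c Hc. apply Hexp. lra.
    - intros c Hc. apply continuity_pt_filterlim.
      apply (ex_derive_continuous (K := R_AbsRing) (V := R_NormedModule)
        (fun s => D s * exp (k * s))).
      eexists. apply Hexp, Hc.
    - exists c. split; [exact Hc|]. rewrite H0, Rmult_0_l, Rminus_0_r in E. exact E. }
  destruct (Rle_dec x t) as [L|L].
  - destruct (Hmvt (- K)) as (c & Hc & E). specialize (Hb c (Hin c Hc)).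
    assert (B := Rle_abs (D' c)). assert (P1' := exp_pos (- K * t)). assert (P2' := exp_pos (- K * c)).
    assert (Q : (D' c + - K * D c) * exp (- K * c) <= 0) by nra.
    assert (Q' : D t * exp (- K * t) <= 0) by (rewrite E; nra). nra.
  - destruct (Hmvt K) as (c & Hc & E). specialize (Hb c (Hin c Hc)).
    assert (B := Rle_abs (- D' c)). rewrite Rabs_Ropp in B.
    assert (P1' := exp_pos (K * t)). assert (P2' := exp_pos (K * c)).
    assert (Q : 0 <= (D' c + K * D c) * exp (K * c)) by nra.
    assert (Q' : D t * exp (K * t) <= 0) by (rewrite E; nra). nra.
Qed.

(** Connectedness of a segment as an induction principle: the supremum of the initial segment on
    which [T] holds satisfies [T] by closedness, and openness forbids it to lie before [b]. *)
Lemma interval_propagation_right (J T : R -> Prop) (a b : R) :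
  (forall x, a <= x <= b -> J x) -> T a -> a <= b ->
  (forall x, J x -> T x -> exists d, 0 < d /\ forall s, Rabs s < d -> T (x + s)) ->
  (forall x, J x -> (forall d, 0 < d -> exists s, Rabs s < d /\ T (x + s)) -> T x) ->
  T b.
Proof.
  intros HJ Ha Hab Ho Hc.
  set (S := fun x => a <= x <= b /\ forall y, a <= y <= x -> T y).
  assert (Sa : S a) by (split; [lra|]; intros y Hy; replace y with a by lra; exact Ha).
  destruct (completeness S) as [m [Hub Hlub]].
  { exists b. intros x [Hx _]. lra. }
  { exists a. exact Sa. }
  assert (Ham : a <= m) by (apply Hub, Sa).
  assert (Hmb : m <= b) by (apply Hlub; intros x [Hx _]; lra).
  assert (Hbelow : forall y, a <= y < m -> T y).
  { intros y Hy. apply NNPP. intros N. assert (m <= y); [|lra].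
    apply Hlub. intros x [Hx HT]. apply Rnot_lt_le. intros L. apply N, HT. lra. }
  assert (Tm : T m).
  { apply Hc; [apply HJ; lra|]. intros d Hd.
    destruct (Req_dec a m) as [E|E].
    - exists 0. rewrite Rabs_R0. split; [exact Hd|]. rewrite Rplus_0_r, <- E. exact Ha.
    - exists (- Rmin (d / 2) (m - a)).
      assert (0 < Rmin (d / 2) (m - a)) by (apply Rmin_pos; lra).
      assert (Q1 := Rmin_l (d / 2) (m - a)). assert (Q2 := Rmin_r (d / 2) (m - a)).
      rewrite Rabs_Ropp, Rabs_pos_eq by lra. split; [lra|]. apply Hbelow. lra. }
  destruct (Ho m (HJ m ltac:(lra)) Tm) as (d & Hd & HT).
  destruct (Req_dec m b) as [E|E]; [rewrite <- E; exact Tm|exfalso].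
  assert (Q : S (m + Rmin (d / 2) (b - m))).
  { assert (Q1 := Rmin_l (d / 2) (b - m)). assert (Q2 := Rmin_r (d / 2) (b - m)).
    assert (0 < Rmin (d / 2) (b - m)) by (apply Rmin_pos; lra).
    split; [lra|]. intros y Hy. destruct (Rlt_le_dec y m) as [L|L]; [apply Hbelow; lra|].
    replace y with (m + (y - m)) by ring. apply HT. rewrite Rabs_pos_eq; lra. }
  apply Hub in Q. assert (0 < Rmin (d / 2) (b - m)) by (apply Rmin_pos; lra). lra.
Qed.

Lemma interval_propagation (J T : R -> Prop) (a : R) :
  (forall x y z, J x -> J z -> x <= y <= z -> J y) -> J a -> T a ->
  (forall x, J x -> T x -> exists d, 0 < d /\ forall s, Rabs s < d -> T (x + s)) ->
  (forall x, J x -> (forall d, 0 < d -> exists s, Rabs s < d /\ T (x + s)) -> T x) ->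
  forall b, J b -> T b.
Proof.
  intros Hconv Ja Ta Ho Hc b Jb. destruct (Rle_dec a b) as [L|L].
  - apply (interval_propagation_right J T a b); try assumption.
    intros x Hx. apply (Hconv a x b); assumption.
  - rewrite <- (Ropp_involutive b).
    apply (interval_propagation_right (fun x => J (- x)) (fun x => T (- x)) (- a) (- b)).
    + intros x Hx. apply (Hconv b (- x) a); [assumption|assumption|lra].
    + rewrite Ropp_involutive. exact Ta.
    + lra.
    + intros x Jx Tx. destruct (Ho (- x) Jx Tx) as (d & Hd & H). exists d.
      split; [exact Hd|]. intros s Hs. replace (- (x + s)) with (- x + - s) by ring.
      apply H. rewrite Rabs_Ropp. exact Hs.
    + intros x Jx H. apply Hc; [exact Jx|]. intros d Hd. destruct (H d Hd) as (s & Hs & Ts).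
      exists (- s). rewrite Rabs_Ropp. split; [exact Hs|].
      replace (- x + - s) with (- (x + s)) by ring. exact Ts.
Qed.

Lemma force_lipschitz (beta k3 k4 R0 : R) : exists K, 0 <= K /\ forall z w,
  Cmod z <= R0 -> Cmod w <= R0 ->
  Cmod (force beta k3 k4 z - force beta k3 k4 w)%C <= K * Cmod (z - w)%C.
Proof.
  exists (Rabs beta + 3 / 2 * Rabs k3 * (2 * Rabs R0) + 2 * Rabs k4 * (3 * Rabs R0 ^ 2)).
  assert (B1 := Rabs_pos beta). assert (B3 := Rabs_pos k3). assert (B4 := Rabs_pos k4).
  assert (BR := Rabs_pos R0). assert (B2 := pow2_ge_0 (Rabs R0)).
  split; [assert (0 <= Rabs k3 * Rabs R0) by nra; assert (0 <= Rabs k4 * Rabs R0 ^ 2) by nra; lra|].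
  intros z w Hz Hw. assert (AR := Rle_abs R0).
  replace (force beta k3 k4 z - force beta k3 k4 w)%C with
    ((RtoC beta + RtoC (3 / 2 * k3) * (z + w) + RtoC (2 * k4) * (z ^ 2 + z * w + w ^ 2)) * (z - w))%C.
  2:{ unfold force. rewrite !RtoC_mult, RtoC_div by lra. ring. }
  rewrite Cmod_mult. apply Rmult_le_compat_r; [apply Cmod_ge_0|].
  assert (Pz := Cmod_ge_0 z). assert (Pw := Cmod_ge_0 w).
  eapply Rle_trans; [apply Cmod_triangle|]. apply Rplus_le_compat.
  - eapply Rle_trans; [apply Cmod_triangle|]. rewrite Cmod_R. apply Rplus_le_compat_l.
    rewrite Cmod_mult, Cmod_R, Rabs_mult, (Rabs_pos_eq (3 / 2)) by lra.
    apply Rmult_le_compat_l; [lra|]. eapply Rle_trans; [apply Cmod_triangle|]. lra.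
  - rewrite Cmod_mult, Cmod_R, Rabs_mult, (Rabs_pos_eq 2) by lra.
    apply Rmult_le_compat_l; [lra|].
    eapply Rle_trans; [apply Cmod_triangle|].
    eapply Rle_trans; [apply Rplus_le_compat_r, Cmod_triangle|].
    rewrite Cmod_mult, !Cmod_pow.
    assert (Q1 : Cmod z ^ 2 <= Rabs R0 ^ 2) by (apply pow_incr; lra).
    assert (Q2 : Cmod w ^ 2 <= Rabs R0 ^ 2) by (apply pow_incr; lra).
    assert (Q3 : Cmod z * Cmod w <= Rabs R0 ^ 2) by nra. lra.
Qed.

Lemma pderiv_real (v : R -> R) (t l : R) : is_derive v t l -> pderiv (fun s => RtoC (v s)) t (RtoC l).
Proof.
  intros H. split; simpl; [exact H|]. apply (is_derive_const (V := R_NormedModule)).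
Qed.

Lemma pderiv_minus (p q : R -> C) (t : R) (v w : C) : pderiv p t v -> pderiv q t w ->
  pderiv (fun s => p s - q s)%C t (v - w)%C.
Proof.
  intros [P1' P2'] [Q1 Q2]. split.
  - apply (is_derive_minus (V := R_NormedModule) _ _ _ _ _ P1' Q1).
  - apply (is_derive_minus (V := R_NormedModule) _ _ _ _ _ P2' Q2).
Qed.

Lemma is_derive_sum_sq (A B : R -> R) (t a b : R) : is_derive A t a -> is_derive B t b ->
  is_derive (fun s => A s ^ 2 + B s ^ 2) t (2 * (A t * a + B t * b)).
Proof.
  intros HA HB. auto_derive.
  - repeat split; eexists; eassumption.
  - replace (Derive (fun s => A s) t) with a by (symmetry; apply is_derive_unique, HA).
    replace (Derive (fun s => B s) t) with b by (symmetry; apply is_derive_unique, HB). ring.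
Qed.

Lemma is_derive_Cmod2 (p : R -> C) (t : R) (v : C) : pderiv p t v ->
  is_derive (fun s => Cmod (p s) ^ 2) t (2 * Re (p t * Cconj v)%C).
Proof.
  intros [H1 H2].
  apply (is_derive_ext (fun s => Re (p s) ^ 2 + Im (p s) ^ 2));
    [intros s; rewrite Cmod2_alt; reflexivity|].
  replace (Re (p t * Cconj v)%C) with (Re (p t) * Re v + Im (p t) * Im v)
    by (destruct (p t), v; simpl; ring).
  apply (is_derive_sum_sq (fun s => Re (p s)) (fun s => Im (p s))); assumption.
Qed.

(* Gronwall applied to [|v - W|^2 + |v' - W'|^2]. *)
Lemma second_order_unique (beta k3 k4 x e : R) (v v1 : R -> R) (W W1 : R -> C) : 0 < e ->
  (forall t, Rabs (t - x) < e -> is_derive v t (v1 t)) ->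
  (forall t, Rabs (t - x) < e -> pderiv (fun s => RtoC (v1 s)) t (force beta k3 k4 (v t))) ->
  (forall t, Rabs (t - x) < e -> pderiv W t (W1 t)) ->
  (forall t, Rabs (t - x) < e -> pderiv W1 t (force beta k3 k4 (W t))) ->
  W x = RtoC (v x) -> W1 x = RtoC (v1 x) ->
  exists d, 0 < d /\ forall t, Rabs (t - x) < d -> W t = RtoC (v t) /\ W1 t = RtoC (v1 t).
Proof.
  intros He Hv Hv1 HW HW1 E0 E1.
  assert (Hx : Rabs (x - x) < e) by (rewrite Rminus_diag, Rabs_R0; exact He).
  destruct (pderiv_continuous _ x _ (pderiv_real _ _ _ (Hv x Hx)) 1 ltac:(lra)) as (d1 & Hd1 & C1).
  destruct (pderiv_continuous _ x _ (HW x Hx) 1 ltac:(lra)) as (d2 & Hd2 & C2).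
  (* The Lipschitz bound for [force] is on bounded sets. Both solutions start at [W x] and move by
     less than 1, so they stay in the disc of radius [R0]. *)
  set (R0 := Cmod (W x) + 1).
  destruct (force_lipschitz beta k3 k4 R0) as (K & HK & HL).
  set (d := Rmin e (Rmin d1 d2)).
  assert (De : d <= e) by apply Rmin_l.
  assert (Dd1 : d <= d1) by (eapply Rle_trans; [apply Rmin_r|apply Rmin_l]).
  assert (Dd2 : d <= d2) by (eapply Rle_trans; [apply Rmin_r|apply Rmin_r]).
  exists d. split; [repeat apply Rmin_pos; assumption|].
  set (X := fun t => (RtoC (v t) - W t)%C). set (Y := fun t => (RtoC (v1 t) - W1 t)%C).
  set (Z := fun t => (force beta k3 k4 (v t) - force beta k3 k4 (W t))%C).
  assert (HX : forall t, Rabs (t - x) < d -> pderiv X t (Y t)).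
  { intros t Ht. apply pderiv_minus; [apply pderiv_real, Hv|apply HW]; lra. }
  assert (HY : forall t, Rabs (t - x) < d -> pderiv Y t (Z t)).
  { intros t Ht. apply pderiv_minus; [apply Hv1|apply HW1]; lra. }
  assert (HZ : forall t, Rabs (t - x) < d -> Cmod (Z t) <= K * Cmod (X t)).
  { intros t Ht. apply HL.
    - specialize (C1 (t - x) ltac:(lra)). replace (x + (t - x)) with t in C1 by ring.
      rewrite <- E0 in C1. assert (T := Cmod_triangle_sub (RtoC (v t)) (W x)). unfold R0. lra.
    - specialize (C2 (t - x) ltac:(lra)). replace (x + (t - x)) with t in C2 by ring.
      assert (T := Cmod_triangle_sub (W t) (W x)). unfold R0. lra. }
  assert (G : forall t, Rabs (t - x) < d -> Cmod (X t) ^ 2 + Cmod (Y t) ^ 2 = 0).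
  (* The rate [1 + K] comes from [2 |X| |Y| + 2 |Y| |Z| <= (1 + K) * 2 |X| |Y|] and
     [2 |X| |Y| <= |X| ^ 2 + |Y| ^ 2]. *)
  { apply (gronwall_zero (fun t => Cmod (X t) ^ 2 + Cmod (Y t) ^ 2)
      (fun t => 2 * Re (X t * Cconj (Y t))%C + 2 * Re (Y t * Cconj (Z t))%C) (1 + K)).
    - intros t Ht. apply (is_derive_plus (V := R_NormedModule));
        apply is_derive_Cmod2; [apply HX|apply HY]; exact Ht.
    - intros t Ht. specialize (HZ t Ht).
      assert (A1 := re_le_Cmod (X t * Cconj (Y t))%C).
      assert (A2 := re_le_Cmod (Y t * Cconj (Z t))%C).
      rewrite Cmod_mult, Cmod_conj in A1, A2.
      assert (PX := Cmod_ge_0 (X t)). assert (PY := Cmod_ge_0 (Y t)).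
      assert (A3 : Cmod (Y t) * Cmod (Z t) <= Cmod (Y t) * (K * Cmod (X t)))
        by (apply Rmult_le_compat_l; assumption).
      assert (A4 : 2 * (Cmod (X t) * Cmod (Y t)) <= Cmod (X t) ^ 2 + Cmod (Y t) ^ 2).
      { assert (Q := pow2_ge_0 (Cmod (X t) - Cmod (Y t))). lra. }
      eapply Rle_trans; [apply Rabs_triang|].
      rewrite !Rabs_mult, (Rabs_pos_eq 2) by lra.
      assert (A5 : K * (2 * (Cmod (X t) * Cmod (Y t))) <= K * (Cmod (X t) ^ 2 + Cmod (Y t) ^ 2))
        by (apply Rmult_le_compat_l; assumption).
      lra.
    - intros t. assert (Q1 := pow2_ge_0 (Cmod (X t))). assert (Q2 := pow2_ge_0 (Cmod (Y t))). lra.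
    - unfold X, Y. rewrite E0, E1.
      replace (RtoC (v x) - RtoC (v x))%C with (RtoC 0) by ring.
      replace (RtoC (v1 x) - RtoC (v1 x))%C with (RtoC 0) by ring. rewrite Cmod_0. ring. }
  intros t Ht. specialize (G t Ht).
  assert (Q1 := pow2_ge_0 (Cmod (X t))). assert (Q2 := pow2_ge_0 (Cmod (Y t))).
  assert (Z1 : Cmod (X t) = 0) by nra. assert (Z2 : Cmod (Y t) = 0) by nra.
  apply Cmod_eq_0 in Z1. apply Cmod_eq_0 in Z2. unfold X in Z1. unfold Y in Z2. split.
  - replace (W t) with (RtoC (v t) - (RtoC (v t) - W t))%C by ring. rewrite Z1. ring.
  - replace (W1 t) with (RtoC (v1 t) - (RtoC (v1 t) - W1 t))%C by ring. rewrite Z2. ring.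
Qed.

Lemma pderiv_limit (p q : R -> C) (x : R) (v w : C) (T : R -> Prop) :
  pderiv p x v -> pderiv q x w -> (forall t, T t -> p t = q t) ->
  (forall d, 0 < d -> exists s, Rabs s < d /\ T (x + s)) -> p x = q x.
Proof.
  intros Hp Hq E Hacc.
  assert (H : Cmod (p x - q x)%C <= 0).
  { apply le_epsilon. intros eps He.
    destruct (pderiv_continuous _ _ _ (pderiv_minus _ _ _ _ _ Hp Hq) eps He) as (d & Hd & C1).
    destruct (Hacc d Hd) as (s & Hs & Ts). specialize (C1 s Hs). rewrite (E _ Ts) in C1.
    replace (q (x + s)%R - q (x + s)%R - (p x - q x))%C with (- (p x - q x))%C in C1 by ring.
    rewrite Cmod_opp in C1. lra. }
  assert (H0 : Cmod (p x - q x)%C = 0) by (apply Rle_antisym; [exact H|apply Cmod_ge_0]).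
  apply Cmod_eq_0 in H0. replace (p x) with (p x - q x + q x)%C by ring. rewrite H0. ring.
Qed.

Lemma pderiv_translate (f : C -> C) (z0 l : C) (t : R) : cderiv f (RtoC t + z0)%C l ->
  pderiv (fun s => f (RtoC s + z0)%C) t l.
Proof.
  intros H. assert (P : pderiv (fun s => (RtoC s + z0)%C) t 1%C).
  { split; simpl; auto_derive; auto; ring. }
  assert (Q := pderiv_comp f (fun s => (RtoC s + z0)%C) t 1%C l P H).
  rewrite Cmult_1_r in Q. exact Q.
Qed.

(** Agreement of values and derivatives spreads to neighbours by uniqueness and to limits by
    continuity. The set [T] also records that [mot] is defined, because its derivatives are
    available only there. *)
Lemma mot_matches (w1 w2 z0 : C) (beta k3 k4 g2 g3 : R) (J : R -> Prop) (v v1 : R -> R) (a : R) :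
  lattice_basis w1 w2 -> lattice_g2 w1 w2 = RtoC g2 -> lattice_g3 w1 w2 = RtoC g3 ->
  g2 = / 4 * (beta ^ 2 / 3 - k3) -> g3 = / 8 * (beta * k3 / 6 - k4 / 2 - beta ^ 3 / 27) ->
  Defs.open_interval J ->
  (forall x, J x -> is_derive v x (v1 x)) ->
  (forall x, J x -> is_derive v1 x
     (/ 2 + beta * v x + 3 / 2 * k3 * v x ^ 2 + 2 * k4 * v x ^ 3)) ->
  J a -> mot_defined w1 w2 beta (RtoC a + z0)%C ->
  mot w1 w2 beta (RtoC a + z0)%C = RtoC (v a) ->
  mot1 w1 w2 beta (RtoC a + z0)%C = RtoC (v1 a) ->
  forall x, J x -> mot_defined w1 w2 beta (RtoC x + z0)%C /\
    mot w1 w2 beta (RtoC x + z0)%C = RtoC (v x).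
Proof.
  intros HB E2 E3 D2 D3 [Jo Jc] Hv Hv1 Ja Da Ma M1a.
  set (T := fun x => J x /\ mot_defined w1 w2 beta (RtoC x + z0)%C /\
     mot w1 w2 beta (RtoC x + z0)%C = RtoC (v x) /\
     mot1 w1 w2 beta (RtoC x + z0)%C = RtoC (v1 x)).
  assert (Hforce : forall x, J x ->
     pderiv (fun s => RtoC (v1 s)) x (force beta k3 k4 (RtoC (v x)))).
  { intros x Jx. assert (Q := pderiv_real _ _ _ (Hv1 x Jx)).
    replace (force beta k3 k4 (RtoC (v x))) with
      (RtoC (/ 2 + beta * v x + 3 / 2 * k3 * v x ^ 2 + 2 * k4 * v x ^ 3)); [exact Q|].
    unfold force. rewrite !RtoC_plus, !RtoC_mult, !RtoC_pow, RtoC_div, RtoC_inv by lra.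
    reflexivity. }
  assert (HD : forall x, mot_defined w1 w2 beta (RtoC x + z0)%C ->
     pderiv (fun s => mot w1 w2 beta (RtoC s + z0)%C) x (mot1 w1 w2 beta (RtoC x + z0)%C) /\
     pderiv (fun s => mot1 w1 w2 beta (RtoC s + z0)%C) x
       (force beta k3 k4 (mot w1 w2 beta (RtoC x + z0)%C))).
  { intros x Dx. destruct (cderiv_mot w1 w2 beta k3 k4 g2 g3 _ HB E2 E3 D2 D3 Dx) as [Q1 Q2].
    split; apply pderiv_translate; assumption. }
  assert (HT : forall x, J x -> T x).
  { apply (interval_propagation J T a Jc Ja).
    - split; [exact Ja|]. split; [exact Da|]. split; assumption.
    - intros x Jx (_ & Dx & Mx & M1x).
      destruct (Jo x Jx) as [dj Hdj].
      destruct (mot_defined_near w1 w2 beta _ HB Dx) as (dd & Hdd & Hnear).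
      set (e := Rmin dj dd).
      assert (Pe : 0 < e) by (apply Rmin_pos; [apply cond_pos|exact Hdd]).
      assert (HJe : forall t, Rabs (t - x) < e -> J t).
      { intros t Ht. apply Hdj. eapply Rlt_le_trans; [exact Ht|apply Rmin_l]. }
      assert (HDe : forall t, Rabs (t - x) < e -> mot_defined w1 w2 beta (RtoC t + z0)%C).
      { intros t Ht. replace (RtoC t + z0)%C with (RtoC x + z0 + RtoC (t - x))%C
          by (rewrite RtoC_minus; ring).
        apply Hnear. rewrite Cmod_R. eapply Rlt_le_trans; [exact Ht|apply Rmin_r]. }
      destruct (second_order_unique beta k3 k4 x e v v1
        (fun t => mot w1 w2 beta (RtoC t + z0)%C) (fun t => mot1 w1 w2 beta (RtoC t + z0)%C))
        as (d & Hd & HU); try assumption.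
      + intros t Ht. apply Hv, HJe, Ht.
      + intros t Ht. apply Hforce, HJe, Ht.
      + intros t Ht. apply HD, HDe, Ht.
      + intros t Ht. apply HD, HDe, Ht.
      + exists (Rmin d e). split; [apply Rmin_pos; assumption|]. intros s Hs.
        assert (S1 : Rabs (x + s - x) < e).
        { replace (x + s - x) with s by ring. eapply Rlt_le_trans; [exact Hs|apply Rmin_r]. }
        assert (S2 : Rabs (x + s - x) < d).
        { replace (x + s - x) with s by ring. eapply Rlt_le_trans; [exact Hs|apply Rmin_l]. }
        destruct (HU _ S2) as [U1 U2].
        split; [apply HJe, S1|]. split; [apply HDe, S1|]. split; assumption.
    - intros x Jx Hacc.
      (* A limit of matched points cannot be a zero of [wden]: at matched points off the lattice
         [wden * v = 1], but close to [x] one has [|v| <= |v x| + 1] while [|wden|] would fall below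
         half the inverse of that bound. *)
      assert (Dx : mot_defined w1 w2 beta (RtoC x + z0)%C).
      { destruct (classic (in_lattice w1 w2 (RtoC x + z0)%C)) as [L|L]; [left; exact L|right].
        intros E.
        assert (Pd : pderiv (fun s => wden w1 w2 beta (RtoC s + z0)%C) x
                       (4 * wp1 w1 w2 (RtoC x + z0))%C).
        { apply pderiv_translate. unfold wden. eapply cderiv_eq.
          - eapply cderiv_minus; [|apply cderiv_const].
            eapply cderiv_mult; [apply cderiv_const|apply cderiv_wp; assumption].
          - cbv beta. ring. }
        assert (Pv := pderiv_real _ _ _ (Hv x Jx)).
        destruct (pderiv_continuous _ _ _ Pd (/ 2 / (Rabs (v x) + 1))) as (d1 & Hd1 & C1).
        { assert (Y := Rabs_pos (v x)). apply Rdiv_lt_0_compat; lra. }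
        destruct (pderiv_continuous _ _ _ Pv 1 ltac:(lra)) as (d2 & Hd2 & C2).
        destruct (not_in_lattice_near w1 w2 (RtoC x + z0)%C HB) as (d3 & Hd3 & H3).
        destruct (Hacc (Rmin d1 (Rmin d2 d3))) as (s & Hs & Js & Ds & Ms & _).
        { repeat apply Rmin_pos; assumption. }
        specialize (C1 s ltac:(eapply Rlt_le_trans; [exact Hs|apply Rmin_l])).
        specialize (C2 s ltac:(eapply Rlt_le_trans; [exact Hs|
          eapply Rle_trans; [apply Rmin_r|apply Rmin_l]])).
        assert (S3 : Rabs s < d3) by (eapply Rlt_le_trans; [exact Hs|
          eapply Rle_trans; [apply Rmin_r|apply Rmin_r]]).
        rewrite E in C1. cbv beta in C1.
        assert (Ls : ~ in_lattice w1 w2 (RtoC (x + s) + z0)%C).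
        { destruct (Req_dec s 0) as [->|N]; [rewrite Rplus_0_r; exact L|].
          replace (RtoC (x + s) + z0)%C with (RtoC x + z0 + RtoC s)%C
            by (rewrite RtoC_plus; ring).
          apply H3; [intros Q; apply RtoC_inj in Q; contradiction|].
          rewrite Cmod_R. exact S3. }
        destruct Ds as [Ds|Ds]; [contradiction|].
        rewrite (proj1 (mot_off_lattice w1 w2 beta _ Ls)) in Ms.
        set (y := wden w1 w2 beta (RtoC (x + s) + z0)%C) in *.
        assert (One : (y * RtoC (v (x + s)%R) = 1)%C) by (rewrite <- Ms; apply Cinv_r, Ds).
        assert (One' : Cmod y * Rabs (v (x + s)) = 1).
        { rewrite <- Cmod_R, <- Cmod_mult, One. apply Cmod_1. }
        replace (y - 0)%C with y in C1 by ring.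
        rewrite <- RtoC_minus, Cmod_R in C2.
        assert (A := Rabs_triang_inv (v (x + s)) (v x)).
        assert (B : Cmod y * (Rabs (v x) + 1) < / 2).
        { assert (Y := Rabs_pos (v x)).
          replace (/ 2) with (/ 2 / (Rabs (v x) + 1) * (Rabs (v x) + 1)) by (field; lra).
          apply Rmult_lt_compat_r; lra. }
        assert (B' : Cmod y * Rabs (v (x + s)) <= Cmod y * (Rabs (v x) + 1)).
        { apply Rmult_le_compat_l; [apply Cmod_ge_0|lra]. }
        lra. }
      destruct (HD x Dx) as [Q1 Q2].
      split; [exact Jx|]. split; [exact Dx|]. split.
      + apply (pderiv_limit (fun s => mot w1 w2 beta (RtoC s + z0)%C) (fun s => RtoC (v s))
          x _ _ T Q1 (pderiv_real _ _ _ (Hv x Jx))); [|exact Hacc].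
        intros t Tt. apply Tt.
      + apply (pderiv_limit (fun s => mot1 w1 w2 beta (RtoC s + z0)%C) (fun s => RtoC (v1 s))
          x _ _ T Q2 (Hforce x Jx)); [|exact Hacc].
        intros t Tt. apply Tt. }
  intros x Jx. destruct (HT x Jx) as (_ & Dx & Mx & _). split; assumption.
Qed.

(** * Null geodesics of the RNdS metric *)

Definition RNdS_Delta' (lambda M Q r : R) : R :=
  - 2 * lambda * r + 2 * M / r ^ 2 - 2 * Q ^ 2 / r ^ 3.

Lemma is_derive_RNdS_Delta (lambda M Q r : R) : r <> 0 ->
  is_derive (RNdS_Delta lambda M Q) r (RNdS_Delta' lambda M Q r).
Proof.
  intros Hr. unfold RNdS_Delta, RNdS_Delta'. auto_derive.
  - split; [exact Hr|]. split; [|exact I]. rewrite Rmult_1_r. apply Rmult_integral_contrapositive; auto.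
  - field. exact Hr.
Qed.

Lemma partial_RNdS (lambda M Q : R) (x : point) (i j k : coord) :
  RNdS_chart lambda M Q x ->
  partial i (fun y => RNdS lambda M Q y j k) x =
  if coord_eqb j k then
    match i, j with
    | cr, ct => - RNdS_Delta' lambda M Q (x cr)
    | cr, cr => - RNdS_Delta' lambda M Q (x cr) / RNdS_Delta lambda M Q (x cr) ^ 2
    | cr, ctheta => 2 * x cr
    | cr, cphi => 2 * x cr * sin (x ctheta) ^ 2
    | ctheta, cphi => 2 * x cr ^ 2 * sin (x ctheta) * cos (x ctheta)
    | _, _ => 0
    end
  else 0.
Proof.
  intros (Hr & HD & _). assert (Q0 := is_derive_RNdS_Delta lambda M Q (x cr) ltac:(lra)).
  unfold partial, RNdS. destruct (coord_eqb j k) eqn:E; [|apply Derive_const].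
  destruct i, j; cbn -[pow]; try apply Derive_const; apply is_derive_unique.
  - apply (is_derive_opp (V := R_NormedModule)). exact Q0.
  - apply is_derive_inv; [exact Q0|exact HD].
  - auto_derive; [exact I|ring].
  - auto_derive; [exact I|ring].
  - auto_derive; [exact I|ring].
Qed.

Lemma christoffel_r (lambda M Q : R) (x : point) (i j : coord) :
  christoffel (RNdS lambda M Q) (RNdS_inv lambda M Q) x cr i j
  = / 2 * (RNdS_Delta lambda M Q (x cr) *
    (partial i (fun y => RNdS lambda M Q y j cr) x + partial j (fun y => RNdS lambda M Q y i cr) x
     - partial cr (fun y => RNdS lambda M Q y i j) x)).
Proof.
  unfold christoffel, csum. unfold RNdS_inv at 1 2 3 4. cbn [coord_eqb RNdS_diag].
  rewrite Rinv_inv. ring.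
Qed.

(** The time and angular equations enter through the conserved [E] and [L], so the radial component
    is the only geodesic equation that is expanded. *)
Lemma radial_acceleration (lambda M Q : R) (I : R -> Prop) (gamma : curve) (l : R) :
  is_geodesic (RNdS lambda M Q) (RNdS_inv lambda M Q) (RNdS_chart lambda M Q) I gamma ->
  I l -> gamma l ctheta = PI / 2 -> vel gamma l ctheta = 0 ->
  let r := gamma l cr in let D := RNdS_Delta lambda M Q r in
  let D' := RNdS_Delta' lambda M Q r in
  acc gamma l cr = - (D' / 2) * (D * vel gamma l ct ^ 2 - vel gamma l cr ^ 2 / D)
    + r * D * vel gamma l cphi ^ 2.
Proof.
  intros Hg Il Hth Hv r D D'. assert (Hc := geodesic_chart _ _ _ _ _ Hg l Il).
  assert (E := geodesic_eq _ _ _ _ _ Hg l cr Il).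
  assert (HD : D <> 0) by apply Hc.
  unfold csum in E. rewrite Hv, !christoffel_r in E.
  rewrite !partial_RNdS in E by exact Hc. cbn [coord_eqb] in E.
  rewrite Hth, sin_PI2 in E. fold r in E. fold D in E. fold D' in E.
  apply Rminus_diag_uniq. rewrite <- E. field. exact HD.
Qed.

Lemma null_condition (lambda M Q : R) (I : R -> Prop) (gamma : curve) (l : R) :
  is_null (RNdS lambda M Q) I gamma -> I l -> gamma l ctheta = PI / 2 ->
  vel gamma l ctheta = 0 ->
  let r := gamma l cr in let D := RNdS_Delta lambda M Q r in
  D * vel gamma l ct ^ 2 - / D * vel gamma l cr ^ 2 = r ^ 2 * vel gamma l cphi ^ 2.
Proof.
  intros Hn Il Hth Hv r D. specialize (Hn l Il). unfold csum, RNdS in Hn.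
  cbn [coord_eqb RNdS_diag] in Hn. rewrite Hv, Hth, sin_PI2 in Hn. fold r in Hn. fold D in Hn.
  lra.
Qed.

(** * Inverting a monotone smooth function *)

(** [Derive_n] adds each new derivative on the outside, whereas the inductions below know the first
    derivative. Openness of [J] is what allows equality on [J] to pass to higher derivatives. *)
Lemma ex_derive_n_S_intro (J : R -> Prop) (F K : R -> R) (n : nat) : open J ->
  (forall y, J y -> is_derive F y (K y)) -> (forall y, J y -> ex_derive_n K n y) ->
  forall y, J y -> ex_derive_n F (S n) y.
Proof.
  intros HJ HF HK y Jy. destruct n as [|n]; [eexists; apply HF, Jy|].
  apply ex_derive_ext_loc with (Derive_n K n); [|apply HK, Jy].
  apply filter_imp with (2 := HJ y Jy). intros t Jt.
  replace (S n) with (n + 1)%nat by lia. rewrite <- Derive_n_comp.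
  apply Derive_n_ext_loc. apply filter_imp with (2 := HJ t Jt). intros s Js.
  symmetry. apply is_derive_unique, HF, Js.
Qed.

Lemma smooth_on_is_derive (J : R -> Prop) (f : R -> R) (x : R) : smooth_on J f -> J x ->
  is_derive f x (Derive f x).
Proof. intros H Jx. apply Derive_correct, (H 1%nat x Jx). Qed.

Lemma smooth_on_Derive (J : R -> Prop) (f : R -> R) : smooth_on J f -> smooth_on J (Derive f).
Proof.
  intros H n x Jx. destruct n as [|n]; [exact I|].
  apply ex_derive_ext with (Derive_n f (S n)); [|apply (H (S (S n)) x Jx)].
  intros t. replace (S n) with (n + 1)%nat by lia. symmetry. exact (Derive_n_comp f n 1 t).
Qed.

Lemma smooth_on_mult (J : R -> Prop) (f g : R -> R) : open J ->
  smooth_on J f -> smooth_on J g -> smooth_on J (fun x => f x * g x).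
Proof.
  intros HJ Hf Hg.
  (* The factors are generalized because the product rule replaces them by their derivatives, and
     all orders up to [n] are kept because the rule for sums asks for every lower order. *)
  assert (H : forall n f g, smooth_on J f -> smooth_on J g -> forall k, (k <= n)%nat ->
     forall x, J x -> ex_derive_n (fun x => f x * g x) k x).
  { clear f g Hf Hg. induction n as [|n IH]; intros f g Hf Hg k Hk x Jx.
    - replace k with O by lia. exact I.
    - destruct k as [|k]; [exact I|].
      apply (ex_derive_n_S_intro J _ (fun x => Derive f x * g x + f x * Derive g x) k HJ);
        [| |exact Jx].
      + intros y Jy. apply (is_derive_mult (K := R_AbsRing) f g y (Derive f y) (Derive g y));
          [apply (smooth_on_is_derive J); assumption|apply (smooth_on_is_derive J); assumption|].
        intros; apply Rmult_comm.
      + intros y Jy. apply ex_derive_n_plus;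
          (apply filter_imp with (2 := HJ y Jy); intros t Jt j Hj; apply IH; [| |lia|exact Jt]);
          try assumption; apply smooth_on_Derive; assumption. }
  intros n x Jx. apply (H n f g Hf Hg n (Nat.le_refl n) x Jx).
Qed.

Lemma smooth_on_ext (J : R -> Prop) (f g : R -> R) : open J ->
  (forall x, J x -> f x = g x) -> smooth_on J f -> smooth_on J g.
Proof.
  intros HJ E Hf n x Jx. apply ex_derive_n_ext_loc with f; [|apply Hf, Jx].
  apply filter_imp with (2 := HJ x Jx). exact E.
Qed.

Lemma smooth_on_scal (J : R -> Prop) (f : R -> R) (a : R) :
  smooth_on J f -> smooth_on J (fun x => a * f x).
Proof. intros H n x Jx. apply ex_derive_n_scal_l, H, Jx. Qed.

(** The autonomous equation [h' = G (h)] bootstraps regularity: the derivative of [A (h y)] is the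
    function [A' * G], again smooth, evaluated at [h y]. Applied to an inverse function, this gives
    smoothness of every order from a first derivative. *)
Lemma smooth_on_flow (I J : R -> Prop) (h G : R -> R) : open I -> open J ->
  (forall y, J y -> I (h y)) -> smooth_on I G -> (forall y, J y -> is_derive h y (G (h y))) ->
  smooth_on J h.
Proof.
  intros HI HJ Hh HG Hd.
  assert (H : forall n A, smooth_on I A -> forall y, J y -> ex_derive_n (fun y => A (h y)) n y).
  { induction n as [|n IH]; intros A HA y Jy; [exact Logic.I|].
    apply (ex_derive_n_S_intro J _ (fun y => Derive A (h y) * G (h y)) n HJ); [| |exact Jy].
    - intros t Jt. rewrite Rmult_comm.
      apply (is_derive_comp (V := R_NormedModule) A h t (Derive A (h t)) (G (h t))); [|apply Hd, Jt].
      apply (smooth_on_is_derive I); [exact HA|apply Hh, Jt].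
    - intros t Jt. apply (IH (fun x => Derive A x * G x)); [|exact Jt].
      apply smooth_on_mult; [exact HI|apply smooth_on_Derive, HA|exact HG]. }
  intros n y Jy. apply (H n (fun x => x)); [|exact Jy].
  intros m x _. destruct m as [|m]; [exact Logic.I|].
  apply (ex_derive_n_S_intro (fun _ => True) (fun x => x) (fun _ => 1) m).
  - apply open_true.
  - intros t _. apply (is_derive_id (K := R_AbsRing)).
  - intros t _. apply ex_derive_n_const.
  - exact Logic.I.
Qed.

Lemma segment_image (f : R -> R) (a b y : R) : a < b ->
  (forall x, a <= x <= b -> continuity_pt f x) ->
  Rmin (f a) (f b) <= y <= Rmax (f a) (f b) -> exists x, a <= x <= b /\ f x = y.
Proof.
  intros Hab Hc Hy.
  assert (Hend : y = f a \/ y = f b \/ (f a < y < f b \/ f b < y < f a)).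
  { unfold Rmin, Rmax in Hy. destruct (Rle_dec (f a) (f b)); lra. }
  destruct Hend as [->|[->|[H|H]]]; [exists a; lra|exists b; lra| |].
  - destruct (IVT_interv (fun x => f x - y) a b) as (x & Hx & E); try lra.
    + intros x Hx. apply (continuity_pt_minus f (fun _ => y)); [apply Hc, Hx|].
      apply continuity_pt_const. intros ? ?; reflexivity.
    + exists x. split; [exact Hx|lra].
  - destruct (IVT_interv (fun x => y - f x) a b) as (x & Hx & E); try lra.
    + intros x Hx. apply (continuity_pt_minus (fun _ => y) f); [|apply Hc, Hx].
      apply continuity_pt_const. intros ? ?; reflexivity.
    + exists x. split; [exact Hx|lra].
Qed.

(** The constant [s] carries the sign of [f'], so increasing and decreasing functions are treated
    together. *)
Lemma monotone_inverse (I : R -> Prop) (f f' : R -> R) (s : R) : Defs.open_interval I ->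
  (forall x, I x -> is_derive f x (f' x)) -> (forall x, I x -> 0 < s * f' x) ->
  Defs.open_interval (image I f) /\ exists h,
    (forall x, I x -> h (f x) = x) /\
    (forall x, I x -> is_derive h (f x) (/ f' x)).
Proof.
  intros [Io Ic] Hd Hs.
  assert (Hcont : forall x, I x -> continuity_pt f x).
  { intros x Ix. apply continuity_pt_filterlim.
    apply (ex_derive_continuous (K := R_AbsRing) (V := R_NormedModule)).
    eexists. apply Hd, Ix. }
  assert (Hmono : forall x y, I x -> I y -> x < y -> 0 < s * (f y - f x)).
  { intros x y Ix Iy L. destruct (MVT_gen f x y f') as (c & Hc & E).
    - rewrite Rmin_left, Rmax_right by lra. intros z Hz. apply Hd, (Ic x z y); auto; lra.
    - rewrite Rmin_left, Rmax_right by lra. intros z Hz. apply Hcont, (Ic x z y); auto.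
    - rewrite Rmin_left, Rmax_right in Hc by lra. rewrite E.
      assert (Q := Hs c (Ic x c y Ix Iy Hc)). nra. }
  assert (Hinj : forall x y, I x -> I y -> f x = f y -> x = y).
  { intros x y Ix Iy E. destruct (Rtotal_order x y) as [L|[L|L]]; [|exact L|].
    - assert (Q := Hmono x y Ix Iy L). rewrite E in Q. lra.
    - assert (Q := Hmono y x Iy Ix L). rewrite E in Q. lra. }
  (* Small changes of the value come from small changes of the argument: this gives both the
     openness of the image and the continuity of the inverse. *)
  assert (Hnb : forall x d, I x -> 0 < d -> exists e, 0 < e /\ forall k, Rabs k < e ->
     exists t, I t /\ Rabs (t - x) < d /\ f t = f x + k).
  { intros x d Ix Hdp. destruct (Io x Ix) as [d0 Hd0].
    set (m := Rmin (d / 2) (d0 / 2)). assert (P0 := cond_pos d0).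
    assert (Pm : 0 < m) by (apply Rmin_pos; lra).
    assert (M1 : m <= d / 2) by apply Rmin_l. assert (M2 : m <= d0 / 2) by apply Rmin_r.
    assert (HI : forall t, x - m <= t <= x + m -> I t).
    { intros t Ht. apply Hd0. change (Rabs (t - x) < d0). apply Rabs_def1; lra. }
    assert (A1 := Hmono (x - m) x (HI (x - m) ltac:(lra)) Ix ltac:(lra)).
    assert (A2 := Hmono x (x + m) Ix (HI (x + m) ltac:(lra)) ltac:(lra)).
    assert (Sn : s <> 0) by (intros E; rewrite E in A1; lra).
    exists (Rmin (Rabs (f x - f (x - m))) (Rabs (f (x + m) - f x))).
    split.
    { apply Rmin_pos; apply Rabs_pos_lt; intros E; rewrite E in *; lra. }
    intros k Hk.
    assert (K1 : Rabs k < Rabs (f x - f (x - m))) by (eapply Rlt_le_trans; [exact Hk|apply Rmin_l]).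
    assert (K2 : Rabs k < Rabs (f (x + m) - f x)) by (eapply Rlt_le_trans; [exact Hk|apply Rmin_r]).
    destruct (segment_image f (x - m) (x + m) (f x + k)) as (t & Ht & E); [lra| | |].
    - intros t Ht. apply Hcont, HI, Ht.
    - destruct (Rtotal_order s 0) as [L|[L|L]]; [|contradiction|].
      + assert (Sneg : forall a, 0 < s * a -> a < 0)
          by (intros a Ha; apply Rnot_le_lt; intros Q; nra).
        apply Sneg in A1. apply Sneg in A2.
        rewrite (Rabs_left (f x - f (x - m))) in K1 by lra.
        rewrite (Rabs_left (f (x + m) - f x)) in K2 by lra.
        apply Rabs_def2 in K1. apply Rabs_def2 in K2.
        rewrite Rmin_right, Rmax_left by lra. lra.
      + assert (Spos : forall a, 0 < s * a -> 0 < a)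
          by (intros a Ha; apply Rnot_le_lt; intros Q; nra).
        apply Spos in A1. apply Spos in A2.
        rewrite (Rabs_pos_eq (f x - f (x - m))) in K1 by lra.
        rewrite (Rabs_pos_eq (f (x + m) - f x)) in K2 by lra.
        apply Rabs_def2 in K1. apply Rabs_def2 in K2.
        rewrite Rmin_left, Rmax_right by lra. lra.
    - exists t. split; [apply HI, Ht|]. split; [|exact E]. apply Rabs_def1; lra. }
  split.
  { split.
    - intros y (x & Ix & <-). destruct (Hnb x 1 Ix ltac:(lra)) as (e & He & H).
      exists (mkposreal e He). intros z Hz. destruct (H (z - f x) Hz) as (t & It & _ & E).
      exists t. split; [exact It|]. rewrite E. ring.
    - intros x y z (a & Ia & Ea) (b & Ib & Eb) Hy.
      destruct (Req_dec a b) as [E|N]; [exists a; split; [exact Ia|]; subst; lra|].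
      destruct (segment_image f (Rmin a b) (Rmax a b) y) as (t & Ht & E).
      + unfold Rmin, Rmax. destruct (Rle_dec a b); lra.
      + intros t Ht. apply Hcont. unfold Rmin, Rmax in Ht.
        destruct (Rle_dec a b); [apply (Ic a t b)|apply (Ic b t a)]; assumption.
      + unfold Rmin, Rmax. destruct (Rle_dec a b), (Rle_dec _ _); lra.
      + exists t. split; [|exact E]. unfold Rmin, Rmax in Ht.
        destruct (Rle_dec a b); [apply (Ic a t b)|apply (Ic b t a)]; assumption. }
  (* Off the image the arbitrary value 0 is chosen, which makes [h] total. *)
  assert (Hh : forall y, exists x, image I f y -> I x /\ f x = y).
  { intros y. destruct (classic (image I f y)) as [(x & Ix)|N]; [exists x; auto|exists 0; tauto]. }
  set (h := fun y => proj1_sig (constructive_indefinite_description _ (Hh y))).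
  assert (Hhs : forall y, image I f y -> I (h y) /\ f (h y) = y).
  { intros y. exact (proj2_sig (constructive_indefinite_description _ (Hh y))). }
  assert (Hhf : forall x, I x -> h (f x) = x).
  { intros x Ix. destruct (Hhs (f x)) as [I1 I2]; [exists x; auto|]. apply Hinj; assumption. }
  exists h. split; [exact Hhf|].
  intros x Ix. assert (Df := Hd x Ix). assert (Sx := Hs x Ix).
  set (m := f' x) in *. assert (Nm : m <> 0) by (intros E; rewrite E in Sx; lra).
  assert (Pm : 0 < Rabs m) by (apply Rabs_pos_lt, Nm).
  apply is_derive_Reals. apply is_derive_Reals in Df. intros eps He.
  (* The first bound yields [|m u| <= 2 |k|] for the argument step [u] and value step [k]; with it
     the second keeps the error of the inverse quotient at most [eps / 2]. *)
  set (eta := Rmin (Rabs m / 2) (eps * Rabs m ^ 2 / 4)).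
  assert (Pm2 : 0 < Rabs m ^ 2) by (apply pow_lt, Pm).
  assert (Pe : 0 < eta) by (apply Rmin_pos; nra).
  assert (E1 : eta <= Rabs m / 2) by apply Rmin_l.
  assert (E2 : eta <= eps * Rabs m ^ 2 / 4) by apply Rmin_r.
  destruct (Df eta Pe) as [d Hdd]. destruct (Hnb x d Ix (cond_pos d)) as (e & Pe' & H).
  exists (mkposreal e Pe'). intros k Nk Hk. simpl in Hk.
  destruct (H k Hk) as (t & It & Ht & Et). rewrite <- Et, (Hhf t It), (Hhf x Ix).
  set (u := t - x) in *.
  assert (Nu : u <> 0).
  { intros E. apply Nk. assert (t = x) by (unfold u in E; lra). subst t. lra. }
  specialize (Hdd u Nu Ht). replace (x + u) with t in Hdd by (unfold u; ring).
  rewrite Et in Hdd. replace ((f x + k - f x) / u - m) with ((k - m * u) / u) in Hdd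
    by (field; exact Nu).
  assert (Pu : 0 < Rabs u) by (apply Rabs_pos_lt, Nu).
  assert (Pk : 0 < Rabs k) by (apply Rabs_pos_lt, Nk).
  rewrite Rabs_div in Hdd by exact Nu.
  assert (B1 : Rabs (k - m * u) < eta * Rabs u).
  { apply Rmult_lt_reg_r with (/ Rabs u); [apply Rinv_0_lt_compat, Pu|].
    replace (eta * Rabs u * / Rabs u) with eta by (field; lra). exact Hdd. }
  assert (B2 : Rabs m * Rabs u <= 2 * Rabs k).
  { assert (T := Rabs_triang_inv (m * u) (m * u - k)).
    replace (m * u - (m * u - k)) with k in T by ring.
    rewrite Rabs_mult, (Rabs_minus_sym (m * u)) in T. nra. }
  replace (u / k - / m) with (- (k - m * u) / (k * m)) by (field; auto).
  rewrite Rabs_div by (apply Rmult_integral_contrapositive; auto).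
  rewrite Rabs_Ropp, Rabs_mult.
  apply Rmult_lt_reg_r with (Rabs k * Rabs m); [nra|].
  replace (Rabs (k - m * u) / (Rabs k * Rabs m) * (Rabs k * Rabs m))
    with (Rabs (k - m * u)) by (field; lra).
  assert (B3 : eta * Rabs u <= eps * Rabs m / 4 * (Rabs m * Rabs u)) by nra.
  assert (B4 : eps * Rabs m / 4 * (Rabs m * Rabs u) <= eps * Rabs m / 4 * (2 * Rabs k))
    by (apply Rmult_le_compat_l; nra).
  assert (0 < eps * Rabs m * Rabs k) by (repeat apply Rmult_lt_0_compat; assumption).
  lra.
Qed.

(** * The polar equation *)

Definition quartic (delta M Q x : R) : R := delta * x ^ 4 - x ^ 2 + 2 * M * x - Q ^ 2.

Lemma is_derive_locally_const (I : R -> Prop) (f : R -> R) (c l : R) : open I -> I l ->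
  (forall x, I x -> f x = c) -> is_derive f l 0.
Proof.
  intros Io Il H. apply is_derive_ext_loc with (fun _ => c).
  - apply filter_imp with (2 := Io l Il). intros x Ix. symmetry. apply H, Ix.
  - apply (is_derive_const (V := R_NormedModule)).
Qed.

Lemma is_derive_sq_mult_div (A B : R -> R) (c t a b : R) : c <> 0 ->
  is_derive A t a -> is_derive B t b ->
  is_derive (fun s => A s ^ 2 * B s / c) t ((2 * A t * a * B t + A t ^ 2 * b) / c).
Proof.
  intros Hc HA HB. auto_derive.
  - split; [eexists; exact HA|]. split; [eexists; exact HB|exact Logic.I].
  - replace (Derive (fun s => A s) t) with a by (symmetry; apply is_derive_unique, HA).
    replace (Derive (fun s => B s) t) with b by (symmetry; apply is_derive_unique, HB).
    field. exact Hc.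
Qed.

(** Since [d/dphi] is [(r ^ 2 / L) d/dl], the last two identities are the equations for [rdot ^ 2]
    and [rddot]. The latter holds at turning points as well, where differentiating the former only
    gives [0 = 0]. *)
Lemma equatorial_null_geodesic (lambda M Q : R) (I : R -> Prop) (gamma : curve) (E L : R) :
  is_null_geodesic lambda M Q I gamma -> equatorial I gamma ->
  has_energy lambda M Q I gamma E -> has_angular_momentum I gamma L -> L <> 0 ->
  forall l, I l -> let r := gamma l cr in
    0 < r /\
    vel gamma l cphi = L / r ^ 2 /\
    (r ^ 2 * vel gamma l cr / L) ^ 2 = quartic (lambda + E ^ 2 / L ^ 2) M Q r /\
    (2 * r * vel gamma l cr ^ 2 + r ^ 2 * acc gamma l cr) * r ^ 2 / L ^ 2
      = 2 * (lambda + E ^ 2 / L ^ 2) * r ^ 3 - r + M.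
Proof.
  intros [Hg Hn] Heq HE HL L0 l Il r.
  destruct (geodesic_chart _ _ _ _ _ Hg l Il) as (Hr & HD & _). fold r in Hr, HD.
  destruct (geodesic_interval _ _ _ _ _ Hg) as [Io _].
  assert (Vth : vel gamma l ctheta = 0).
  { apply is_derive_unique, (is_derive_locally_const I _ (PI / 2)); assumption. }
  assert (N := null_condition lambda M Q I gamma l Hn Il (Heq l Il) Vth).
  assert (A := radial_acceleration lambda M Q I gamma l Hg Il (Heq l Il) Vth).
  assert (El := HE l Il). assert (Ll := HL l Il). cbv zeta in N, A. fold r in N, A, El, Ll.
  set (D := RNdS_Delta lambda M Q r) in *. set (D' := RNdS_Delta' lambda M Q r) in *.
  set (ut := vel gamma l ct) in *. set (ur := vel gamma l cr) in *.
  set (up := vel gamma l cphi) in *. set (ar := acc gamma l cr) in *.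
  assert (Eup : up = L / r ^ 2) by (rewrite <- Ll; field; lra).
  assert (Eut : ut = E / D) by (rewrite <- El; field; exact HD).
  assert (Eur : ur ^ 2 = E ^ 2 - D * L ^ 2 / r ^ 2).
  { rewrite Eut, Eup in N.
    replace (ur ^ 2) with (D * (D * (E / D) ^ 2 - (D * (E / D) ^ 2 - / D * ur ^ 2)))
      by (field; exact HD).
    rewrite N. field. split; [lra|exact HD]. }
  split; [exact Hr|]. split; [exact Eup|]. split.
  - replace ((r ^ 2 * ur / L) ^ 2) with (r ^ 4 * ur ^ 2 / L ^ 2) by (field; exact L0).
    rewrite Eur. unfold quartic, D, RNdS_Delta. field. split; [exact L0|lra].
  - assert (Ear : ar = L ^ 2 * (D / r ^ 3 - D' / (2 * r ^ 2))).
    { rewrite A, Eut, Eup, Eur. field. split; [lra|exact HD]. }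
    rewrite Ear, Eur. unfold D, D', RNdS_Delta, RNdS_Delta'. field. split; [exact L0|lra].
Qed.

Lemma quartic_root_ex (delta M Q x : R) : 0 < x -> 0 <= quartic delta M Q x ->
  exists y, quartic delta M Q y = 0.
Proof.
  intros Hx H.
  destruct (segment_image (quartic delta M Q) 0 x 0) as (y & _ & E); [exact Hx| | |].
  - intros t _. apply continuity_pt_filterlim.
    apply (ex_derive_continuous (K := R_AbsRing) (V := R_NormedModule)).
    unfold quartic. auto_derive. exact Logic.I.
  - assert (Q0 : quartic delta M Q 0 <= 0).
    { unfold quartic. assert (Y := pow2_ge_0 Q). lra. }
    rewrite Rmin_left, Rmax_right by lra. lra.
  - exists y. exact E.
Qed.

Lemma weierstrass_identity (delta M Q rb r s : R) : quartic delta M Q rb = 0 ->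
  s ^ 2 = quartic delta M Q r -> r <> rb ->
  let c := 4 * rb * delta in
  let beta := 6 * rb ^ 2 * delta - 1 in
  let alpha := 4 * rb ^ 3 * delta - 2 * rb + 2 * M in
  let g2 := / 4 * (beta ^ 2 / 3 - alpha * c) in
  let g3 := / 8 * (alpha * beta * c / 6 - alpha ^ 2 * delta / 2 - beta ^ 3 / 27) in
  let p := alpha / (4 * (r - rb)) + beta / 12 in
  (- (alpha * s) / (4 * (r - rb) ^ 2)) ^ 2 = 4 * p ^ 3 - g2 * p - g3.
Proof.
  intros H0 Hs Hne. cbv zeta.
  replace ((- ((4 * rb ^ 3 * delta - 2 * rb + 2 * M) * s) / (4 * (r - rb) ^ 2)) ^ 2)
    with ((4 * rb ^ 3 * delta - 2 * rb + 2 * M) ^ 2 * s ^ 2 / (16 * (r - rb) ^ 4))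
    by (field; lra).
  rewrite Hs.
  (* Subtracting the zero value at the root eliminates [Q] and makes [r - rb] a factor, which turns
     the claim into a rational identity. *)
  replace (quartic delta M Q r) with (quartic delta M Q r - quartic delta M Q rb) by lra.
  unfold quartic. field. lra.
Qed.

(** [alpha] is the derivative of the quartic at [rbar], and the statement is the case [alpha = 0]:
    at a multiple root the Weierstrass cubic degenerates. *)
Lemma discriminant_simple_root (beta c delta : R) :
  (/ 4 * (beta ^ 2 / 3 - 0 * c)) ^ 3
  - 27 * (/ 8 * (0 * beta * c / 6 - 0 ^ 2 * delta / 2 - beta ^ 3 / 27)) ^ 2 = 0.
Proof. field. Qed.

Lemma weierstrass_motion_ex (delta M Q rb : R) (J : R -> Prop) (r r1 : R -> R)
    (w1 w2 : C) (a : R) :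
  let c := 4 * rb * delta in
  let beta := 6 * rb ^ 2 * delta - 1 in
  let alpha := 4 * rb ^ 3 * delta - 2 * rb + 2 * M in
  let g2 := / 4 * (beta ^ 2 / 3 - alpha * c) in
  let g3 := / 8 * (alpha * beta * c / 6 - alpha ^ 2 * delta / 2 - beta ^ 3 / 27) in
  quartic delta M Q rb = 0 -> alpha <> 0 -> Defs.open_interval J ->
  (forall x, J x -> is_derive r x (r1 x)) ->
  (forall x, J x -> r1 x ^ 2 = quartic delta M Q (r x)) ->
  (forall x, J x -> is_derive r1 x (2 * delta * r x ^ 3 - r x + M)) ->
  J a -> r a <> rb -> has_invariants w1 w2 g2 g3 ->
  exists z0, weierstrass_motion w1 w2 rb alpha beta J r z0.
Proof.
  intros c beta alpha g2 g3 H0 Ha HJ Hr Hr2 Hr1 Ja Hne (HB & E2 & E3).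
  set (v := fun x => (r x - rb) / alpha). set (v1 := fun x => r1 x / alpha).
  set (p0 := alpha / (4 * (r a - rb)) + beta / 12).
  assert (Va : v a <> 0).
  { unfold v. intros Q0. apply Hne.
    replace (r a) with ((r a - rb) / alpha * alpha + rb) by (field; exact Ha). rewrite Q0. ring. }
  assert (Hne' : r a - rb <> 0) by lra.
  assert (Id := weierstrass_identity delta M Q rb (r a) (r1 a) H0 (Hr2 a Ja) Hne).
  cbv zeta in Id. fold c in Id. fold beta in Id. fold alpha in Id. fold g2 in Id. fold g3 in Id.
  fold p0 in Id.
  (* [p0] and [dp] are the value and the derivative of [P] at [a]; [Id] says that this pair lies on
     the Weierstrass cubic. *)
  set (dp := - (alpha * r1 a) / (4 * (r a - rb) ^ 2)) in *.
  assert (Hz1 : exists z1, ~ in_lattice w1 w2 z1 /\ wp w1 w2 z1 = RtoC p0 /\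
            wp1 w1 w2 z1 = RtoC dp).
  { destruct (wp_surjective w1 w2 (RtoC p0) HB) as (z1 & L1 & W1).
    assert (O := wp_ode1 w1 w2 HB z1 L1).
    rewrite E2, E3, W1, <- !RtoC_pow, <- !RtoC_mult, <- !RtoC_minus, <- Id, RtoC_pow in O.
    assert (F : ((wp1 w1 w2 z1 - RtoC dp) * (wp1 w1 w2 z1 + RtoC dp) = 0)%C).
    { transitivity (wp1 w1 w2 z1 ^ 2 - RtoC dp ^ 2)%C; [ring|rewrite O; ring]. }
    destruct (Ceq_dec (wp1 w1 w2 z1 - RtoC dp)%C 0%C) as [F1|F1].
    - exists z1. split; [exact L1|]. split; [exact W1|].
      replace (wp1 w1 w2 z1) with (wp1 w1 w2 z1 - RtoC dp + RtoC dp)%C by ring.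
      rewrite F1. ring.
    - exists (- z1)%C.
      assert (L1' : ~ in_lattice w1 w2 (- z1)%C).
      { intros L. apply L1. replace z1 with (- - z1)%C by ring. apply in_lattice_opp, L. }
      split; [exact L1'|]. rewrite wp_even, wp1_odd by assumption. split; [exact W1|].
      assert (F2 : (wp1 w1 w2 z1 + RtoC dp = 0)%C).
      { destruct (Ceq_dec (wp1 w1 w2 z1 + RtoC dp)%C 0%C) as [F2|F2]; [exact F2|].
        exfalso. exact (Cmult_neq_0 _ _ F1 F2 F). }
      replace (- wp1 w1 w2 z1)%C with (RtoC dp - (wp1 w1 w2 z1 + RtoC dp))%C by ring.
      rewrite F2. ring. }
  destruct Hz1 as (z1 & L1 & W1 & W1').
  set (z0 := (z1 - RtoC a)%C).
  assert (Ez : (RtoC a + z0)%C = z1) by (unfold z0; ring).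
  assert (Dz : wden w1 w2 beta z1 = RtoC (/ v a)).
  { unfold wden. rewrite W1, <- RtoC_mult, <- RtoC_minus. f_equal. unfold p0, v.
    field. split; assumption. }
  assert (Dz0 : wden w1 w2 beta z1 <> 0%C).
  { rewrite Dz. intros Q0. apply RtoC_inj in Q0. apply (Rinv_neq_0_compat _ Va), Q0. }
  exists z0.
  assert (K := mot_matches w1 w2 z0 beta (alpha * c) (alpha ^ 2 * delta) g2 g3 J v v1 a HB E2 E3).
  assert (HM : forall x, J x -> mot_defined w1 w2 beta (RtoC x + z0)%C /\
     mot w1 w2 beta (RtoC x + z0)%C = RtoC (v x)).
  { apply K; clear K.
    - reflexivity.
    - unfold g3. field.
    - exact HJ.
    - intros x Jx. apply is_derive_ext with (fun t => / alpha * (r t - rb));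
        [intros t; unfold v; simpl; field; exact Ha|].
      replace (v1 x) with (/ alpha * (r1 x - 0)) by (unfold v1; field; exact Ha).
      apply is_derive_scal, (is_derive_minus (V := R_NormedModule) r (fun _ => rb));
        [apply Hr, Jx|apply (is_derive_const (V := R_NormedModule))].
    - intros x Jx. apply is_derive_ext with (fun t => / alpha * r1 t);
        [intros t; unfold v1; simpl; field; exact Ha|].
      replace (/ 2 + beta * v x + 3 / 2 * (alpha * c) * v x ^ 2 + 2 * (alpha ^ 2 * delta) * v x ^ 3)
        with (/ alpha * (2 * delta * r x ^ 3 - r x + M)); [apply is_derive_scal, Hr1, Jx|].
      assert (Er : r x = rb + alpha * v x) by (unfold v; field; exact Ha).
      rewrite Er. set (y := v x).
      apply Rmult_eq_reg_l with alpha; [|exact Ha].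
      rewrite <- Rmult_assoc, Rinv_r, Rmult_1_l by exact Ha.
      (* Trading [M] for [alpha] leaves a polynomial identity in independent quantities. *)
      replace M with (alpha / 2 - 2 * delta * rb ^ 3 + rb) by (unfold alpha; field).
      unfold beta, c. field.
    - exact Ja.
    - rewrite Ez. right. exact Dz0.
    - rewrite Ez, (proj1 (mot_off_lattice w1 w2 beta z1 L1)), Dz.
      rewrite <- RtoC_inv by (apply Rinv_neq_0_compat, Va). rewrite Rinv_inv. reflexivity.
    - rewrite Ez, (proj2 (mot_off_lattice w1 w2 beta z1 L1)), Dz, W1'.
      rewrite <- RtoC_mult, <- RtoC_opp, <- RtoC_pow, <- RtoC_div.
      + f_equal. unfold dp, v, v1. field. repeat split; assumption.
      + apply pow_nonzero, Rinv_neq_0_compat, Va. }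
  intros x Jx. cbv zeta. destruct (HM x Jx) as [Dx Mx]. split.
  - intros Lx. rewrite (proj1 (mot_lattice w1 w2 beta _ Lx)) in Mx. apply RtoC_inj in Mx.
    replace (r x) with (v x * alpha + rb) by (unfold v; field; exact Ha). rewrite <- Mx. ring.
  - intros Lx. destruct Dx as [Dx|Dx]; [contradiction|]. split; [exact Dx|].
    rewrite (proj1 (mot_off_lattice w1 w2 beta _ Lx)) in Mx. unfold Cdiv.
    change (4 * wp w1 w2 (x + z0) - RtoC (beta / 3))%C with (wden w1 w2 beta (RtoC x + z0)).
    rewrite Mx, <- RtoC_mult, <- RtoC_plus. f_equal. unfold v. field. exact Ha.
Qed.

Theorem proposition4p2p1
  (lambda M Q : R) (hM : 0 <= M) (hQ : 0 <= Q)
  (I : R -> Prop) (gamma : curve) (E L : R)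
  (hgeod : is_null_geodesic lambda M Q I gamma)
  (heq : equatorial I gamma)
  (hcirc : ~ circular I gamma)
  (hrad : ~ radial I gamma)
  (hE : has_energy lambda M Q I gamma E)
  (hL : has_angular_momentum I gamma L) :
  diffeo_onto_image I (fun l => gamma l cphi) /\
  forall r : R -> R,
    (forall l, I l -> r (gamma l cphi) = gamma l cr) ->
    lambda >= - (E ^ 2 / L ^ 2) ->
    let J := image I (fun l => gamma l cphi) in
    let delta := lambda + E ^ 2 / L ^ 2 in
    let root x := delta * x ^ 4 - x ^ 2 + 2 * M * x - Q ^ 2 = 0 in
    (exists rbar : R, root rbar) /\
    forall rbar : R, root rbar ->
      let c := 4 * rbar * delta in
      let beta := 6 * rbar ^ 2 * delta - 1 in
      let alpha := 4 * rbar ^ 3 * delta - 2 * rbar + 2 * M in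
      let g2 := / 4 * (beta ^ 2 / 3 - alpha * c) in
      let g3 := / 8 * (alpha * beta * c / 6 - alpha ^ 2 * delta / 2
                       - beta ^ 3 / 27) in
      let P phi := alpha / (4 * (r phi - rbar)) + beta / 12 in
      (forall phi, J phi -> r phi <> rbar ->
         ex_derive P phi /\
         Derive P phi ^ 2 = 4 * P phi ^ 3 - g2 * P phi - g3) /\
      (g2 ^ 3 - 27 * g3 ^ 2 <> 0 ->
       forall w1 w2 : C, has_invariants w1 w2 g2 g3 ->
       exists z0 : C, weierstrass_motion w1 w2 rbar alpha beta J r z0).
Proof.
  assert (Hg := proj1 hgeod). assert (HI := geodesic_interval _ _ _ _ _ Hg).
  destruct HI as [Io Ic].
  set (J := image I (fun l => gamma l cphi)).
  assert (L0 : L <> 0).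
  { intros E0. apply hrad. intros l Il. assert (Q0 := hL l Il). rewrite E0 in Q0.
    destruct (geodesic_chart _ _ _ _ _ Hg l Il) as (Hr & _).
    apply Rmult_integral in Q0. destruct Q0 as [Q0|Q0]; [|exact Q0].
    exfalso. revert Q0. apply pow_nonzero. lra. }
  assert (Hdyn := equatorial_null_geodesic lambda M Q I gamma E L hgeod heq hE hL L0).
  assert (Hsm : forall i, smooth_on I (fun l => gamma l i)) by exact (geodesic_smooth _ _ _ _ _ Hg).
  assert (Hder : forall i l, I l -> is_derive (fun l => gamma l i) l (vel gamma l i)).
  { intros i l Il. apply (smooth_on_is_derive I); [apply Hsm|exact Il]. }
  assert (Hder2 : forall l, I l -> is_derive (fun l => vel gamma l cr) l (acc gamma l cr)).
  { intros l Il. apply (smooth_on_is_derive I (Derive (fun l => gamma l cr)));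
      [apply smooth_on_Derive, Hsm|exact Il]. }
  (* [L] itself serves as the sign, because [L] times the angular velocity is [(L / r) ^ 2]. *)
  destruct (monotone_inverse I (fun l => gamma l cphi) (fun l => vel gamma l cphi) L)
    as [HJ (h & Hh & Hdh)].
  { split; assumption. }
  { apply Hder. }
  { intros l Il. destruct (Hdyn l Il) as (Hr & -> & _).
    replace (L * (L / gamma l cr ^ 2)) with ((L / gamma l cr) ^ 2) by (field; lra).
    apply pow2_gt_0. apply Rmult_integral_contrapositive. split; [exact L0|].
    apply Rinv_neq_0_compat. lra. }
  fold J in HJ.
  assert (HhJ : forall y, J y -> I (h y) /\ gamma (h y) cphi = y).
  { intros y (l & Il & <-). rewrite (Hh l Il). split; [exact Il|reflexivity]. }
  assert (Hdh' : forall y, J y -> is_derive h y (gamma (h y) cr ^ 2 / L)).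
  { intros y Jy. destruct (HhJ y Jy) as [Ih Eh]. assert (Q0 := Hdh (h y) Ih).
    simpl in Q0. rewrite Eh in Q0. destruct (Hdyn (h y) Ih) as (Hr & Ev & _).
    rewrite Ev in Q0.
    replace (gamma (h y) cr ^ 2 / L) with (/ (L / gamma (h y) cr ^ 2)); [exact Q0|].
    field. split; [exact L0|lra]. }
  split.
  { split; [apply Hsm|]. split; [exact (proj1 HJ)|]. exists h. split; [exact Hh|].
    apply (smooth_on_flow I J h (fun l => gamma l cr ^ 2 / L)); try assumption.
    - exact (proj1 HJ).
    - intros y Jy. apply HhJ, Jy.
    - apply smooth_on_ext with (fun l => / L * (gamma l cr * gamma l cr)); [exact Io| |].
      + intros l _. field. exact L0.
      + apply smooth_on_scal, smooth_on_mult; [exact Io|apply Hsm|apply Hsm]. }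
  intros r Hr _. cbv zeta. fold J. set (delta := lambda + E ^ 2 / L ^ 2) in *.
  assert (HrJ : forall y, J y -> r y = gamma (h y) cr).
  { intros y Jy. destruct (HhJ y Jy) as [Ih Eh]. rewrite <- (Hr (h y) Ih), Eh. reflexivity. }
  (* The polar derivative of [r], written through the affine parameter so that the geodesic equation
     can differentiate it once more. *)
  set (r1 := fun y => gamma (h y) cr ^ 2 * vel gamma (h y) cr / L).
  assert (Dr : forall y, J y -> is_derive r y (r1 y)).
  { intros y Jy. apply is_derive_ext_loc with (fun y => gamma (h y) cr).
    - apply filter_imp with (2 := proj1 HJ y Jy). intros t Jt. symmetry. apply HrJ, Jt.
    - replace (r1 y) with (gamma (h y) cr ^ 2 / L * vel gamma (h y) cr)
        by (unfold r1; field; exact L0).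
      apply (is_derive_comp (V := R_NormedModule) (fun l => gamma l cr) h); [|apply Hdh', Jy].
      apply Hder, HhJ, Jy. }
  assert (Dr2 : forall y, J y -> r1 y ^ 2 = quartic delta M Q (r y)).
  { intros y Jy. rewrite (HrJ y Jy). destruct (Hdyn (h y)) as (_ & _ & Q0 & _);
      [apply HhJ, Jy|exact Q0]. }
  assert (Dr1 : forall y, J y -> is_derive r1 y (2 * delta * r y ^ 3 - r y + M)).
  { intros y Jy. rewrite (HrJ y Jy). destruct (HhJ y Jy) as [Ih _].
    destruct (Hdyn (h y) Ih) as (_ & _ & _ & Q0). fold delta in Q0. rewrite <- Q0.
    set (k := fun l => gamma l cr ^ 2 * vel gamma l cr / L).
    assert (Dk : is_derive k (h y) ((2 * gamma (h y) cr * vel gamma (h y) cr ^ 2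
        + gamma (h y) cr ^ 2 * acc gamma (h y) cr) / L)).
    { assert (A1 := Hder cr (h y) Ih). assert (A2 := Hder2 (h y) Ih).
      replace (2 * gamma (h y) cr * vel gamma (h y) cr ^ 2)
        with (2 * gamma (h y) cr * vel gamma (h y) cr * vel gamma (h y) cr) by ring.
      exact (is_derive_sq_mult_div _ _ L (h y) _ _ L0 A1 A2). }
    replace ((2 * gamma (h y) cr * vel gamma (h y) cr ^ 2 + gamma (h y) cr ^ 2 * acc gamma (h y) cr)
        * gamma (h y) cr ^ 2 / L ^ 2)
      with (gamma (h y) cr ^ 2 / L * ((2 * gamma (h y) cr * vel gamma (h y) cr ^ 2
        + gamma (h y) cr ^ 2 * acc gamma (h y) cr) / L)) by (field; exact L0).
    apply (is_derive_comp (V := R_NormedModule) k h); [exact Dk|apply Hdh', Jy]. }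
  (* Non-circularity is used twice in this form: with the arbitrary value 0 to obtain some point of
     [J], and with [rbar] to obtain a point where [P] is finite. *)
  assert (Hnonconst : forall x, exists y, J y /\ r y <> x).
  { intros x. apply NNPP. intros N. apply hcirc. exists x. intros l Il.
    apply NNPP. intros Q0. apply N. exists (gamma l cphi).
    split; [exists l; auto|]. rewrite (Hr l Il). exact Q0. }
  split.
  { destruct (Hnonconst 0) as (y & Jy & _).
    apply (quartic_root_ex delta M Q (r y)).
    - rewrite (HrJ y Jy). apply (Hdyn (h y)), HhJ, Jy.
    - rewrite <- (Dr2 y Jy). apply pow2_ge_0. }
  intros rbar Hroot. split.
  - intros y Jy Hne.
    set (alpha := 4 * rbar ^ 3 * delta - 2 * rbar + 2 * M).
    set (beta := 6 * rbar ^ 2 * delta - 1).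
    assert (DP : is_derive (fun phi => alpha / (4 * (r phi - rbar)) + beta / 12) y
      (- (alpha * r1 y) / (4 * (r y - rbar) ^ 2))).
    { assert (A1 := Dr y Jy). auto_derive.
      - split; [eexists; exact A1|]. split; [|exact Logic.I]. lra.
      - replace (Derive (fun x => r x) y) with (r1 y) by (symmetry; apply is_derive_unique, A1).
        field. lra. }
    split; [eexists; exact DP|].
    transitivity ((- (alpha * r1 y) / (4 * (r y - rbar) ^ 2)) ^ 2);
      [f_equal; exact (is_derive_unique _ _ _ DP)|].
    apply (weierstrass_identity delta M Q rbar (r y) (r1 y) Hroot (Dr2 y Jy) Hne).
  - intros Hdisc w1 w2 Hinv. destruct (Hnonconst rbar) as (a & Ja & Hne).
    apply (weierstrass_motion_ex delta M Q rbar J r r1 w1 w2 a); try assumption.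
    intros Ea. apply Hdisc. rewrite Ea. apply discriminant_simple_root.
Qed.
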